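(* Let $(M,J)$ be a compact complex manifold of complex dimension $n\geq 2$. Then $M$ does not admit a negative projectively flat metric.
   Context: Let $h$ be a Hermitian metric on the holomorphic tangent bundle of a complex manifold $(M,J)$ ($J$ integrable) of complex dimension $n$. In local holomorphic coordinates its Chern curvature tensor is $$\Theta_{i\bar j k\bar l} = -\frac{\partial^2 h_{i\bar j}}{\partial z^k\partial\bar z^l} + h^{p\bar q}\frac{\partial h_{i\bar q}}{\partial z^k}\frac{\partial h_{p\bar j}}{\partial\bar z^l}.$$ The first Ricci tensor is $\Theta^{(1)}_{k\bar l} = h^{i\bar j}\Theta_{i\bar jk\bar l}$, and the Chern scalar curvature is $s_{[h]} = h^{k\bar l}\Theta^{(1)}_{k\bar l}$. The metric $h$ is called projectively flat if $\Theta_{i\bar jk\bar l} = \frac1n\,\Theta^{(1)}_{k\bar l}\,h_{i\bar j}$. If $h$ is projectively flat, so is $\exp(u)h$ for every $u\in C^\infty(M;\mathbb R)$. The conformal class of $h$ is $\{h\}=\{\exp(u)h : u\in C^\infty(M;\mathbb R)\}$. A projectively flat metric $h$ is called negative projectively flat if there is $\tilde h\in\{h\}$ whose Chern scalar curvature $s_{[\tilde h]}$ is a (everywhere) negative function on $M$. *)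

(* Defs.v *)
From HB Require Import structures.
From mathcomp Require Import all_boot all_order all_algebra.
From mathcomp Require Import complex.
From mathcomp Require Import all_classical all_reals all_analysis.

Set Implicit Arguments.
Unset Strict Implicit.
Unset Printing Implicit Defensive.

Import Order.TTheory GRing.Theory Num.Theory.
Import numFieldNormedType.Exports.

Local Open Scope classical_set_scope.
Local Open Scope ring_scope.
Local Open Scope sesquilinear_scope.

(* The topology of C = R[i] given by its norm, as the library provides it for
   abstract numeric fields. *)
HB.instance Definition _ (R : realType) :=
  PseudoPointedMetric.copy R[i] (R[i]^o : pseudoPMetricType R[i]).
HB.instance Definition _ (R : realType) := GRing.ComAlgebra.copy R[i] R[i]^o.
HB.instance Definition _ (R : realType) := Vector.copy R[i] R[i]^o.
HB.instance Definition _ (R : realType) := NormedModule.copy R[i] R[i]^o.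

Section RealSmoothness.
Context {R : realType} {n : nat}.
Local Notation C := (R[i]).
Implicit Types (f : 'rV[C]_n -> C) (U : set 'rV[C]_n) (v z : 'rV[C]_n).

(* The library's [derivable] and ['D_v] on 'rV[C]_n are complex derivatives
   (the increment ranges over C).  Here the increment t is real, so that
   non-holomorphic functions can be differentiated. *)
Definition rderivable f v z : Prop :=
  derivable (fun t : R => complex.Re (f (z + t%:C%C *: v))) 0 1 /\
  derivable (fun t : R => complex.Im (f (z + t%:C%C *: v))) 0 1.

Definition rderive v f z : C :=
  (derive1 (fun t : R => complex.Re (f (z + t%:C%C *: v))) 0 +i*
   derive1 (fun t : R => complex.Im (f (z + t%:C%C *: v))) 0)%C.

Fixpoint rdiff_class (k : nat) U f : Prop :=
  (forall z, U z -> {for z, continuous f}) /\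
  if k is k'.+1 then
    forall v, (forall z, U z -> rderivable f v z) /\
              rdiff_class k' U (rderive v f)
  else True.

(* [U] is meant to be open. *)
Definition rsmooth U f : Prop := forall k, rdiff_class k U f.

(* d/dz^k = (d/dx^k - i d/dy^k) / 2 and its conjugate, where x^k and y^k are
   the directions e_k and i e_k. *)
Definition dz (k : 'I_n) f z : C :=
  (rderive (delta_mx 0 k) f z - 'i%C * rderive ('i%C *: delta_mx 0 k) f z) / 2.

Definition dzbar (k : 'I_n) f z : C :=
  (rderive (delta_mx 0 k) f z + 'i%C * rderive ('i%C *: delta_mx 0 k) f z) / 2.

End RealSmoothness.

Section ChernCurvature.
Context {R : realType} {n : nat}.
Local Notation C := (R[i]).
Implicit Types (H : 'rV[C]_n -> 'M[C]_n) (z : 'rV[C]_n) (i j k l : 'I_n).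

(* [H z i j] is h_{i \bar j}; since h^{p \bar q} h_{i \bar q} = delta^p_i,
   the coefficient h^{p \bar q} is [invmx (H z) q p]. *)
Definition chern_curvature H i j k l z : C :=
  - dz k (dzbar l (fun w => H w i j)) z
  + \sum_p \sum_q invmx (H z) q p
                  * dz k (fun w => H w i q) z * dzbar l (fun w => H w p j) z.

Definition ricci1 H k l z : C :=
  \sum_i \sum_j invmx (H z) j i * chern_curvature H i j k l z.

Definition chern_scalar H z : C :=
  \sum_k \sum_l invmx (H z) l k * ricci1 H k l z.

End ChernCurvature.

(* An integrable complex structure is given by a holomorphic atlas.  The total
   functions [chart_map a] and [chart_inv a] are only meaningful on [chart_dom a] and
   on its image under [chart_map a]. *)
Record complex_manifold (R : realType) (n : nat) := ComplexManifold {
  carrier :> topologicalType;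
  carrier_hausdorff : hausdorff_space carrier;
  carrier_countable : @second_countable carrier;
  chart : Type;
  chart_dom : chart -> set carrier;
  chart_map : chart -> carrier -> 'rV[R[i]]_n;
  chart_inv : chart -> 'rV[R[i]]_n -> carrier;
  chart_cover : forall x, exists a, chart_dom a x;
  chart_dom_open : forall a, open (chart_dom a);
  chart_image_open : forall a, open (chart_map a @` chart_dom a);
  chart_mapK : forall a x, chart_dom a x -> chart_inv a (chart_map a x) = x;
  chart_map_continuous : forall a x, chart_dom a x -> {for x, continuous (chart_map a)};
  chart_inv_continuous : forall a z, (chart_map a @` chart_dom a) z ->
    {for z, continuous (chart_inv a)};
  transition_holomorphic : forall a b x, chart_dom a x -> chart_dom b x ->
    differentiable (chart_map b \o chart_inv a) (chart_map a x)
}.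

Section HermitianMetrics.
Context {R : realType} {n : nat}.
Implicit Type M : complex_manifold R n.

Definition chart_image M (a : chart M) : set 'rV[R[i]]_n :=
  chart_map a @` chart_dom a.

Definition smooth_function M (u : M -> R) : Prop :=
  forall a : chart M, rsmooth (chart_image a) (fun z => (u (chart_inv a z))%:C%C).

(* [hmx a z i j] is the coefficient h_{i \bar j} = h(d/dz^i, d/d\bar z^j) in the
   chart [a].  The library's Jacobian acts on row vectors: its (i, p) entry is
   dw^p/dz^i, so that the last field reads
   h_{i \bar j} = h'_{p \bar q} dw^p/dz^i \overline{dw^q/dz^j}. *)
Record hermitian_metric M := HermitianMetric {
  hmx :> chart M -> 'rV[R[i]]_n -> 'M[R[i]]_n;
  hmx_smooth : forall a i j, rsmooth (chart_image a) (fun z => hmx a z i j);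
  hmx_hermitian : forall a z, chart_image a z -> (hmx a z) ^t* = hmx a z;
  hmx_posdef : forall a z (v : 'rV[R[i]]_n), chart_image a z -> v != 0 ->
    0 < (v *m hmx a z *m v ^t*) 0 0;
  hmx_transition : forall a b x, chart_dom a x -> chart_dom b x ->
    let J := jacobian (chart_map b \o chart_inv a) (chart_map a x) in
    hmx a (chart_map a x) = J *m hmx b (chart_map b x) *m J ^t*
}.

Definition projectively_flat M (h : hermitian_metric M) : Prop :=
  forall (a : chart M) z, chart_image a z -> forall i j k l : 'I_n,
    chern_curvature (h a) i j k l z = n%:R^-1 * ricci1 (h a) k l z * h a z i j.

Definition conformal_class M (h : hermitian_metric M) : set (hermitian_metric M) :=
  [set h' | exists2 u : M -> R, smooth_function u &
     forall (a : chart M) z, chart_image a z ->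
       h' a z = (expR (u (chart_inv a z)))%:C%C *: h a z].

(* On R[i], [_ < 0] says that the value is real and negative. *)
Definition negative_chern_scalar M (h : hermitian_metric M) : Prop :=
  forall (a : chart M) z, chart_image a z -> chern_scalar (h a) z < 0.

Definition negative_projectively_flat M (h : hermitian_metric M) : Prop :=
  projectively_flat h /\
  exists2 h', conformal_class h h' & negative_chern_scalar h'.

End HermitianMetrics.

(* Main.v *)
Require Import Defs.
From mathcomp Require Import all_boot all_order all_algebra.
From mathcomp Require Import perm complex ring lra.
From mathcomp Require Import all_classical all_reals all_analysis.

Set Implicit Arguments.
Unset Strict Implicit.
Unset Printing Implicit Defensive.

Import Order.TTheory GRing.Theory Num.Theory.
Import numFieldNormedType.Exports.

Local Open Scope classical_set_scope.
Local Open Scope ring_scope.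
Local Open Scope sesquilinear_scope.

(** A projectively flat metric stays so under a conformal change, so the metric [h] itself can be taken to
    have negative Chern scalar curvature [s] ([conformal_flat], [divY_gt0]). In a chart with metric matrix
    [H], let [Gam k] be the matrices of the Chern connection, the product of [dz k H] and of the inverse
    of [H]. Projective flatness says that [dzbar l (Gam k)] is a scalar matrix [- r k l]. Let [eta] be the trace
    of the torsion, a form of type (1,0), and let [Y] be the vector field of type (0,1) dual to it for the
    metric. Differentiating, one finds
        sum over l of dzbar l (det H * Y_l)  =  det H * (|eta|^2 - (n - 1) / n * s),
    which is positive as [s < 0] and [n >= 2] ([div_Y], [div_Y_gt0]). The point is that the terms that do not come
    from curvature assemble into the square norm of [eta], which is nonnegative whatever the torsion is.
    The left-hand side is the divergence of [Y] for the volume form with density [det H]. Both [Y] and the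
    volume form are independent of the chart ([transition_Yd], [transition_det]), and the integral of a divergence
    over a compact manifold is zero: a contradiction ([no_positive_divergence]).

    Most of the text establishes this last fact. With a partition of unity it reduces to integration by parts
    in a chart, and to the independence of the integral of a function with small support from the
    chart in which it is computed. For compactly supported functions on [C^n], iterated integrals over boxes
    are translation invariant, which gives the divergence theorem by passing to the limit in difference
    quotients ([iC_dz_dzbar]). The change of variables is then deduced from the divergence theorem
    ([local_change_of_variables]): a holomorphic map that is regular at a point can be joined to a translation
    by a family of maps, and by the Piola identity the pulled back density varies by a divergence along
    the family, so that its integral does not change.

    The calculus above differentiates transition maps twice, whereas they are only supposed to be complex
    differentiable at each point. Because they intertwine two metrics their derivatives are locally bounded
    ([transition_holo]), and a complex differentiable function with bounded derivatives is regular
    ([goursat]). The latter is proved by integration as well: the averages of such a function over balls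
    satisfy an Euler equation in the radius, which gives the mean value property, and the mean value property
    presents the function as a convolution with a regular kernel. *)

(** * Moduli of complex numbers and of coordinate vectors *)

(** The real-valued modulus: the norm that [C] carries as a normed space takes its values in [C]. *)
Notation nc := (@complex.ComplexField.Normc.normc _).

Section Norms.
Context {R : realType}.
Local Notation C := (R[i]).
Implicit Types (x y : C).

Lemma nc_ge0 x : 0 <= nc x.
Proof. by case: x => a b; exact: sqrtr_ge0. Qed.

Lemma nc0 : nc (0 : C) = 0.
Proof. exact: complex.ComplexField.Normc.normc0. Qed.

Lemma nc1 : nc (1 : C) = 1.
Proof. exact: complex.ComplexField.Normc.normc1. Qed.

Lemma nc_eq0 x : nc x = 0 -> x = 0.
Proof. exact: complex.ComplexField.Normc.eq0_normc. Qed.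

Lemma ncN x : nc (- x) = nc x.
Proof. exact: normcN. Qed.

Lemma ncB x y : nc (x - y) = nc (y - x).
Proof. by rewrite -ncN opprB. Qed.

Lemma ncD x y : nc (x + y) <= nc x + nc y.
Proof. exact: le_normcD. Qed.

Lemma ncM x y : nc (x * y) = nc x * nc y.
Proof. exact: complex.ComplexField.Normc.normcM. Qed.

Lemma nc_conj x : nc (x^*)%C = nc x.
Proof. by case: x => a b /=; rewrite sqrrN. Qed.

Lemma nc_real (a : R) : nc (a%:C%C) = `|a|.
Proof. by rewrite /= expr0n /= addr0 sqrtr_sqr. Qed.

Lemma conjcD x y : ((x + y)^*)%C = (x^*)%C + (y^*)%C.
Proof. exact: rmorphD. Qed.

Lemma conjcN x : ((- x)^*)%C = - (x^*)%C.
Proof. exact: rmorphN. Qed.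

Lemma conjcB x y : ((x - y)^*)%C = (x^*)%C - (y^*)%C.
Proof. exact: rmorphB. Qed.

Lemma conjcM x y : ((x * y)^*)%C = (x^*)%C * (y^*)%C.
Proof. exact: rmorphM. Qed.

Lemma conjc_i : ('i%C : C)^*%C = - 'i%C.
Proof. by apply/eqP; rewrite eq_complex /= oppr0 !eqxx. Qed.

Lemma conjc_sum I (r : seq I) (P : pred I) (F : I -> C) :
  ((\sum_(i <- r | P i) F i)^*)%C = \sum_(i <- r | P i) ((F i)^*)%C.
Proof. exact: rmorph_sum. Qed.

Lemma nc_Re x : `|complex.Re x| <= nc x.
Proof. by case: x => a b /=; rewrite -sqrtr_sqr ler_sqrt ?lerDl ?addr_ge0 ?sqr_ge0. Qed.

Lemma nc_Im x : `|complex.Im x| <= nc x.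
Proof. by case: x => a b /=; rewrite -sqrtr_sqr ler_sqrt ?lerDr ?addr_ge0 ?sqr_ge0. Qed.

Lemma nc_i : nc ('i%C : C) = 1.
Proof. by rewrite /= expr0n /= add0r expr1n sqrtr1. Qed.

Lemma nc_le x : nc x <= `|complex.Re x| + `|complex.Im x|.
Proof.
rewrite {1}(complexE x); apply: le_trans (ncD _ _) _.
by rewrite ncM !nc_real nc_i mul1r.
Qed.

Lemma nc_sum I (r : seq I) (P : pred I) (F : I -> C) :
  nc (\sum_(i <- r | P i) F i) <= \sum_(i <- r | P i) nc (F i).
Proof.
elim/big_rec2 : _ => [|i y1 y2 _ h]; first by rewrite nc0.
by apply: le_trans (ncD _ _) _; rewrite lerD2l.
Qed.

Lemma norm_nc x : `|x| = (nc x)%:C%C.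
Proof. by case: x. Qed.

Lemma nbhsCP (x : C) (P : set C) :
  nbhs x P <-> exists2 e : R, 0 < e & forall y, nc (y - x) < e -> P y.
Proof.
split.
  move=> /nbhs_ballP [[e e'] /= e0 H].
  move: e0; rewrite ltcE /= => /andP [/eqP e'0 e0]; rewrite e'0 in H.
  exists e => // y hy; apply: H.
  by rewrite -ball_normE /ball_ /= distrC norm_nc ltcR.
move=> [e e0 H]; apply/nbhs_ballP; exists (e%:C)%C; first by rewrite /= ltcR.
by move=> y; rewrite -ball_normE /ball_ /= distrC norm_nc ltcR; exact: H.
Qed.

Section Vectors.
Context {n : nat}.
Local Notation V := ('rV[C]_n).
Implicit Types (v w z : V).

(** The sum norm, for which bounds on coordinates and on vectors convert without square roots. *)
Definition nv w : R := \sum_k nc (w 0 k).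

Lemma nv_ge0 w : 0 <= nv w.
Proof. by apply: sumr_ge0 => k _; exact: nc_ge0. Qed.

Lemma nv0 : nv 0 = 0.
Proof. by rewrite /nv big1 // => k _; rewrite mxE nc0. Qed.

Lemma nvN w : nv (- w) = nv w.
Proof. by apply: eq_bigr => k _; rewrite mxE ncN. Qed.

Lemma nvB v w : nv (v - w) = nv (w - v).
Proof. by rewrite -nvN opprB. Qed.

Lemma nvD v w : nv (v + w) <= nv v + nv w.
Proof. by rewrite -big_split; apply: ler_sum => k _; rewrite mxE; exact: ncD. Qed.

Lemma nvZ (a : C) w : nv (a *: w) = nc a * nv w.
Proof. by rewrite /nv mulr_sumr; apply: eq_bigr => k _; rewrite mxE ncM. Qed.

Lemma nv_coord w k : nc (w 0 k) <= nv w.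
Proof.
by rewrite /nv (bigD1 k) //= lerDl; apply: sumr_ge0 => j _; exact: nc_ge0.
Qed.

Lemma nv_delta k : nv (delta_mx 0 k) = 1.
Proof.
rewrite /nv (bigD1 k) //= !mxE !eqxx nc1 big1 ?addr0 // => j jk.
by rewrite mxE (negPf jk) andbF nc0.
Qed.

Lemma nv_eq0 w : nv w = 0 -> w = 0.
Proof.
move=> w0; apply/rowP => k; rewrite mxE; apply: nc_eq0; apply/eqP.
by rewrite eq_le nc_ge0 -w0 nv_coord.
Qed.

Lemma nv_gt0 w : w != 0 -> 0 < nv w.
Proof.
by rewrite lt_neqAle nv_ge0 andbT => w0; apply/eqP => /esym/nv_eq0 /eqP; apply/negP.
Qed.

Lemma nbhsVP (z : V) (P : set V) :
  nbhs z P <-> exists2 e : R, 0 < e & forall w, nv (w - z) < e -> P w.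
Proof.
split.
  move=> /nbhs_ballP [[e e'] /= e0 H].
  move: e0; rewrite ltcE /= => /andP [/eqP e'0 e0]; rewrite e'0 in H.
  exists e => // y hy; apply: H; split=> [|i j]; first by rewrite ltcR.
  rewrite -ball_normE /ball_ /= distrC norm_nc ltcR ord1.
  by apply: le_lt_trans hy; have := nv_coord (y - z) j; rewrite !mxE.
move=> [e e0 H]; apply/nbhs_ballP.
exists ((e / n.+1%:R)%:C)%C; first by rewrite /= ltcR divr_gt0.
move=> y [_ hy]; apply: H.
apply: (@le_lt_trans _ _ (\sum_(k < n) e / n.+1%:R)).
  apply: ler_sum => k _; have := hy ord0 k.
  by rewrite -ball_normE /ball_ /= distrC norm_nc ltcR !mxE; exact: ltW.
rewrite sumr_const card_ord -[X in X < _]mulr_natr -mulrA gtr_pMr // mulrC.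
by rewrite ltr_pdivrMr // mul1r ltr_nat.
Qed.

Lemma continuousVP (f : V -> C) z : {for z, continuous f} <->
  forall e : R, 0 < e -> exists2 d : R, 0 < d &
    forall w, nv (w - z) < d -> nc (f w - f z) < e.
Proof.
split.
  move=> cf e e0.
  have /cf/nbhsVP [d d0 H] : nbhs (f z) [set y | nc (y - f z) < e].
    by apply/nbhsCP; exists e.
  by exists d.
move=> H P /nbhsCP [e e0 hP]; have [d d0 hd] := H e e0.
by apply/nbhsVP; exists d => // w /hd /hP.
Qed.

Lemma continuous_coord k z : {for z, continuous (fun w : V => w 0 k)}.
Proof.
apply/continuousVP => e e0; exists e => // w hw.
by apply: le_lt_trans hw; have := nv_coord (w - z) k; rewrite !mxE.
Qed.

End Vectors.
End Norms.

(** * Differentials between normed groups *)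

Section Differentials.
Context {R : realType}.
Local Notation C := (R[i]).

Lemma ratio_le (e K : R) : 0 <= e -> 0 <= K -> e / (K + 1) * K <= e.
Proof.
by move=> e0 K0; rewrite mulrAC ler_pdivrMr ?ltr_wpDl // ler_wpM2l // lerDl.
Qed.

Lemma finite_radius (I : finType) (P : I -> R -> Prop) :
  (forall i, exists2 d : R, 0 < d & P i d) ->
  (forall i (d d' : R), d' <= d -> P i d -> P i d') ->
  exists2 d : R, 0 < d & forall i, P i d.
Proof.
move=> h mono.
have hs (s : seq I) : exists2 d : R, 0 < d & forall i, i \in s -> P i d.
  elim: s => [|i s [d d0 hd]]; first by exists 1.
  have [d' d'0 hd'] := h i; exists (Num.min d d'); first by rewrite lt_min d0.
  move=> j; rewrite inE => /orP [/eqP ->|js].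
    by apply: mono hd'; rewrite ge_min lexx orbT.
  by apply: mono (hd j js); rewrite ge_min lexx.
by have [d d0 hd] := hs (enum I); exists d => // i; apply: hd; rewrite mem_enum.
Qed.

(** Norms are passed explicitly, so that one notion of differential serves for functions of a real
    variable, of a complex parameter and of a point of [C^n]. *)
Record is_norm (X : zmodType) (N : X -> R) : Prop := IsNorm {
  norm_ge0 : forall x, 0 <= N x;
  norm_zero : N 0 = 0;
  norm_opp : forall x, N (- x) = N x;
  norm_triangle : forall x y, N (x + y) <= N x + N y }.

Lemma is_norm_real : is_norm (fun x : R => `|x|).
Proof. by split=> *; rewrite ?normr0 ?normrN ?ler_normD. Qed.

Lemma is_norm_nc : is_norm (nc : C -> R).
Proof. by split=> *; rewrite ?nc0 ?ncN ?ncD ?nc_ge0. Qed.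

Lemma is_norm_nv n : is_norm (@nv R n).
Proof. by split=> *; rewrite ?nv0 ?nvN ?nvD ?nv_ge0. Qed.

(** The Frechet differential over the reals. Only the boundedness of [L] is recorded; additivity is
    a hypothesis of the chain rule alone. *)
Definition has_diff (X Y : zmodType) (N : X -> R) (N' : Y -> R)
    (f : X -> Y) (z : X) (L : X -> Y) : Prop :=
  (exists2 K : R, 0 <= K & forall w, N' (L w) <= K * N w) /\
  (forall e : R, 0 < e -> exists2 d : R, 0 < d &
    forall w, N w < d -> N' (f (z + w) - f z - L w) <= e * N w).

Section General.
Context {X Y : zmodType} {N : X -> R} {N' : Y -> R}.
Hypotheses (hN : is_norm N) (hN' : is_norm N').
Implicit Types (f g : X -> Y) (L M : X -> Y) (z : X).

Lemma has_diff_near f g z L :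
  (exists2 d : R, 0 < d & forall w, N w < d -> f (z + w) = g (z + w)) ->
  has_diff N N' f z L -> has_diff N N' g z L.
Proof.
move=> [d d0 fg] [hK h]; split=> // e e0; have [d' d'0 hd] := h e e0.
exists (Num.min d d'); first by rewrite lt_min d0.
move=> w; rewrite lt_min => /andP [h1 h2]; have fz := fg 0.
by rewrite -fg // -[z in g z]addr0 -fz ?norm_zero // addr0 hd.
Qed.

Lemma has_diff_eqL f z L M : (forall w, L w = M w) ->
  has_diff N N' f z L -> has_diff N N' f z M.
Proof.
move=> LM [[K K0 hK] h]; split; first by exists K => // w; rewrite -LM.
by move=> e /h [d d0 hd]; exists d => // w; rewrite -LM; exact: hd.
Qed.

Lemma has_diff_cst (c : Y) z : has_diff N N' (fun=> c) z (fun=> 0).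
Proof.
split; first by exists 0 => // w; rewrite norm_zero // mul0r.
move=> e e0; exists 1 => // w _.
by rewrite subrr subr0 norm_zero // mulr_ge0 ?norm_ge0 // ltW.
Qed.

Lemma has_diffD f g z L M : has_diff N N' f z L -> has_diff N N' g z M ->
  has_diff N N' (fun x => f x + g x) z (fun w => L w + M w).
Proof.
move=> [[K K0 hK] h] [[K' K'0 hK'] h']; split.
  exists (K + K'); first exact: addr_ge0.
  by move=> w; rewrite mulrDl; apply: le_trans (norm_triangle hN' _ _) _; exact: lerD.
move=> e e0; have e20 : 0 < e / 2 by rewrite divr_gt0.
have [d d0 hd] := h _ e20; have [d' d'0 hd'] := h' _ e20.
exists (Num.min d d'); first by rewrite lt_min d0.
move=> w; rewrite lt_min => /andP [h1 h2].
rewrite [e]splitr mulrDl; apply: le_trans (lerD (hd w h1) (hd' w h2)).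
apply: le_trans (norm_triangle hN' _ _); rewrite le_eqVlt; apply/orP; left; apply/eqP.
by congr N'; rewrite !opprD (AC (2*2*2) ((1*3*5)*(2*4*6))).
Qed.

Lemma has_diff_shift f z L : has_diff N N' (fun x => f (z + x)) 0 L -> has_diff N N' f z L.
Proof.
move=> [hK h]; split=> [//|e e0]; have [d d0 hd] := h e e0.
by exists d => [//|w hw]; have := hd w hw; rewrite add0r addr0.
Qed.

Lemma has_diff_cont f z L : has_diff N N' f z L ->
  forall e : R, 0 < e -> exists2 d : R, 0 < d & forall w, N w < d -> N' (f (z + w) - f z) < e.
Proof.
move=> [[K K0 hK] h] e e0; have [d d0 hd] := h 1 ltr01.
have K1 : 0 < 1 + K by rewrite ltr_pwDl.
exists (Num.min d (e / (1 + K))); first by rewrite lt_min d0 divr_gt0.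
move=> w; rewrite lt_min => /andP [h1 h2].
rewrite -(subrK (L w) (f _ - _)); apply: le_lt_trans (norm_triangle hN' _ _) _.
apply: le_lt_trans (lerD (hd w h1) (hK w)) _.
by rewrite -mulrDl mulrC -ltr_pdivlMr.
Qed.

Lemma has_diff_lip f z L : has_diff N N' f z L ->
  exists2 K : R, 0 <= K & exists2 d : R, 0 < d &
    forall w, N w < d -> N' (f (z + w) - f z) <= K * N w.
Proof.
move=> [[K K0 hK] h]; have [d d0 hd] := h 1 ltr01.
exists (1 + K); first by rewrite addr_ge0.
exists d => // w hw; rewrite -(subrK (L w) (f _ - _)).
apply: le_trans (norm_triangle hN' _ _) _.
by apply: le_trans (lerD (hd w hw) (hK w)) _; rewrite mulrDl.
Qed.

End General.

Lemma has_diff_comp (X Y Z : zmodType) (N : X -> R) (N' : Y -> R) (N'' : Z -> R)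
    (f : Y -> Z) (h : X -> Y) z L M :
  is_norm N -> is_norm N' -> is_norm N'' ->
  (forall u v, M (u + v) = M u + M v) ->
  has_diff N N' h z L -> has_diff N' N'' f (h z) M ->
  has_diff N N'' (fun x => f (h x)) z (fun w => M (L w)).
Proof.
move=> hN hN' hN'' addM hh [[K' K'0 hK'] hf].
have [K2 K20 [d2 d20 hd2]] := has_diff_lip hN' hh.
have hc := has_diff_cont hN' hh.
case: hh => [[K K0 hK] hh]; split.
  exists (K' * K); first exact: mulr_ge0.
  move=> w; apply: le_trans (hK' _) _; rewrite -mulrA; exact: ler_wpM2l.
move=> e e0; set e1 := e / 2 / (K2 + 1); set e2 := e / 2 / (K' + 1).
have p1 : 0 < K2 + 1 by rewrite ltr_wpDl.
have p2 : 0 < K' + 1 by rewrite ltr_wpDl.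
have e10 : 0 < e1 by rewrite !divr_gt0.
have e20 : 0 < e2 by rewrite !divr_gt0.
have [d1 d10 hd1] := hf _ e10; have [d3 d30 hd3] := hh _ e20.
have [d4 d40 hd4] := hc _ d10.
exists (Num.min d2 (Num.min d3 d4)); first by rewrite !lt_min d20 d30.
move=> w; rewrite !lt_min => /and3P [h2 h3 h4].
set u := h (z + w) - h z.
have -> : f (h (z + w)) - f (h z) - M (L w) =
    (f (h z + u) - f (h z) - M u) + M (u - L w).
  have hu : h z + u = h (z + w) by rewrite addrC subrK.
  have -> : M u = M (u - L w) + M (L w) by rewrite -addM subrK.
  by rewrite hu (opprD (M (u - L w))) [- M (u - L w) + _]addrC addrA subrK.
apply: le_trans (norm_triangle hN'' _ _) _.
have a1 := hd1 u (hd4 w h4); have a2 := hK' (u - L w).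
have a3 := hd2 w h2; have a4 := hd3 w h3.
have w0 := norm_ge0 hN w.
have b1 : e1 * N' u <= e / 2 * N w.
  apply: le_trans (ler_wpM2l (ltW e10) a3) _; rewrite mulrA ler_wpM2r //.
  by apply: ratio_le => //; rewrite ltW // divr_gt0.
have b2 : K' * N' (u - L w) <= e / 2 * N w.
  apply: le_trans (ler_wpM2l K'0 a4) _; rewrite mulrA ler_wpM2r //.
  by rewrite mulrC; apply: ratio_le => //; rewrite ltW // divr_gt0.
have := splitr e; lra.
Qed.

Notation has_diffC N := (has_diff N nc).

Section ComplexValued.
Context {X : zmodType} {N : X -> R}.
Hypothesis (hN : is_norm N).
Implicit Types (f g : X -> C) (L M : X -> C) (z : X).
Let hC := is_norm_nc.

Lemma has_diffM f g z L M : has_diffC N f z L -> has_diffC N g z M ->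
  has_diffC N (fun x => f x * g x) z (fun w => L w * g z + f z * M w).
Proof.
move=> hf hg; have [K2 K20 [d2 d20 hd2]] := has_diff_lip hC hf.
have hc := has_diff_cont hC hg.
case: hf => [[K K0 hK] hf]; case: hg => [[K' K'0 hK'] hg]; split.
  exists (K * nc (g z) + nc (f z) * K'); first by rewrite addr_ge0 ?mulr_ge0 ?nc_ge0.
  move=> w; apply: le_trans (ncD _ _) _; rewrite !ncM mulrDl.
  have h1 := ler_wpM2r (nc_ge0 (g z)) (hK w).
  have h2 := ler_wpM2l (nc_ge0 (f z)) (hK' w).
  by apply: lerD; [rewrite mulrAC | rewrite -mulrA].
move=> e e0; have e30 : 0 < e / 3 by rewrite divr_gt0.
have p1 : 0 < nc (g z) + 1 by rewrite ltr_wpDl ?nc_ge0.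
have p2 : 0 < nc (f z) + 1 by rewrite ltr_wpDl ?nc_ge0.
have p3 : 0 < K2 + 1 by rewrite ltr_wpDl.
have q1 : 0 < e / 3 / (nc (g z) + 1) by rewrite divr_gt0.
have q2 : 0 < e / 3 / (nc (f z) + 1) by rewrite divr_gt0.
have q3 : 0 < e / 3 / (K2 + 1) by rewrite divr_gt0.
have [d1 d10 hd1] := hf _ q1; have [d3 d30 hd3] := hg _ q2.
have [d4 d40 hd4] := hc _ q3.
exists (Num.min (Num.min d1 d2) (Num.min d3 d4)); first by rewrite !lt_min d20 d30 d10.
move=> w; rewrite !lt_min -andbA => /and4P [/hd1 h1 /hd2 h2 /hd3 h3 /hd4 h4].
have w0 := norm_ge0 hN w.
have -> : f (z + w) * g (z + w) - f z * g z - (L w * g z + f z * M w) =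
  (f (z + w) - f z - L w) * g z + f z * (g (z + w) - g z - M w) +
  (f (z + w) - f z) * (g (z + w) - g z) by ring.
apply: le_trans (ncD _ _) _; apply: le_trans (lerD (ncD _ _) (lexx _)) _.
rewrite !ncM.
have aux a b c : 0 <= c -> 0 < b -> a <= e / 3 / (b + 1) * c -> b * a <= e / 3 * c.
  move=> c0 b0 h; apply: le_trans (ler_wpM2l (ltW b0) h) _.
  rewrite mulrA ler_wpM2r // mulrCA ger_pMr // ler_pdivrMr; last lra.
  by rewrite mul1r lerDl.
have aux2 a b c : 0 <= c -> 0 <= b -> a <= e / 3 / (b + 1) * c -> b * a <= e / 3 * c.
  move=> c0; rewrite le_eqVlt => /orP [/eqP <- _|]; last exact: aux.
  by rewrite mul0r mulr_ge0 // ltW.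
have k1 := aux2 _ _ _ w0 (nc_ge0 _) h1.
have k2 := aux2 _ _ _ w0 (nc_ge0 _) h3.
have k3 : nc (f (z + w) - f z) * nc (g (z + w) - g z) <= e / 3 * N w.
  apply: le_trans (_ : (K2 * N w) * (e / 3 / (K2 + 1)) <= _).
    by apply: ler_pM; rewrite ?nc_ge0 // ltW.
  by rewrite -mulrA; apply: aux2 => //; rewrite mulrC.
have -> : e * N w = e / 3 * N w + e / 3 * N w + e / 3 * N w by lra.
by apply: lerD => //; apply: lerD => //; rewrite mulrC.
Qed.

Lemma has_diffZ (c : C) f z L : has_diffC N f z L ->
  has_diffC N (fun x => c * f x) z (fun w => c * L w).
Proof.
move=> h; have := has_diffM (has_diff_cst hN hC c z) h.
by apply: has_diff_eqL => w; rewrite mul0r add0r.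
Qed.

Lemma has_diff_conj f z L : has_diffC N f z L ->
  has_diffC N (fun x => (f x)^*%C) z (fun w => (L w)^*%C).
Proof.
move=> [[K K0 hK] h]; split; first by exists K => // w; rewrite nc_conj.
by move=> e /h [d d0 hd]; exists d => // w /hd; rewrite -!rmorphB nc_conj.
Qed.

Lemma has_diff_sum I (r : seq I) (P : pred I) (F : I -> X -> C) (L : I -> X -> C) z :
  (forall i, P i -> has_diffC N (F i) z (L i)) ->
  has_diffC N (fun x => \sum_(i <- r | P i) F i x) z (fun w => \sum_(i <- r | P i) L i w).
Proof.
move=> h; elim: r => [|i r IH].
  under [fun x => _]eq_fun do rewrite big_nil.
  by apply: has_diff_eqL (has_diff_cst hN hC 0 z) => w; rewrite big_nil.
under [fun x => _]eq_fun do rewrite big_cons.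
case Pi: (P i); first by apply: has_diff_eqL (has_diffD hC (h i Pi) IH) => w; rewrite big_cons Pi.
by apply: has_diff_eqL IH => w; rewrite big_cons Pi.
Qed.

Lemma has_diff_prod (I : eqType) (r : seq I) (F : I -> X -> C) (L : I -> X -> C) z :
  uniq r -> (forall i, has_diffC N (F i) z (L i)) ->
  has_diffC N (fun x => \prod_(i <- r) F i x) z
    (fun w => \sum_(i <- r) L i w * \prod_(j <- r | j != i) F j z).
Proof.
move=> + h; elim: r => [|i r IH] /=.
  move=> _; under [fun x => _]eq_fun do rewrite big_nil.
  by apply: has_diff_eqL (has_diff_cst hN hC 1 z) => w; rewrite big_nil.
move=> /andP [ir /IH {}IH]; under [fun x => _]eq_fun do rewrite big_cons.
apply: has_diff_eqL (has_diffM (h i) IH) => w; rewrite big_cons; congr (_ + _).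
  rewrite big_cons eqxx /= [in RHS]big_seq_cond; congr (_ * _).
  rewrite big_seq_cond; apply: eq_bigl => j; rewrite andbT; case jr: (j \in r) => //=.
  by apply/esym; apply: contraNneq ir => <-.
rewrite mulr_sumr [LHS]big_seq [RHS]big_seq; apply: eq_bigr => j jr.
rewrite big_cons ifT; first by rewrite mulrCA.
by apply: contraNneq ir => ->.
Qed.

Lemma has_diff_inv f z L : f z != 0 -> has_diffC N f z L ->
  has_diffC N (fun x => (f x)^-1) z (fun w => - (L w / (f z) ^+ 2)).
Proof.
move=> fz0 hf.
have [K2 K20 [d2 d20 hd2]] := has_diff_lip hC hf.
have hc := has_diff_cont hC hf; case: hf => [[K K0 hK] hf].
set y0 := f z in fz0 *; have m0 : 0 < nc y0.
  rewrite lt_neqAle nc_ge0 andbT eq_sym; apply: contraNneq fz0 => /nc_eq0 ->.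
  by rewrite eqxx.
split.
  exists (K / nc y0 ^+ 2); first by rewrite divr_ge0 // sqr_ge0.
  move=> w; rewrite ncN expr2 ncM complex.ComplexField.Normc.normcV ncM -expr2 mulrAC.
  by rewrite ler_wpM2r ?invr_ge0 ?sqr_ge0.
move=> e e0; set m := nc y0 in m0 *.
have q1 : 0 < e * m ^+ 2 / 4 by rewrite divr_gt0 ?mulr_gt0 ?exprn_gt0.
have q2 : 0 < m / 2 by rewrite divr_gt0.
have q3 : 0 < e * m ^+ 3 / (4 * (K + 1)).
  by rewrite divr_gt0 ?mulr_gt0 ?exprn_gt0 // ltr_wpDl.
have [d1 d10 hd1] := hf _ q1; have [d3 d30 hd3] := hc _ q2.
have [d4 d40 hd4] := hc _ q3.
exists (Num.min (Num.min d1 d2) (Num.min d3 d4)); first by rewrite !lt_min d20 d30 d10.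
move=> w; rewrite !lt_min -andbA => /and4P [/hd1 h1 /hd2 h2 /hd3 h3 /hd4 h4].
have w0 := norm_ge0 hN w; set y := f (z + w) in h1 h2 h3 h4 *.
have ym : m / 2 <= nc y.
  have := ncD (y0 - y) y; rewrite subrK -/m ncB => hh; lra.
have ny0 : y != 0.
  by apply/eqP => y_0; move: ym; rewrite y_0 nc0; lra.
have -> : y^-1 - y0^-1 - - (L w / y0 ^+ 2) =
  (- y0 * (y - y0 - L w) + L w * (y - y0)) / (y * y0 ^+ 2).
  by field; apply/andP.
rewrite ncM complex.ComplexField.Normc.normcV ncM expr2 ncM -/m -expr2.
have ypos : 0 < nc y by apply: lt_le_trans ym.
rewrite ler_pdivrMr ?mulr_gt0 ?exprn_gt0 //.
apply: le_trans (ncD _ _) _; rewrite !ncM ncN -/m.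
have k1 : m * nc (y - y0 - L w) <= e * m ^+ 3 / 4 * N w.
  apply: le_trans (ler_wpM2l (ltW m0) h1) _; rewrite le_eqVlt; apply/orP; left; apply/eqP; ring.
have k2 : nc (L w) * nc (y - y0) <= e * m ^+ 3 / 4 * N w.
  apply: le_trans (_ : (K * N w) * (e * m ^+ 3 / (4 * (K + 1))) <= _).
    by apply: ler_pM; rewrite ?nc_ge0 // ltW.
  have -> : K * N w * (e * m ^+ 3 / (4 * (K + 1))) = (K / (K + 1)) * (e * m ^+ 3 / 4 * N w).
    by field; apply/eqP; lra.
  apply: ler_piMl; first by rewrite mulr_ge0 // ltW // divr_gt0 // mulr_gt0 // exprn_gt0.
  by rewrite ler_pdivrMr ?ltr_wpDl // mul1r lerDl.
have k3 : e * m ^+ 3 / 2 * N w <= e * N w * (nc y * m ^+ 2).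
  have -> : e * m ^+ 3 / 2 * N w = (e * N w) * (m / 2 * m ^+ 2) by field.
  by rewrite ler_wpM2l ?mulr_ge0 ?ler_wpM2r ?sqr_ge0 // ltW.
lra.
Qed.

Lemma has_diff_row n (h : X -> 'rV[C]_n) z (L : X -> 'rV[C]_n) :
  (forall p, has_diffC N (fun x => h x 0 p) z (fun w => L w 0 p)) ->
  has_diff N (@nv R n) h z L.
Proof.
move=> H; split.
  have [K K0 hK] : exists2 K : R, 0 <= K & forall w p, nc (L w 0 p) <= K * N w.
    case: (@finite_radius _ (fun p (d : R) => forall w, d * nc (L w 0 p) <= N w))
      => [p|p d d' dd' h' w|d d0 hd].
    - have [[K K0 hK] _] := H p; have K1 : 0 < K + 1 by rewrite ltr_wpDl.
      exists (K + 1)^-1 => [|w]; first by rewrite invr_gt0.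
      rewrite ler_pdivrMl //; apply: le_trans (hK w) _.
      by rewrite ler_wpM2r ?norm_ge0 // lerDl.
    - by apply: le_trans (h' w); rewrite ler_wpM2r ?nc_ge0.
    exists d^-1 => [|w p]; first by rewrite invr_ge0 ltW.
    by rewrite ler_pdivlMl.
  exists (\sum_(p < n) K) => [|w]; first exact: sumr_ge0.
  by rewrite mulr_suml; apply: ler_sum => p _; exact: hK.
move=> e e0; have n0 : 0 < n.+1%:R :> R by [].
case: (@finite_radius _ (fun p (d : R) => forall w, N w < d ->
    nc (h (z + w) 0 p - h z 0 p - L w 0 p) <= e / n.+1%:R * N w))
  => [p|p d d' dd' h' w hw|d d0 hd].
- by have [_ /(_ (e / n.+1%:R)) H'] := H p; apply: H'; rewrite divr_gt0.
- by apply: h'; exact: lt_le_trans dd'.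
exists d => // w hw; apply: le_trans (_ : \sum_(p < n) e / n.+1%:R * N w <= _).
  by apply: ler_sum => p _; have := hd p w hw; rewrite !mxE.
rewrite sumr_const card_ord -[X in X <= _]mulr_natl mulrA ler_wpM2r ?norm_ge0 //.
rewrite mulrCA ger_pMr // ler_pdivrMr // mul1r ler_nat; exact: leqnSn.
Qed.

End ComplexValued.

Section RealParameter.
Implicit Types (phi d : R -> C) (t : R).
Notation has_diffR := (has_diff (fun x : R => `|x|)).

Lemma is_derive_has_diff (f : R -> R) t (d : R) :
  is_derive t (1 : R) f d <-> has_diffR (fun x : R => `|x|) f t (fun s => s * d).
Proof.
split.
  case=> hd hv; split; first by exists `|d| => // s; rewrite normrM mulrC.
  move=> e e0.
  have : (fun h : R => h^-1 *: (f (h *: 1 + t) - f t)) @ 0^' --> d.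
    by rewrite -hv; exact: hd.
  move=> /cvgrPdist_lt /(_ e e0) /nbhs_ballP [r /= r0 H].
  exists r => // w hw; have [->|w0] := eqVneq w 0.
    by rewrite addr0 subrr mul0r subr0 normr0 mulr0.
  have := H w; rewrite /ball /= sub0r normrN => /(_ hw w0).
  rewrite /GRing.scale /= mulr1 => /ltW; rewrite (addrC w t) => hh.
  have -> : f (t + w) - f t - w * d = - w * (d - w^-1 * (f (t + w) - f t)).
    by field.
  by rewrite normrM normrN mulrC ler_wpM2r.
move=> [_ h].
have cv : (fun h : R => h^-1 *: (f (h *: 1 + t) - f t)) @ 0^' --> d.
  apply/cvgrPdist_le => e e0; have [r r0 H] := h e e0.
  apply/nbhs_ballP; exists r => //= w; rewrite /ball /= sub0r normrN => hw w0.
  rewrite /GRing.scale /= mulr1.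
  have -> : d - w^-1 * (f (w + t) - f t) = - w^-1 * (f (t + w) - f t - w * d).
    by rewrite (addrC w t); field.
  rewrite normrM normrN normfV ler_pdivrMl ?normr_gt0 // [_ * e]mulrC; exact: H.
apply: DeriveDef; first by apply/cvg_ex; exists d.
by apply: cvg_lim.
Qed.

Lemma Re_diff (x y d : C) (s : R) :
  complex.Re (x - y - s%:C%C * d) = complex.Re x - complex.Re y - s * complex.Re d.
Proof. by case: x y d => a b [a' b'] [p q] /=; ring. Qed.

Lemma Im_diff (x y d : C) (s : R) :
  complex.Im (x - y - s%:C%C * d) = complex.Im x - complex.Im y - s * complex.Im d.
Proof. by case: x y d => a b [a' b'] [p q] /=; ring. Qed.

(** The link with the real derivatives of the real and imaginary parts, in terms of which partial
    derivatives are defined. *)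
Lemma has_diffR_ReIm phi t (d : C) :
  has_diffR nc phi t (fun s => s%:C%C * d) <->
  is_derive t (1 : R) (fun s => complex.Re (phi s)) (complex.Re d) /\
  is_derive t (1 : R) (fun s => complex.Im (phi s)) (complex.Im d).
Proof.
split.
  move=> [_ h]; split; apply/is_derive_has_diff; split.
  - by exists `|complex.Re d| => // s; rewrite normrM mulrC.
  - move=> e /h [r r0 hr]; exists r => // w /hr; apply: le_trans.
    by rewrite -Re_diff; exact: nc_Re.
  - by exists `|complex.Im d| => // s; rewrite normrM mulrC.
  - move=> e /h [r r0 hr]; exists r => // w /hr; apply: le_trans.
    by rewrite -Im_diff; exact: nc_Im.
move=> [/is_derive_has_diff [_ h1] /is_derive_has_diff [_ h2]]; split.
  by exists (nc d); rewrite ?nc_ge0 // => s; rewrite ncM nc_real mulrC.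
move=> e e0; have e2 : 0 < e / 2 by rewrite divr_gt0.
have [r1 r10 H1] := h1 _ e2; have [r2 r20 H2] := h2 _ e2.
exists (Num.min r1 r2); first by rewrite lt_min r10.
move=> w; rewrite lt_min => /andP [/H1 k1 /H2 k2].
by apply: le_trans (nc_le _) _; rewrite [e]splitr mulrDl Re_diff Im_diff lerD.
Qed.

(** The mean value theorem, applied to the real and imaginary parts separately: hence the factor 2. *)
Lemma mean_value_bound phi d (c : C) (e : R) :
  (forall t, 0 <= t <= 1 -> has_diffR nc phi t (fun s => s%:C%C * d t)) ->
  (forall t, 0 <= t <= 1 -> nc (d t - c) <= e) ->
  nc (phi 1 - phi 0 - c) <= 2 * e.
Proof.
move=> hd he.
have real (f df : R -> R) (a : R) : (forall t, 0 <= t <= 1 -> is_derive t (1 : R) f (df t)) ->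
    (forall t, 0 <= t <= 1 -> `|df t - a| <= e) -> `|f 1 - f 0 - a| <= e.
  move=> hf hdf.
  have [||u] := @MVT R f df 0 1 ltr01.
  - by move=> x; rewrite in_itv /= => /andP [x0 x1]; apply: hf; rewrite !ltW.
  - apply: derivable_within_continuous => x; rewrite in_itv /= => hx.
    by have [] := hf x hx.
  rewrite in_itv /= => /andP [u0 u1] ->; rewrite subr0 mulr1.
  by apply: hdf; rewrite !ltW.
apply: le_trans (nc_le _) _; have -> : 2 * e = e + e by ring.
apply: lerD.
  have := real (fun s => complex.Re (phi s)) (fun s => complex.Re (d s)) (complex.Re c).
  case: (phi 1) (phi 0) => a b [a' b'] /=; case: c he => p q he /=; apply=> t ht.
    by have /has_diffR_ReIm [] := hd t ht.
  by apply: le_trans (he t ht); apply: le_trans (nc_Re _); case: (d t).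
have := real (fun s => complex.Im (phi s)) (fun s => complex.Im (d s)) (complex.Im c).
case: (phi 1) (phi 0) => a b [a' b'] /=; case: c he => p q he /=; apply=> t ht.
  by have /has_diffR_ReIm [] := hd t ht.
by apply: le_trans (he t ht); apply: le_trans (nc_Im _); case: (d t).
Qed.

End RealParameter.
End Differentials.
Notation has_diffC N := (has_diff N nc).
Notation has_diffR := (has_diff (fun x => `|x|)).

(** * Wirtinger calculus *)

Section Wirtinger.
Context {R : realType} {n : nat}.
Local Notation C := (R[i]).
Local Notation V := ('rV[C]_n).
Local Notation has_diffV := (has_diff (@nv R n) nc).
Implicit Types (f g : V -> C) (a b : 'I_n -> C) (v w z : V) (U : set V).
Let hV := @is_norm_nv R n.
Let hC := @is_norm_nc R.

(** The general real linear form on [C^n]: [wirt f z a b] therefore says that [f] is real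
    differentiable at [z], with Wirtinger derivatives [a] and [b]. *)
Definition wform a b w : C := \sum_k (a k * w 0 k + b k * (w 0 k)^*%C).

Definition wirt f z a b := has_diffV f z (wform a b).

Lemma wformD a b v w : wform a b (v + w) = wform a b v + wform a b w.
Proof.
by rewrite -big_split /=; apply: eq_bigr => k _; rewrite !mxE conjcD; ring.
Qed.

Lemma wformZ a b (t : R) w : wform a b (t%:C%C *: w) = t%:C%C * wform a b w.
Proof.
by rewrite mulr_sumr; apply: eq_bigr => k _; rewrite !mxE conjcM conjc_real; ring.
Qed.

Lemma wform_e a b k : wform a b (delta_mx 0 k) = a k + b k.
Proof.
rewrite /wform (bigD1 k) //= !mxE !eqxx big1; first by rewrite conjc1 !mulr1 addr0.
by move=> j jk; rewrite mxE (negPf jk) andbF conjc0 !mulr0 addr0.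
Qed.

Lemma wform_ie a b k : wform a b ('i%C *: delta_mx 0 k) = 'i%C * (a k - b k).
Proof.
rewrite /wform (bigD1 k) //= !mxE !eqxx big1; last first.
  by move=> j jk; rewrite !mxE (negPf jk) andbF mulr0 conjc0 !mulr0 addr0.
by rewrite andbT mulr1n conjcM conjc_i conjc1; ring.
Qed.

Lemma nc_wform a b w M : (forall k, nc (a k) <= M) -> (forall k, nc (b k) <= M) ->
  nc (wform a b w) <= 2 * M * nv w.
Proof.
move=> ha hb; apply: le_trans (nc_sum _ _ _) _; rewrite mulr_sumr.
apply: ler_sum => k _; apply: le_trans (ncD _ _) _; rewrite !ncM nc_conj.
have := ler_wpM2r (nc_ge0 (w 0 k)) (ha k); have := ler_wpM2r (nc_ge0 (w 0 k)) (hb k).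
lra.
Qed.

Lemma wirt_line f z a b v (t : R) : wirt f (z + t%:C%C *: v) a b ->
  has_diffR nc (fun t : R => f (z + t%:C%C *: v)) t (fun s => s%:C%C * wform a b v).
Proof.
move=> h.
have hl : has_diffR (@nv R n) (fun t : R => z + t%:C%C *: v) t (fun s => s%:C%C *: v).
  split; first by exists (nv v) => [|s]; rewrite ?nv_ge0 // nvZ nc_real mulrC.
  move=> e e0; exists 1 => // w _; rewrite rmorphD /= scalerDl opprD addrACA subrr add0r.
  by rewrite (addrC (_ *: v)) addrK subrr nv0 mulr_ge0 // ltW.
have := has_diff_comp is_norm_real hV hC (wformD a b) hl h.
by apply: has_diff_eqL => s; exact: wformZ.
Qed.

Lemma wirt_rderive f z a b v : wirt f z a b ->
  rderivable f v z /\ rderive v f z = wform a b v.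
Proof.
move=> h; have := @wirt_line f z a b v 0; rewrite scale0r addr0 => /(_ h).
move=> /has_diffR_ReIm [h1 h2]; split.
  by split; apply: ex_derive.
by rewrite /rderive !derive1E !derive_val; case: (wform a b v).
Qed.

Lemma wirt_dz f z a b k : wirt f z a b -> dz k f z = a k.
Proof.
move=> h; rewrite /dz; have [_ ->] := wirt_rderive (delta_mx 0 k) h.
have [_ ->] := wirt_rderive ('i%C *: delta_mx 0 k) h; rewrite wform_e wform_ie.
rewrite mulrA -expr2 sqr_i; have : (2 : C) != 0 by rewrite pnatr_eq0.
by move=> h2; field.
Qed.

Lemma wirt_dzbar f z a b k : wirt f z a b -> dzbar k f z = b k.
Proof.
move=> h; rewrite /dzbar; have [_ ->] := wirt_rderive (delta_mx 0 k) h.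
have [_ ->] := wirt_rderive ('i%C *: delta_mx 0 k) h; rewrite wform_e wform_ie.
rewrite mulrA -expr2 sqr_i; have : (2 : C) != 0 by rewrite pnatr_eq0.
by move=> h2; field.
Qed.

Definition wdiff f z := wirt f z (fun k => dz k f z) (fun k => dzbar k f z).

Lemma eq_wirt f z a b a' b' : a =1 a' -> b =1 b' -> wirt f z a b -> wirt f z a' b'.
Proof.
move=> ha hb; apply: has_diff_eqL => w.
by apply: eq_bigr => k _; rewrite ha hb.
Qed.

Lemma wirt_wdiff f z a b : wirt f z a b -> wdiff f z.
Proof.
by move=> h; apply: eq_wirt (h) => k; rewrite ?(wirt_dz _ h) ?(wirt_dzbar _ h).
Qed.

Lemma wirt_near f g z a b : (\forall w \near z, f w = g w) -> wirt f z a b -> wirt g z a b.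
Proof.
move=> /nbhsVP [d d0 fg] h; refine (has_diff_near hV _ h).
by exists d => // w hw; apply: fg; rewrite (addrC z) addrK.
Qed.

Lemma near_eq_dz f g z k : (\forall w \near z, f w = g w) -> wdiff f z -> dz k f z = dz k g z.
Proof. by move=> fg /(wirt_near fg) /wirt_dz ->. Qed.

Lemma near_eq_dzbar f g z k :
  (\forall w \near z, f w = g w) -> wdiff f z -> dzbar k f z = dzbar k g z.
Proof. by move=> fg /(wirt_near fg) /wirt_dzbar ->. Qed.

Lemma near_eq_wdiff f g z : (\forall w \near z, f w = g w) -> wdiff f z -> wdiff g z.
Proof. by move=> fg /(wirt_near fg) /wirt_wdiff. Qed.

Lemma wdiff_continuous f z : wdiff f z -> {for z, continuous f}.
Proof.
move=> h; apply/continuousVP => e e0; have [d d0 hd] := has_diff_cont hC h e0.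
by exists d => // w /hd; rewrite (addrC z) subrK.
Qed.

Lemma wirt_cst c z : wirt (fun=> c) z (fun=> 0) (fun=> 0).
Proof.
apply: has_diff_eqL (has_diff_cst hV hC c z) => w.
by rewrite /wform big1 // => k _; rewrite !mul0r addr0.
Qed.

Lemma wirt_coord j z : wirt (fun w => w 0 j) z (fun k => (k == j)%:R) (fun=> 0).
Proof.
rewrite /wirt; have -> : wform (fun k => (k == j)%:R) (fun=> 0) = fun w => w 0 j.
  apply/funext => w; rewrite /wform (bigD1 j) //= eqxx mul1r mul0r addr0 big1 ?addr0 // => k kj.
  by rewrite (negPf kj) !mul0r addr0.
split; first by exists 1 => // w; rewrite mul1r nv_coord.
move=> e e0; exists 1 => // w _.
by rewrite mxE (addrC (z 0 j)) addrK subrr nc0 mulr_ge0 ?nv_ge0 // ltW.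
Qed.

Lemma wirtD f g z a b a' b' : wirt f z a b -> wirt g z a' b' ->
  wirt (fun w => f w + g w) z (fun k => a k + a' k) (fun k => b k + b' k).
Proof.
move=> hf hg; apply: has_diff_eqL (has_diffD hC hf hg) => w.
by rewrite -big_split; apply: eq_bigr => k _ /=; ring.
Qed.

Lemma wirtM f g z a b a' b' : wirt f z a b -> wirt g z a' b' ->
  wirt (fun w => f w * g w) z (fun k => a k * g z + f z * a' k)
    (fun k => b k * g z + f z * b' k).
Proof.
move=> hf hg; apply: has_diff_eqL (has_diffM hV hf hg) => w.
by rewrite /wform mulr_suml mulr_sumr -big_split; apply: eq_bigr => k _ /=; ring.
Qed.

Lemma wirtV f z a b : f z != 0 -> wirt f z a b ->
  wirt (fun w => (f w)^-1) z (fun k => - (a k / f z ^+ 2)) (fun k => - (b k / f z ^+ 2)).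
Proof.
move=> f0 hf; apply: has_diff_eqL (has_diff_inv hV f0 hf) => w.
by rewrite /wform mulr_suml -sumrN; apply: eq_bigr => k _; ring.
Qed.

Lemma wirt_conj f z a b : wirt f z a b ->
  wirt (fun w => (f w)^*%C) z (fun k => (b k)^*%C) (fun k => (a k)^*%C).
Proof.
move=> hf; apply: has_diff_eqL (has_diff_conj hf) => w.
by rewrite /wform conjc_sum; apply: eq_bigr => k _; rewrite conjcD !conjcM conjcK addrC.
Qed.

Lemma wirt_sum I (r : seq I) (P : pred I) (F : I -> V -> C) z (a b : I -> 'I_n -> C) :
  (forall i, P i -> wirt (F i) z (a i) (b i)) ->
  wirt (fun w => \sum_(i <- r | P i) F i w) z
    (fun k => \sum_(i <- r | P i) a i k) (fun k => \sum_(i <- r | P i) b i k).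
Proof.
move=> h; apply: has_diff_eqL (has_diff_sum hV r h) => w.
rewrite /wform exchange_big; apply: eq_bigr => k _.
by rewrite !mulr_suml big_split.
Qed.

Lemma wdiffD f g z : wdiff f z -> wdiff g z -> wdiff (fun w => f w + g w) z.
Proof. by move=> hf hg; exact: wirt_wdiff (wirtD hf hg). Qed.

Lemma wdiffM f g z : wdiff f z -> wdiff g z -> wdiff (fun w => f w * g w) z.
Proof. by move=> hf hg; exact: wirt_wdiff (wirtM hf hg). Qed.

Lemma wdiffV f z : f z != 0 -> wdiff f z -> wdiff (fun w => (f w)^-1) z.
Proof. by move=> f0 hf; exact: wirt_wdiff (wirtV f0 hf). Qed.

Lemma wdiff_conj f z : wdiff f z -> wdiff (fun w => (f w)^*%C) z.
Proof. by move=> hf; exact: wirt_wdiff (wirt_conj hf). Qed.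

Lemma wdiff_cst c z : wdiff (fun=> c) z.
Proof. exact: wirt_wdiff (wirt_cst c z). Qed.

Lemma wdiff_sum I (r : seq I) (P : pred I) (F : I -> V -> C) z :
  (forall i, P i -> wdiff (F i) z) -> wdiff (fun w => \sum_(i <- r | P i) F i w) z.
Proof. by move=> h; exact: wirt_wdiff (wirt_sum r h). Qed.

Section Rules.
Variables (f g : V -> C) (z : V) (k : 'I_n).
Hypotheses (hf : wdiff f z) (hg : wdiff g z).

Lemma dzD : dz k (fun w => f w + g w) z = dz k f z + dz k g z.
Proof. exact: wirt_dz (wirtD hf hg). Qed.

Lemma dzbarD : dzbar k (fun w => f w + g w) z = dzbar k f z + dzbar k g z.
Proof. exact: wirt_dzbar (wirtD hf hg). Qed.

Lemma dzM : dz k (fun w => f w * g w) z = dz k f z * g z + f z * dz k g z.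
Proof. exact: wirt_dz (wirtM hf hg). Qed.

Lemma dzbarM : dzbar k (fun w => f w * g w) z = dzbar k f z * g z + f z * dzbar k g z.
Proof. exact: wirt_dzbar (wirtM hf hg). Qed.

Lemma dzV : f z != 0 -> dz k (fun w => (f w)^-1) z = - (dz k f z / f z ^+ 2).
Proof. by move=> f0; exact: wirt_dz (wirtV f0 hf). Qed.

Lemma dzbarV : f z != 0 -> dzbar k (fun w => (f w)^-1) z = - (dzbar k f z / f z ^+ 2).
Proof. by move=> f0; exact: wirt_dzbar (wirtV f0 hf). Qed.

Lemma dz_conj : dz k (fun w => (f w)^*%C) z = (dzbar k f z)^*%C.
Proof. exact: wirt_dz (wirt_conj hf). Qed.

Lemma dzbar_conj : dzbar k (fun w => (f w)^*%C) z = (dz k f z)^*%C.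
Proof. exact: wirt_dzbar (wirt_conj hf). Qed.

End Rules.

Lemma dz_cst c z k : dz k (fun=> c) z = 0.
Proof. exact: wirt_dz (wirt_cst c z). Qed.

Lemma dzbar_cst c z k : dzbar k (fun=> c) z = 0.
Proof. exact: wirt_dzbar (wirt_cst c z). Qed.

Lemma dz_sum I (r : seq I) (P : pred I) (F : I -> V -> C) z k :
  (forall i, P i -> wdiff (F i) z) ->
  dz k (fun w => \sum_(i <- r | P i) F i w) z = \sum_(i <- r | P i) dz k (F i) z.
Proof. by move=> h; exact: wirt_dz (wirt_sum r h). Qed.

Lemma dzbar_sum I (r : seq I) (P : pred I) (F : I -> V -> C) z k :
  (forall i, P i -> wdiff (F i) z) ->
  dzbar k (fun w => \sum_(i <- r | P i) F i w) z = \sum_(i <- r | P i) dzbar k (F i) z.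
Proof. by move=> h; exact: wirt_dzbar (wirt_sum r h). Qed.

(** The mean value bound along the segment from [z] to [z + w]. *)
Lemma wirt_increment f z w (a b : V -> 'I_n -> C) (a0 b0 : 'I_n -> C) (e : R) :
  (forall t : R, 0 <= t <= 1 -> wirt f (z + t%:C%C *: w) (a (z + t%:C%C *: w)) (b (z + t%:C%C *: w))) ->
  (forall (t : R) k, 0 <= t <= 1 -> nc (a (z + t%:C%C *: w) k - a0 k) <= e) ->
  (forall (t : R) k, 0 <= t <= 1 -> nc (b (z + t%:C%C *: w) k - b0 k) <= e) ->
  nc (f (z + w) - f z - wform a0 b0 w) <= 4 * e * nv w.
Proof.
move=> hf ha hb.
have := @mean_value_bound R (fun t => f (z + t%:C%C *: w))
  (fun t => wform (a (z + t%:C%C *: w)) (b (z + t%:C%C *: w)) w) (wform a0 b0 w) (2 * e * nv w).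
rewrite scale1r scale0r addr0 => h.
have -> : 4 * e * nv w = 2 * (2 * e * nv w) by ring.
apply: h => t ht; first exact/wirt_line/hf.
have -> : wform (a (z + t%:C%C *: w)) (b (z + t%:C%C *: w)) w - wform a0 b0 w =
   wform (fun k => a (z + t%:C%C *: w) k - a0 k) (fun k => b (z + t%:C%C *: w) k - b0 k) w.
  by rewrite /wform -sumrB; apply: eq_bigr => k _; ring.
by apply: nc_wform => k; [exact: ha | exact: hb].
Qed.

(** The [2n] real coordinate directions of [C^n]; the flag selects the imaginary one. *)
Definition dirv (i : 'I_n * bool) : V := (if i.2 then 'i%C else 1) *: delta_mx 0 i.1.
Definition crd (i : 'I_n * bool) z : R :=
  if i.2 then complex.Im (z 0 i.1) else complex.Re (z 0 i.1).

Lemma dirv_sum w : w = \sum_i (crd i w)%:C%C *: dirv i.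
Proof.
rewrite -(pair_bigA _ (fun k (c : bool) => (crd (k, c) w)%:C%C *: dirv (k, c))) /=.
rewrite [LHS]row_sum_delta; apply: eq_bigr => k _.
rewrite big_bool /= /crd /dirv /= scale1r addrC scalerA -scalerDl.
by rewrite [_ * 'i%C]mulrC -complexE.
Qed.

Lemma crdD i z w : crd i (z + w) = crd i z + crd i w.
Proof.
rewrite /crd mxE; case: i.2; by case: (z 0 i.1) => ? ?; case: (w 0 i.1).
Qed.

Lemma crdZ i (t : R) w : crd i (t%:C%C *: w) = t * crd i w.
Proof.
rewrite /crd mxE; case: i.2; case: (w 0 i.1) => x y /=; ring.
Qed.

Lemma crd_dirv i j : crd i (dirv j) = (i == j)%:R.
Proof.
case: i j => [k b] [l c]; rewrite /crd /dirv /= !mxE eqxx /= xpair_eqE.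
by case: (k == l); rewrite /= ?mulr1n ?mulr0n ?mulr1 ?mulr0; case: b c => [] [].
Qed.

Lemma crd0 i : crd i 0 = 0.
Proof. by rewrite /crd mxE; case: i.2. Qed.

Lemma le_crd i w : `|crd i w| <= nv w.
Proof.
apply: le_trans (nv_coord w i.1); rewrite /crd; case: i.2; [exact: nc_Im|exact: nc_Re].
Qed.

Lemma nv_dirv i : nv (dirv i) = 1.
Proof. by rewrite /dirv nvZ nv_delta mulr1; case: i.2; rewrite ?nc_i ?nc1. Qed.

Lemma rderivable_line f v z (t : R) : rderivable f v (z + t%:C%C *: v) ->
  has_diffR nc (fun t : R => f (z + t%:C%C *: v)) t
    (fun s => s%:C%C * rderive v f (z + t%:C%C *: v)).
Proof.
move=> [h1 h2]; apply: has_diff_shift.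
have -> : (fun x : R => f (z + (t + x)%:C%C *: v)) =
          (fun x : R => f (z + t%:C%C *: v + x%:C%C *: v)).
  by apply/funext => x; rewrite -addrA -scalerDl -rmorphD.
apply/has_diffR_ReIm; rewrite /rderive !derive1E /=.
split; [exact: (derivableP h1)|exact: (derivableP h2)].
Qed.

Lemma rderivable_increment f v z (c e : R) (D : C) :
  (forall t : R, 0 <= t <= 1 -> rderivable f v (z + (t * c)%:C%C *: v)) ->
  (forall t : R, 0 <= t <= 1 -> nc (rderive v f (z + (t * c)%:C%C *: v) - D) <= e) ->
  nc (f (z + c%:C%C *: v) - f z - c%:C%C * D) <= 2 * e * `|c|.
Proof.
move=> hd he.
have := @mean_value_bound R (fun t => f (z + (t * c)%:C%C *: v))
  (fun t => c%:C%C * rderive v f (z + (t * c)%:C%C *: v)) (c%:C%C * D) (e * `|c|).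
rewrite mul1r mul0r scale0r addr0 mulrA; apply=> t ht; last first.
  by rewrite -mulrBr ncM nc_real mulrC ler_wpM2r // he.
have hl : has_diffR (fun x : R => `|x|) (fun t : R => t * c) t (fun s => s * c).
  split; first by exists `|c| => // s; rewrite normrM mulrC.
  move=> r r0; exists 1 => // s _; rewrite mulrDl (addrC (t * c)) addrK subrr normr0.
  by rewrite mulr_ge0 // ltW.
have := has_diff_comp (M := fun s => s%:C%C * rderive v f (z + (t * c)%:C%C *: v))
  is_norm_real is_norm_real hC _ hl (rderivable_line (hd t ht)).
move=> h; apply: has_diff_eqL (h _) => [s|s1 s2]; first by rewrite rmorphM /= mulrA.
by rewrite rmorphD /= mulrDl.
Qed.

(** Move from [z] to [z + w] along one real coordinate direction at a time; the continuity of the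
    partial derivatives makes each of the [2n] errors small with respect to [w]. *)
Lemma C1_wdiff f U z : open U -> U z ->
  (forall v w, U w -> rderivable f v w) ->
  (forall v w, U w -> {for w, continuous (rderive v f)}) -> wdiff f z.
Proof.
move=> /[swap] Uz; rewrite openE => /(_ z Uz) /nbhsVP [r r0 Ur] hd hc.
pose L w := \sum_i (crd i w)%:C%C * rderive (dirv i) f z.
have E : wform (fun k => (rderive (dirv (k, false)) f z - 'i%C * rderive (dirv (k, true)) f z) / 2)
      (fun k => (rderive (dirv (k, false)) f z + 'i%C * rderive (dirv (k, true)) f z) / 2) = L.
  apply/funext => w; rewrite /L.
  rewrite -(pair_bigA _ (fun k (c : bool) => (crd (k, c) w)%:C%C * rderive (dirv (k, c)) f z)) /=.
  apply: eq_bigr => k _; rewrite big_bool /= /crd /=.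
  set x := rderive _ _ _; set y := rderive _ _ _.
  have : (2 : C) != 0 by rewrite pnatr_eq0.
  rewrite [in LHS](complexE (w 0 k)) conjcD conjcM !conjc_real conjc_i.
  have := sqr_i R; set im := 'i%C; move=> i2 n2.
  set p := (complex.Re _)%:C%C; set q := (complex.Im _)%:C%C.
  have -> : (x - im * y) / 2 * (p + im * q) + (x + im * y) / 2 * (p + - im * q) =
     p * x - (im ^+ 2) * q * y by field.
  by rewrite i2; ring.
have K0 : 0 <= \sum_i nc (rderive (dirv i) f z) by apply: sumr_ge0 => i _; exact: nc_ge0.
suff : wirt f z (fun k => (rderive (dirv (k, false)) f z - 'i%C * rderive (dirv (k, true)) f z) / 2)
      (fun k => (rderive (dirv (k, false)) f z + 'i%C * rderive (dirv (k, true)) f z) / 2).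
  exact: wirt_wdiff.
rewrite /wirt E; split.
  exists (\sum_i nc (rderive (dirv i) f z)) => // w.
  apply: le_trans (nc_sum _ _ _) _; rewrite mulr_suml; apply: ler_sum => i _.
  by rewrite ncM nc_real mulrC ler_wpM2l ?nc_ge0 ?le_crd.
move=> e e0; set N : R := (2 * #|{: 'I_n * bool}|%:R) + 1.
have N0 : 0 < N by rewrite ltr_wpDl // mulr_ge0.
have e10 : 0 < e / N by rewrite divr_gt0.
have [d d0 hdd] : exists2 d : R, 0 < d & forall i w, nv (w - z) < d ->
    nc (rderive (dirv i) f w - rderive (dirv i) f z) < e / N.
  have := @finite_radius R _ (fun i (d : R) => forall w, nv (w - z) < d ->
    nc (rderive (dirv i) f w - rderive (dirv i) f z) < e / N).
  apply=> [i|i d d' d'd H w hw]; first by have /continuousVP := hc (dirv i) z Uz; exact.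
  by apply: H; exact: lt_le_trans d'd.
have path w (s : seq ('I_n * bool)) : \sum_(i <- s) `|crd i w| < Num.min d r ->
    nc (f (z + \sum_(i <- s) (crd i w)%:C%C *: dirv i) - f z
      - \sum_(i <- s) (crd i w)%:C%C * rderive (dirv i) f z)
    <= 2 * (e / N) * \sum_(i <- s) `|crd i w|.
  elim: s => [|i s IH]; first by rewrite !big_nil addr0 subrr subr0 nc0 mulr0.
  rewrite !big_cons; set S := \sum_(j <- s) _ *: _; set A := \sum_(j <- s) `|_|.
  set B := \sum_(j <- s) _ * _; set c := crd i w => hcA.
  have hA : A < Num.min d r by apply: le_lt_trans hcA; rewrite lerDr.
  have nS : nv S <= A.
    rewrite /S /A; elim: (s) => [|j s' IHs]; first by rewrite !big_nil nv0.
    rewrite !big_cons; apply: le_trans (nvD _ _) _; apply: lerD IHs.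
    by rewrite nvZ nc_real nv_dirv mulr1.
  have near_z (t : R) : 0 <= t <= 1 -> nv (z + S + (t * c)%:C%C *: dirv i - z) < Num.min d r.
    move=> /andP [t0 t1]; rewrite (addrC z) addrAC addrK; apply: le_lt_trans hcA.
    apply: le_trans (nvD _ _) _; rewrite addrC; apply: lerD nS.
    by rewrite nvZ nc_real nv_dirv mulr1 normrM (ger0_norm t0) ler_piMl.
  have := @rderivable_increment f (dirv i) (z + S) c (e / N) (rderive (dirv i) f z).
  have h1 (t : R) : 0 <= t <= 1 -> rderivable f (dirv i) (z + S + (t * c)%:C%C *: dirv i).
    by move=> /near_z; rewrite lt_min => /andP [_ /Ur]; exact: hd.
  have h2 (t : R) : 0 <= t <= 1 ->
      nc (rderive (dirv i) f (z + S + (t * c)%:C%C *: dirv i) - rderive (dirv i) f z) <= e / N.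
    by move=> /near_z; rewrite lt_min => /andP [/hdd /ltW h _].
  move=> /(_ h1 h2) h3; rewrite mulrDr.
  have -> : f (z + (c%:C%C *: dirv i + S)) - f z - (c%:C%C * rderive (dirv i) f z + B) =
    (f (z + S + c%:C%C *: dirv i) - f (z + S) - c%:C%C * rderive (dirv i) f z) +
    (f (z + S) - f z - B) by rewrite (addrC _ S) addrA; ring.
  by apply: le_trans (ncD _ _) _; apply: lerD h3 (IH hA).
have M0 : 0 < Num.min d r by rewrite lt_min d0.
have crdN w : \sum_i `|crd i w| <= #|{: 'I_n * bool}|%:R * nv w.
  rewrite mulr_natl -sumr_const; apply: ler_sum => i _; exact: le_crd.
exists (Num.min d r / N) => [|w hw]; first by rewrite divr_gt0.
have hw2 : \sum_i `|crd i w| < Num.min d r.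
  apply: le_lt_trans (crdN w) _; rewrite ltr_pdivlMr // in hw.
  apply: le_lt_trans hw; rewrite mulrC ler_wpM2l ?nv_ge0 // /N.
  have : 0 <= #|{: 'I_n * bool}|%:R :> R by []; lra.
have := path w (index_enum _) hw2; rewrite -dirv_sum => /le_trans; apply.
apply: le_trans (ler_wpM2l _ (crdN w)) _; first by rewrite mulr_ge0 // ltW.
rewrite [X in X <= _]mulrA ler_wpM2r ?nv_ge0 //.
have -> : 2 * (e / N) * #|{: 'I_n * bool}|%:R = e / N * (2 * #|{: 'I_n * bool}|%:R) by ring.
by apply: ratio_le; rewrite ?mulr_ge0 // ltW.
Qed.

(** The chain rule, without holomorphy of [T]: both Wirtinger derivatives of [T] contribute to each
    of those of the composite. *)
Lemma wirt_comp (F : V -> C) (T : V -> V) z A B (a b : 'I_n -> 'I_n -> C) :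
  (forall p, wirt (fun w => T w 0 p) z (a p) (b p)) -> wirt F (T z) A B ->
  wirt (fun w => F (T w)) z
    (fun k => \sum_p (A p * a p k + B p * (b p k)^*%C))
    (fun k => \sum_p (A p * b p k + B p * (a p k)^*%C)).
Proof.
move=> hT hF.
have hrow : has_diff (@nv R n) (@nv R n) T z (fun w => \row_p wform (a p) (b p) w).
  by apply: has_diff_row => // p; apply: has_diff_eqL (hT p) => w; rewrite mxE.
apply: has_diff_eqL (has_diff_comp hV hV hC (wformD A B) hrow hF) => w.
rewrite {1}/wform [RHS]/wform.
have -> : \sum_k ((\sum_p (A p * a p k + B p * (b p k)^*%C)) * w 0 k +
     (\sum_p (A p * b p k + B p * (a p k)^*%C)) * (w 0 k)^*%C) =
   \sum_k \sum_p (A p * (a p k * w 0 k + b p k * (w 0 k)^*%C) +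
      B p * (a p k * w 0 k + b p k * (w 0 k)^*%C)^*%C).
  apply: eq_bigr => k _; rewrite !mulr_suml -big_split; apply: eq_bigr => p _ /=.
  by rewrite conjcD !conjcM conjcK; ring.
rewrite exchange_big; apply: eq_bigr => p _ /=.
by rewrite mxE big_split -!mulr_sumr /wform conjc_sum.
Qed.

Section Chain.
Variables (F : V -> C) (T : V -> V) (z : V).
Hypotheses (hT : forall p, wdiff (fun w => T w 0 p) z) (hF : wdiff F (T z)).

Lemma wdiff_comp : wdiff (fun w => F (T w)) z.
Proof. exact: wirt_wdiff (wirt_comp hT hF). Qed.

Lemma dz_comp k : dz k (fun w => F (T w)) z =
  \sum_p (dz p F (T z) * dz k (fun w => T w 0 p) z
          + dzbar p F (T z) * (dzbar k (fun w => T w 0 p) z)^*%C).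
Proof. exact: wirt_dz (wirt_comp hT hF). Qed.

Lemma dzbar_comp k : dzbar k (fun w => F (T w)) z =
  \sum_p (dz p F (T z) * dzbar k (fun w => T w 0 p) z
          + dzbar p F (T z) * (dz k (fun w => T w 0 p) z)^*%C).
Proof. exact: wirt_dzbar (wirt_comp hT hF). Qed.

End Chain.

Lemma continuous_row (T : V -> V) z :
  (forall p, {for z, continuous (fun w => T w 0 p)}) -> {for z, continuous T}.
Proof.
move=> h P /nbhsVP [e e0 hP].
have n0 : 0 < n.+1%:R :> R by [].
case: (@finite_radius R _ (fun p (d : R) => forall w, nv (w - z) < d ->
    nc (T w 0 p - T z 0 p) < e / n.+1%:R)) => [p|p d d' dd' h' w hw|d d0 hd].
- by have /continuousVP := h p; apply; rewrite divr_gt0.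
- by apply: h'; exact: lt_le_trans dd'.
apply/nbhsVP; exists d => // w hw; apply: hP.
apply: le_lt_trans (_ : \sum_(p < n) e / n.+1%:R < _).
  by apply: ler_sum => p _; have := hd p w hw; rewrite !mxE; exact: ltW.
rewrite sumr_const card_ord -[X in X < _]mulr_natr -mulrA gtr_pMr // mulrC.
by rewrite ltr_pdivrMr // mul1r ltr_nat.
Qed.

Lemma near_eq_continuous f g z :
  (\forall w \near z, f w = g w) -> {for z, continuous f} -> {for z, continuous g}.
Proof.
move=> /nbhsVP [r r0 fg] /continuousVP h; apply/continuousVP => e /h [d d0 hd].
exists (Num.min d r) => [|w]; first by rewrite lt_min d0.
rewrite lt_min => /andP [/hd h1 h2]; rewrite -!fg //.
by rewrite subrr nv0.
Qed.

Lemma continuous_cst (c : C) z : {for z, continuous (fun _ : V => c)}.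
Proof. by apply/continuousVP => e e0; exists 1 => // w _; rewrite subrr nc0. Qed.

Lemma continuous_conjc f z : {for z, continuous f} -> {for z, continuous (fun w => (f w)^*%C)}.
Proof.
move=> /continuousVP h; apply/continuousVP => e /h [d d0 hd]; exists d => // w /hd.
by rewrite -conjcB nc_conj.
Qed.

(** * Functions of class C^k *)

(** Class [C^k] in the real sense, expressed through the two Wirtinger derivatives so that the
    calculus rules yield closure properties by induction on [k]. *)
Fixpoint wclass (k : nat) U f : Prop :=
  (forall z, U z -> {for z, continuous f}) /\
  if k is k'.+1 then
    (forall z, U z -> wdiff f z) /\
    forall j, wclass k' U (dz j f) /\ wclass k' U (dzbar j f)
  else True.

Lemma open_near_eq U f g z : open U -> U z -> (forall w, U w -> f w = g w) ->
  \forall w \near z, f w = g w.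
Proof. by rewrite openE => oU /oU Uz fg; apply: filterS Uz. Qed.

Lemma wclass_continuous k U f z : wclass k U f -> U z -> {for z, continuous f}.
Proof. by case: k => [|k] [h _]; exact: h. Qed.

Lemma wclass_wdiff k U f z : wclass k.+1 U f -> U z -> wdiff f z.
Proof. by move=> [_ [h _]]; exact: h. Qed.

Lemma wclass_dz k U f j : wclass k.+1 U f -> wclass k U (dz j f).
Proof. by move=> [_ [_ h]]; have [] := h j. Qed.

Lemma wclass_dzbar k U f j : wclass k.+1 U f -> wclass k U (dzbar j f).
Proof. by move=> [_ [_ h]]; have [] := h j. Qed.

Lemma wclass_pred k U f : wclass k.+1 U f -> wclass k U f.
Proof.
elim: k f => [|k IH] f [hc [hd h]]; first by [].
split; first exact: hc.
split=> [z Uz|j]; first exact: hd.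
by have [h1 h2] := h j; split; exact: IH.
Qed.

Lemma wclass_le k l U f : (k <= l)%N -> wclass l U f -> wclass k U f.
Proof.
elim: l => [|l IH]; first by rewrite leqn0 => /eqP ->.
by rewrite leq_eqVlt => /orP [/eqP -> //|/IH h /wclass_pred].
Qed.

Lemma wclass_sub k U U' f : U' `<=` U -> wclass k U f -> wclass k U' f.
Proof.
move=> UU'; elim: k f => [|k IH] f; first by move=> [h _]; split=> [z /UU' /h|].
move=> [hc [hd h]]; split=> [z /UU' /hc //|]; split=> [z /UU' /hd //|j].
by have [h1 h2] := h j; split; exact: IH.
Qed.

Lemma wclass_eq k U f g : open U -> (forall z, U z -> f z = g z) ->
  wclass k U f -> wclass k U g.
Proof.
move=> oU; elim: k f g => [|k IH] f g fg.
  move=> [h _]; split=> [z Uz|//].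
  exact: near_eq_continuous (open_near_eq oU Uz fg) (h z Uz).
move=> [hc [hd h]]; split.
  move=> z Uz; exact: near_eq_continuous (open_near_eq oU Uz fg) (hc z Uz).
split=> [z Uz|j]; first exact: near_eq_wdiff (open_near_eq oU Uz fg) (hd z Uz).
have [h1 h2] := h j; split.
  apply: IH h1 => z Uz; exact: near_eq_dz (open_near_eq oU Uz fg) (hd z Uz).
by apply: IH h2 => z Uz; exact: near_eq_dzbar (open_near_eq oU Uz fg) (hd z Uz).
Qed.

Section ClassRules.
Variable U : set V.
Hypothesis oU : open U.

Lemma wclass_cst k c : wclass k U (fun=> c).
Proof.
elim: k c => [|k IH] c; first by split=> [z _|]; [exact: continuous_cst|].
split=> [z _|]; first exact: continuous_cst.
split=> [z _|j]; first exact: wdiff_cst.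
have -> : dz j (fun _ : V => c) = fun=> 0 by apply/funext => z; exact: dz_cst.
have -> : dzbar j (fun _ : V => c) = fun=> 0 by apply/funext => z; exact: dzbar_cst.
by split; exact: IH.
Qed.

Lemma wclass_coord k p : wclass k U (fun w => w 0 p).
Proof.
case: k => [|k]; first by split=> [z _|]; [exact: continuous_coord|].
split=> [z _|]; first exact: continuous_coord.
split=> [z _|j]; first exact: wirt_wdiff (wirt_coord p z).
have -> : dz j (fun w : V => w 0 p) = fun=> (j == p)%:R.
  by apply/funext => z; exact: wirt_dz (wirt_coord p z).
have -> : dzbar j (fun w : V => w 0 p) = fun=> 0.
  by apply/funext => z; exact: wirt_dzbar (wirt_coord p z).
by split; exact: wclass_cst.
Qed.

Lemma wclassD k f g : wclass k U f -> wclass k U g -> wclass k U (fun w => f w + g w).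
Proof.
elim: k f g => [|k IH] f g hf hg.
  split=> [z Uz|]; last exact: I.
  exact: continuousD (wclass_continuous hf Uz) (wclass_continuous hg Uz).
split=> [z Uz|].
  exact: continuousD (wclass_continuous hf Uz) (wclass_continuous hg Uz).
split=> [z Uz|j]; first exact: wdiffD (wclass_wdiff hf Uz) (wclass_wdiff hg Uz).
split.
  apply: wclass_eq (IH _ _ (wclass_dz j hf) (wclass_dz j hg)) => // z Uz.
  by rewrite dzD //; [exact: wclass_wdiff hf Uz|exact: wclass_wdiff hg Uz].
apply: wclass_eq (IH _ _ (wclass_dzbar j hf) (wclass_dzbar j hg)) => // z Uz.
by rewrite dzbarD //; [exact: wclass_wdiff hf Uz|exact: wclass_wdiff hg Uz].
Qed.

Lemma wclassM k f g : wclass k U f -> wclass k U g -> wclass k U (fun w => f w * g w).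
Proof.
elim: k f g => [|k IH] f g hf hg.
  split=> [z Uz|]; last exact: I.
  exact: continuousM (wclass_continuous hf Uz) (wclass_continuous hg Uz).
split=> [z Uz|].
  exact: continuousM (wclass_continuous hf Uz) (wclass_continuous hg Uz).
split=> [z Uz|j]; first exact: wdiffM (wclass_wdiff hf Uz) (wclass_wdiff hg Uz).
have hf' := wclass_pred hf; have hg' := wclass_pred hg; split.
  apply: wclass_eq (wclassD (IH _ _ (wclass_dz j hf) hg') (IH _ _ hf' (wclass_dz j hg))) => // z Uz.
  by rewrite dzM //; [exact: wclass_wdiff hf Uz|exact: wclass_wdiff hg Uz].
apply: wclass_eq (wclassD (IH _ _ (wclass_dzbar j hf) hg') (IH _ _ hf' (wclass_dzbar j hg))) => // z Uz.
by rewrite dzbarM //; [exact: wclass_wdiff hf Uz|exact: wclass_wdiff hg Uz].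
Qed.

Lemma wclass_conj k f : wclass k U f -> wclass k U (fun w => (f w)^*%C).
Proof.
elim: k f => [|k IH] f hf.
  split=> [z Uz|]; last exact: I.
  by apply: continuous_conjc; exact: wclass_continuous hf Uz.
split=> [z Uz|]; first by apply: continuous_conjc; exact: wclass_continuous hf Uz.
split=> [z Uz|j]; first exact: wdiff_conj (wclass_wdiff hf Uz).
split.
  apply: wclass_eq (IH _ (wclass_dzbar j hf)) => // z Uz.
  by rewrite dz_conj //; exact: wclass_wdiff hf Uz.
apply: wclass_eq (IH _ (wclass_dz j hf)) => // z Uz.
by rewrite dzbar_conj //; exact: wclass_wdiff hf Uz.
Qed.

Lemma wclassZ k c f : wclass k U f -> wclass k U (fun w => c * f w).
Proof. by move=> h; apply: wclassM => //; exact: wclass_cst. Qed.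

Lemma wclassN k f : wclass k U f -> wclass k U (fun w => - f w).
Proof. by move=> /(wclassZ (-1)); apply: wclass_eq => // z _; rewrite mulN1r. Qed.

Lemma wclassB k f g : wclass k U f -> wclass k U g -> wclass k U (fun w => f w - g w).
Proof. by move=> hf /wclassN; exact: wclassD. Qed.

Lemma wclass_sum k I (r : seq I) (P : pred I) (F : I -> V -> C) :
  (forall i, P i -> wclass k U (F i)) -> wclass k U (fun w => \sum_(i <- r | P i) F i w).
Proof.
move=> h; elim: r => [|i r IH].
  by apply: wclass_eq (wclass_cst k 0) => // z _; rewrite big_nil.
case Pi: (P i).
  by apply: wclass_eq (wclassD (h i Pi) IH) => // z _; rewrite big_cons Pi.
by apply: wclass_eq IH => // z _; rewrite big_cons Pi.
Qed.

Lemma wclass_prod k I (r : seq I) (P : pred I) (F : I -> V -> C) :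
  (forall i, P i -> wclass k U (F i)) -> wclass k U (fun w => \prod_(i <- r | P i) F i w).
Proof.
move=> h; elim: r => [|i r IH].
  by apply: wclass_eq (wclass_cst k 1) => // z _; rewrite big_nil.
case Pi: (P i).
  by apply: wclass_eq (wclassM (h i Pi) IH) => // z _; rewrite big_cons Pi.
by apply: wclass_eq IH => // z _; rewrite big_cons Pi.
Qed.

Lemma wclassV k f : (forall z, U z -> f z != 0) -> wclass k U f ->
  wclass k U (fun w => (f w)^-1).
Proof.
move=> f0; elim: k => [|k IH] hf.
  split=> [z Uz|]; last exact: I.
  exact: continuousV (f0 z Uz) (wclass_continuous hf Uz).
split=> [z Uz|]; first exact: continuousV (f0 z Uz) (wclass_continuous hf Uz).
split=> [z Uz|j]; first exact: wdiffV (f0 z Uz) (wclass_wdiff hf Uz).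
have hi := IH (wclass_pred hf); split.
  apply: wclass_eq (wclassN (wclassM (wclass_dz j hf) (wclassM hi hi))) => // z Uz.
  rewrite dzV ?f0 //; last exact: wclass_wdiff hf Uz.
  by rewrite expr2 invfM.
apply: wclass_eq (wclassN (wclassM (wclass_dzbar j hf) (wclassM hi hi))) => // z Uz.
rewrite dzbarV ?f0 //; last exact: wclass_wdiff hf Uz.
by rewrite expr2 invfM.
Qed.

Lemma wclass_comp k (U' : set V) (F : V -> C) (T : V -> V) :
  (forall z, U z -> U' (T z)) -> (forall p, wclass k U (fun w => T w 0 p)) ->
  wclass k U' F -> wclass k U (fun w => F (T w)).
Proof.
move=> TU; elim: k F => [|k IH] F hT hF.
  split=> [z Uz|]; last exact: I.
  apply: continuous_comp; last exact: wclass_continuous hF (TU z Uz).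
  by apply: continuous_row => p; exact: wclass_continuous (hT p) Uz.
split=> [z Uz|].
  apply: continuous_comp; last exact: wclass_continuous hF (TU z Uz).
  by apply: continuous_row => p; exact: wclass_continuous (hT p) Uz.
have hd z : U z -> forall p, wdiff (fun w => T w 0 p) z.
  by move=> Uz p; exact: wclass_wdiff (hT p) Uz.
have hFd z : U z -> wdiff F (T z) by move=> Uz; exact: wclass_wdiff hF (TU z Uz).
have hT' p : wclass k U (fun w => T w 0 p) by exact: wclass_pred.
split=> [z Uz|j]; first exact: wdiff_comp (hd z Uz) (hFd z Uz).
split.
  apply: wclass_eq oU (fun z Uz => esym (dz_comp (hd z Uz) (hFd z Uz) j)) _.
  apply: wclass_sum => p _; apply: wclassD; apply: wclassM.
  - by apply: IH => //; exact: wclass_dz.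
  - exact: wclass_dz.
  - by apply: IH => //; exact: wclass_dzbar.
  - by apply: wclass_conj; exact: wclass_dzbar.
apply: wclass_eq oU (fun z Uz => esym (dzbar_comp (hd z Uz) (hFd z Uz) j)) _.
apply: wclass_sum => p _; apply: wclassD; apply: wclassM.
- by apply: IH => //; exact: wclass_dz.
- exact: wclass_dzbar.
- by apply: IH => //; exact: wclass_dzbar.
- by apply: wclass_conj; exact: wclass_dz.
Qed.

(** Smoothness given by iterated directional derivatives, as for the coefficients of a metric,
    enters the calculus here. *)
Lemma rdiff_wclass k f : rdiff_class k U f -> wclass k U f.
Proof.
elim: k f => [|k IH] f; first by [].
move=> [hc hd]; split=> //; split=> [z Uz|j].
  apply: (C1_wdiff oU Uz) => [v w Uw|v w Uw]; first by have [h _] := hd v; exact: h.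
  have [_ h] := hd v; case: (k) h => [|l] [h _]; exact: h.
have hv v : wclass k U (rderive v f) by apply: IH; have [] := hd v.
split; apply: wclassM; try exact: wclass_cst.
  by apply: wclassB => //; apply: wclassZ.
by apply: wclassD => //; apply: wclassZ.
Qed.

End ClassRules.

(** * Symmetry of second derivatives *)

Fact second_difference_alg (A B E F G S : C) :
  S * (A - B) - S * S * G = S * (A - E - (F + S * G) - (B - E - F)).
Proof. by ring. Qed.

Fact second_difference_est (s e P Q T : R) : 0 < s -> T <= P + Q ->
  P <= e / 4 * s -> Q <= e / 4 * s -> s * T <= e / 2 * s ^+ 2.
Proof.
move=> s0 h1 h2 h3; have -> : e / 2 * s ^+ 2 = s * (e / 4 * s + e / 4 * s) by field.
by rewrite ler_wpM2l ?(ltW s0) //; apply: le_trans h1 _; exact: lerD.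
Qed.

(** The left-hand side is symmetric in [u] and [v] apart from the last term, whence the symmetry of
    second derivatives. *)
Lemma second_difference f (u v z : V) a b :
  (\forall w \near z, wdiff f w) ->
  wirt (fun w => wform (fun k => dz k f w) (fun k => dzbar k f w) v) z a b ->
  forall e : R, 0 < e -> exists2 d : R, 0 < d & forall s : R, 0 < s -> s < d ->
    nc (f (z + s%:C%C *: u + s%:C%C *: v) - f (z + s%:C%C *: u)
        - f (z + s%:C%C *: v) + f z - (s ^+ 2)%:C%C * wform a b u) <= e * s ^+ 2.
Proof.
move=> /nbhsVP [r r0 hr] [_ hD] e e0.
pose D w := wform (fun k => dz k f w) (fun k => dzbar k f w) v.
set N := nv u + nv v; have N0 : 0 <= N by rewrite addr_ge0 ?nv_ge0.
have N1 : 0 < N + 1 by rewrite ltr_wpDl.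
have e40 : 0 < e / 4 / (N + 1) by rewrite !divr_gt0.
have [d d0 hd] := hD _ e40.
exists (Num.min d r / (N + 1)) => [|s s0]; first by rewrite divr_gt0 // lt_min d0.
rewrite ltr_pdivlMr // => sd.
have small (t c : R) : 0 <= t <= 1 -> 0 <= c <= 1 ->
    nv (t%:C%C *: (s%:C%C *: v) + c%:C%C *: (s%:C%C *: u)) <= s * N.
  move=> /andP [t0 t1] /andP [c0 c1]; apply: le_trans (nvD _ _) _.
  rewrite !nvZ !nc_real !ger0_norm ?(ltW s0) // /N.
  have h1 : t * (s * nv v) <= s * nv v by rewrite ler_piMl // mulr_ge0 ?nv_ge0 // ltW.
  have h2 : c * (s * nv u) <= s * nv u by rewrite ler_piMl // mulr_ge0 ?nv_ge0 // ltW.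
  lra.
have small2 (t c : R) : 0 <= t <= 1 -> 0 <= c <= 1 ->
    nv (t%:C%C *: (s%:C%C *: v) + c%:C%C *: (s%:C%C *: u)) < Num.min d r.
  by move=> ht hc; apply: le_lt_trans (small t c ht hc) _; apply: le_lt_trans sd; nra.
have bracket (t c : R) : 0 <= t <= 1 -> 0 <= c <= 1 ->
    nc (D (z + (t%:C%C *: (s%:C%C *: v) + c%:C%C *: (s%:C%C *: u))) - D z -
      wform a b (t%:C%C *: (s%:C%C *: v) + c%:C%C *: (s%:C%C *: u))) <= e / 4 * s.
  move=> ht hc; have := small2 t c ht hc; rewrite lt_min => /andP [/hd h _].
  apply: le_trans h _; apply: le_trans (ler_wpM2l (ltW e40) (small t c ht hc)) _.
  have -> : e / 4 / (N + 1) * (s * N) = s * (e / 4 / (N + 1) * N) by ring.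
  by rewrite mulrC ler_wpM2r ?(ltW s0) // ratio_le // ltW // divr_gt0.
have i0 : 0 <= (0 : R) <= 1 by rewrite lexx ler01.
have i1 : 0 <= (1 : R) <= 1 by rewrite lexx ler01.
have hline (c : R) (t : R) : 0 <= c <= 1 -> 0 <= t <= 1 ->
    has_diffR nc (fun t => f (z + c%:C%C *: (s%:C%C *: u) + t%:C%C *: (s%:C%C *: v))) t
      (fun q => q%:C%C * (s%:C%C * D (z + (t%:C%C *: (s%:C%C *: v) + c%:C%C *: (s%:C%C *: u))))).
  move=> hc ht; set y := z + c%:C%C *: (s%:C%C *: u).
  have := small2 t c ht hc; rewrite lt_min => /andP [_ hx].
  have E : z + (t%:C%C *: (s%:C%C *: v) + c%:C%C *: (s%:C%C *: u)) =
    y + t%:C%C *: (s%:C%C *: v) by rewrite addrCA addrC.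
  rewrite E /D -wformZ; apply: wirt_line; rewrite -E; apply: hr.
  by rewrite (addrC z) addrK.
(* The difference of [f] along two parallel segments, to which the mean value bound applies. *)
pose phi (t : R) := f (z + s%:C%C *: u + t%:C%C *: (s%:C%C *: v)) + -1 * f (z + t%:C%C *: (s%:C%C *: v)).
pose dphi (t : R) := s%:C%C * (D (z + (t%:C%C *: (s%:C%C *: v) + 1%:C%C *: (s%:C%C *: u)))
   - D (z + (t%:C%C *: (s%:C%C *: v) + 0%:C%C *: (s%:C%C *: u)))).
have := @mean_value_bound R phi dphi ((s ^+ 2)%:C%C * wform a b u) (e / 2 * s ^+ 2).
have -> : phi 1 - phi 0 - (s ^+ 2)%:C%C * wform a b u =
  f (z + s%:C%C *: u + s%:C%C *: v) - f (z + s%:C%C *: u)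
        - f (z + s%:C%C *: v) + f z - (s ^+ 2)%:C%C * wform a b u.
  by rewrite /phi !scale1r !scale0r !addr0; ring.
have -> : 2 * (e / 2 * s ^+ 2) = e * s ^+ 2 by field.
apply=> t ht.
  have h1 := hline 1 t i1 ht; have h0 := hline 0 t i0 ht.
  have h0' := has_diffZ is_norm_real (-1) h0.
  have := has_diffD hC h1 h0'; rewrite /phi /dphi.
  rewrite [1%:C%C *: (s%:C%C *: u)]scale1r scale0r addr0.
  move: (D (z + (_ + s%:C%C *: u))) (D (z + (_ + 0))) => A B.
  by apply: has_diff_eqL => q; move: (q%:C)%C (s%:C)%C => x y; ring.
have b1 := bracket t 1 ht i1; have b0 := bracket t 0 ht i0.
move: b1 b0; rewrite /dphi /=.
set x1 := _ + 1%:C%C *: _; set x0 := _ + 0%:C%C *: _ => b1 b0.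
have -> : s%:C%C * (D (z + x1) - D (z + x0)) - (s ^+ 2)%:C%C * wform a b u =
  s%:C%C * ((D (z + x1) - D z - wform a b x1) - (D (z + x0) - D z - wform a b x0)).
  have -> : wform a b x1 = wform a b x0 + s%:C%C * wform a b u.
    by rewrite -wformZ -wformD /x1 /x0 scale1r scale0r addr0.
  rewrite rmorphXn /= expr2.
  exact: second_difference_alg.
rewrite ncM nc_real (gtr0_norm s0).
apply: (second_difference_est s0 _ b1 b0).
by apply: le_trans (ncD _ _) _; rewrite ncN.
Qed.

Lemma wclass2_dir f U v z : open U -> wclass 2 U f -> U z ->
  wirt (fun w => wform (fun k => dz k f w) (fun k => dzbar k f w) v) z
    (fun j => wform (fun k => dz j (dz k f) z) (fun k => dz j (dzbar k f) z) v)
    (fun j => wform (fun k => dzbar j (dz k f) z) (fun k => dzbar j (dzbar k f) z) v).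
Proof.
move=> oU hf Uz; apply: wirt_sum => k _.
have h1 : wdiff (dz k f) z by exact: wclass_wdiff (wclass_dz k hf) Uz.
have h2 : wdiff (dzbar k f) z by exact: wclass_wdiff (wclass_dzbar k hf) Uz.
have := wirtD (wirtM h1 (wirt_cst (v 0 k) z)) (wirtM h2 (wirt_cst (v 0 k)^*%C z)).
have E (x y p q u w : C) : x * p + u * 0 + (y * q + w * 0) = x * p + y * q.
  by rewrite !mulr0 !addr0.
by apply: eq_wirt => j; exact: E.
Qed.

Lemma second_derivative_sym f U (u v z : V) : open U -> wclass 2 U f -> U z ->
  wform (fun j => wform (fun k => dz j (dz k f) z) (fun k => dz j (dzbar k f) z) v)
    (fun j => wform (fun k => dzbar j (dz k f) z) (fun k => dzbar j (dzbar k f) z) v) u =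
  wform (fun j => wform (fun k => dz j (dz k f) z) (fun k => dz j (dzbar k f) z) u)
    (fun j => wform (fun k => dzbar j (dz k f) z) (fun k => dzbar j (dzbar k f) z) u) v.
Proof.
move=> oU hf Uz.
pose H u v := wform (fun j => wform (fun k => dz j (dz k f) z) (fun k => dz j (dzbar k f) z) v)
    (fun j => wform (fun k => dzbar j (dz k f) z) (fun k => dzbar j (dzbar k f) z) v) u.
rewrite -/(H u v) -/(H v u); apply/eqP; rewrite -subr_eq0; apply/eqP; apply: nc_eq0.
apply/eqP; rewrite eq_le nc_ge0 andbT; apply/ler_addgt0Pr => e e0; rewrite add0r.
have e20 : 0 < e / 2 by rewrite divr_gt0.
have hn : \forall w \near z, wdiff f w.
  by move: oU; rewrite openE => /(_ z Uz); apply: filterS => w; exact: wclass_wdiff hf.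
have [d1 d10 h1] := @second_difference f u v z _ _ hn (wclass2_dir v oU hf Uz) _ e20.
have [d2 d20 h2] := @second_difference f v u z _ _ hn (wclass2_dir u oU hf Uz) _ e20.
have m0 : 0 < Num.min d1 d2 by rewrite lt_min d10.
have : Num.min d1 d2 / 2 < Num.min d1 d2 by lra.
have : 0 < Num.min d1 d2 / 2 by rewrite divr_gt0.
move: (Num.min d1 d2 / 2) => s s0; rewrite lt_min => /andP [/(h1 s s0) {}h1 /(h2 s s0) {}h2].
have s20 : 0 < s ^+ 2 by rewrite exprn_gt0.
rewrite -(ler_pM2l s20) -[s ^+ 2 in X in X <= _]gtr0_norm // -nc_real -ncM.
apply: le_trans (_ : e / 2 * s ^+ 2 + e / 2 * s ^+ 2 <= _); last lra.
apply: le_trans (lerD h2 h1); rewrite -[X in _ <= X + _]ncN addrC.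
apply: le_trans _ (ncD _ _); rewrite le_eqVlt; apply/orP; left; apply/eqP.
rewrite -ncN; congr nc; rewrite (addrAC z (s%:C%C *: v)) /H; ring.
Qed.

(** The real symmetry, tested on the vectors [e_j] and [i e_j], separates into symmetries of the
    blocks of Wirtinger derivatives. *)
Lemma hessian_sym (a b c d : 'I_n -> 'I_n -> C) :
  (forall u v : V, wform (fun j => wform (a j) (c j) v) (fun j => wform (b j) (d j) v) u =
     wform (fun j => wform (a j) (c j) u) (fun j => wform (b j) (d j) u) v) ->
  forall j k, a j k = a k j /\ c j k = b k j.
Proof.
move=> H j k.
have := H (delta_mx 0 j) (delta_mx 0 k); rewrite !wform_e => E1.
have := H ('i%C *: delta_mx 0 j) ('i%C *: delta_mx 0 k); rewrite !wform_ie => E2.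
have := H ('i%C *: delta_mx 0 j) (delta_mx 0 k); rewrite !wform_e !wform_ie !wform_e => E3.
have := H (delta_mx 0 j) ('i%C *: delta_mx 0 k); rewrite !wform_e !wform_ie !wform_e => E4.
have i2 := sqr_i R; have i0 : ('i%C : C) != 0.
  by apply/eqP => h; move: i2; rewrite h expr0n => /eqP; rewrite eq_sym oppr_eq0 oner_eq0.
have n2 : (2 : C) != 0 by rewrite pnatr_eq0.
have mulI (x y : C) : 'i%C * x = 'i%C * y -> x = y by exact: mulfI.
move: E2; rewrite -!mulrBr => /mulI/mulI E2.
move: E3; rewrite -mulrDr => /mulI E3; move: E4; rewrite -mulrDr => /mulI E4.
move: E1 E2 E3 E4.
move: (a j k) (a k j) (b j k) (b k j) (c j k) (c k j) (d j k) (d k j) => a1 a2 b1 b2 c1 c2 d1 d2.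
move=> E1 E2 E3 E4; have n4 : (4 : C) != 0 by rewrite pnatr_eq0.
split; apply: (mulfI n4).
- have -> : 4 * a1 = (a1 + c1 + (b1 + d1)) + (a1 - c1 - (b1 - d1)) + (a1 + c1 - (b1 + d1)) + (a1 - c1 + (b1 - d1)) by ring.
  by rewrite E1 E2 E3 E4; ring.
- have -> : 4 * c1 = (a1 + c1 + (b1 + d1)) - (a1 - c1 - (b1 - d1)) + (a1 + c1 - (b1 + d1)) - (a1 - c1 + (b1 - d1)) by ring.
  by rewrite E1 E2 E3 E4; ring.
Qed.

Section Schwarz.
Variables (f : V -> C) (U : set V) (z : V).
Hypotheses (oU : open U) (hf : wclass 2 U f) (Uz : U z).

Lemma dz_dzC j k : dz j (dz k f) z = dz k (dz j f) z.
Proof. by have [] := hessian_sym (fun u v => second_derivative_sym u v oU hf Uz) j k. Qed.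

Lemma dz_dzbarC j k : dz j (dzbar k f) z = dzbar k (dz j f) z.
Proof. by have [] := hessian_sym (fun u v => second_derivative_sym u v oU hf Uz) j k. Qed.

End Schwarz.

End Wirtinger.

(** * Integration over boxes *)

Section IntervalIntegral.
Context {R : realType}.
Variable B : R.
Hypothesis B0 : 0 < B.
Implicit Types (f g : R -> R).
Notation mu := (@lebesgue_measure R).

Definition rint f : R := \int[mu]_(t in `[- B, B]%classic) f t.

Lemma rint_integrable f : continuous f ->
  mu.-integrable `[- B, B]%classic (EFin \o f).
Proof.
move=> cf; apply: continuous_compact_integrable; first exact: segment_compact.
exact: continuous_subspaceT.
Qed.

Lemma rint_measurable : measurable (`[- B, B]%classic : set R).
Proof. exact: measurable_itv. Qed.

Lemma rintD f g : continuous f -> continuous g ->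
  rint (fun t => f t + g t) = rint f + rint g.
Proof.
by move=> cf cg; apply: RintegralD; [exact: rint_measurable| exact: rint_integrable..].
Qed.

Lemma rintZ (c : R) f : continuous f -> rint (fun t => c * f t) = c * rint f.
Proof. by move=> cf; apply: RintegralZl; [exact: rint_measurable| exact: rint_integrable]. Qed.

Lemma rint_le f g : continuous f -> continuous g ->
  (forall t, - B <= t <= B -> f t <= g t) -> rint f <= rint g.
Proof.
move=> cf cg fg; apply: le_Rintegral; [exact: rint_measurable| exact: rint_integrable..|].
by move=> t; rewrite /= in_itv /=; exact: fg.
Qed.

Lemma eq_rint f g : (forall t, - B <= t <= B -> f t = g t) -> rint f = rint g.
Proof. by move=> fg; apply: eq_Rintegral => t; rewrite inE /= in_itv /=; exact: fg. Qed.

Lemma rint_cst (c : R) : rint (fun=> c) = 2 * B * c.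
Proof.
rewrite /rint Rintegral_cst; last exact: rint_measurable.
have := @lebesgue_measure_itv R `[- B, B]; rewrite /= lte_fin ifT; last by have := B0; lra.
move=> E; transitivity (c * fine (B%:E - (- B)%:E)%E); first by congr (_ * fine _).
by rewrite /= mulrC; congr (_ * _); ring.
Qed.

Lemma rint_norm f (M : R) : continuous f ->
  (forall t, - B <= t <= B -> `|f t| <= M) -> `|rint f| <= 2 * B * M.
Proof.
move=> cf fM; have cc (c : R) : continuous (fun _ : R => c) by move=> x; exact: cvg_cst.
rewrite ler_norml; apply/andP; split.
  rewrite -mulrN -rint_cst; apply: rint_le => // t /fM.
  by rewrite ler_norml => /andP [].
by rewrite -rint_cst; apply: rint_le => // t /fM; rewrite ler_norml => /andP [].
Qed.

Lemma rint_bounded_cvg (f : nat -> R -> R) (M : R) :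
  (forall j, continuous (f j)) -> (forall j t, `|f j t| <= M) ->
  (forall t, - B <= t <= B -> (fun j => f j t) @ \oo --> (0 : R)) ->
  (fun j => rint (f j)) @ \oo --> (0 : R).
Proof.
move=> cf fM f0.
have cc (c : R) : continuous (fun _ : R => c) by move=> x; exact: cvg_cst.
have [|||||_ _] := @dominated_convergence _ _ R mu `[- B, B]%classic rint_measurable
  (fun j => EFin \o f j) (cst 0%E) (EFin \o (fun=> M)).
- by move=> j; have /integrableP [] := rint_integrable (cf j).
- exact: measurable_cst.
- apply: aeW => t /=; rewrite in_itv /= => /f0 h; apply: cvg_EFin => //.
  by near=> j.
- exact: rint_integrable.
- by apply: aeW => t j _ /=; rewrite lee_fin.
by rewrite integral0 => /fine_cvg.
Unshelve. all: by end_near.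
Qed.

(** The same primitive [F] serves for all small translates of [f], which makes their integrals
    comparable. *)
Lemma rint_primitive f (K : R) : B < K -> continuous f ->
  exists2 F : R -> R, (forall x, - K < x < K -> is_derive x (1 : R) F (f x)) &
    forall g (s : R), (forall t, g t = f (t + s)) -> B + `|s| < K -> rint g = F (B + s) - F (- B + s).
Proof.
move=> BK cf; pose F (x : R) := \int[mu]_(t in `[- K, x]%classic) f t.
have dF x : - K < x < K -> is_derive x (1 : R) F (f x).
  move=> /andP [x1 x2].
  have [] := @continuous_FTC1_closed R f (- K) x K x2 _ x1 (cf x).
    apply: continuous_compact_integrable; first exact: segment_compact.
    exact: continuous_subspaceT.
  by rewrite derive1E => h1 h2; apply: DeriveDef.
exists F => // g s gf sK.
have := ler_norm s; have := ler_norm (- s); rewrite normrN => s1 s2.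
pose G t := F (t + s).
have dG t : - B <= t <= B -> is_derive t (1 : R) G (g t).
  move=> /andP [t1 t2]; rewrite gf; apply/is_derive_has_diff.
  have /is_derive_has_diff [hK h] : is_derive (t + s) (1 : R) F (f (t + s)).
    by apply: dF; apply/andP; split; lra.
  split=> // e /h [d d0 hd]; exists d => // w /hd.
  by rewrite /G (addrAC t).
have cG t : - B <= t <= B -> {for t, continuous G}.
  move=> /dG [dg _]; apply: differentiable_continuous; exact/derivable1_diffP.
have cg : continuous g.
  have -> : g = f \o (fun t => t + s) by apply/funext.
  move=> t; apply: continuous_comp; last exact: cf.
  by apply: cvgD; [exact: cvg_id|exact: cvg_cst].
have bB : - B < B by have := B0; lra.
have LR : derivable_oo_LRcontinuous G (- B) B.
  split.
  - by move=> t; rewrite in_itv /= => /andP [t1 t2]; have [] := dG t; [rewrite !ltW|].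
  - by apply: cvg_at_right_filter; apply: cG; rewrite lexx ltW.
  - by apply: cvg_at_left_filter; apply: cG; rewrite lexx ltW.
have G' : {in `]- B, B[, G^`()%classic =1 g}.
  move=> t; rewrite in_itv /= => /andP [t1 t2]; rewrite derive1E.
  by have [] := dG t; [rewrite !ltW|].
by rewrite /rint /Rintegral (continuous_FTC2 bB (continuous_subspaceT cg) LR G').
Qed.

(** Translation invariance for a function whose support stays away from the end points: the
    primitive is constant near both of them. *)
Lemma rint_shift f (B' s : R) : B' + `|s| <= B -> 0 <= B' -> continuous f ->
  (forall t, B' <= `|t| -> f t = 0) -> rint (fun t => f (t + s)) = rint f.
Proof.
move=> sB B'0 cf f0; have := ler_norm s; have := ler_norm (- s); rewrite normrN => s1 s2.
have sp := normr_ge0 s.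
have [F dF hF] := @rint_primitive f (B + `|s| + 1) ltac:(lra) cf.
rewrite (hF _ s) //; last lra; rewrite (hF f 0); first last.
- by rewrite normr0; lra.
- by move=> t; rewrite addr0.
rewrite !addr0.
have cstF x y : - (B + `|s| + 1) < x -> x <= y -> y < B + `|s| + 1 ->
    (forall t, x <= t <= y -> f t = 0) -> F y = F x.
  move=> x1 xy y1 h0; apply/eqP; rewrite -subr_eq0; apply/eqP.
  have dF' t : x <= t <= y -> is_derive t (1 : R) F (f t).
    by move=> /andP [t1 t2]; apply: dF; apply/andP; split; lra.
  have [||c] := @MVT_segment R F f x y xy.
  - by move=> t; rewrite in_itv /= => /andP [t1 t2]; apply: dF'; rewrite !ltW.
  - apply: derivable_within_continuous => t; rewrite in_itv /= => ht.
    by have [] := dF' t ht.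
  by rewrite in_itv /= => hc ->; rewrite h0 // mul0r.
have e1 : F (B + s) = F B.
  have [s0|s0] := leP 0 s.
    apply: cstF; try lra; move=> t /andP [t1 t2]; apply: f0.
    by apply: le_trans (ler_norm t); lra.
  apply/esym; apply: cstF; try lra; move=> t /andP [t1 t2]; apply: f0.
  by apply: le_trans (ler_norm t); lra.
have e2 : F (- B + s) = F (- B).
  have [s0|s0] := leP 0 s.
    apply: cstF; try lra; move=> t /andP [t1 t2]; apply: f0.
    by rewrite -normrN; apply: le_trans (ler_norm (- t)); lra.
  apply/esym; apply: cstF; try lra; move=> t /andP [t1 t2]; apply: f0.
  by rewrite -normrN; apply: le_trans (ler_norm (- t)); lra.
by rewrite e1 e2.
Qed.

Lemma rint_gt0 f (t0 : R) : continuous f -> (forall t, 0 <= f t) ->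
  - B < t0 < B -> 0 < f t0 -> 0 < rint f.
Proof.
move=> cf f0 /andP [h1 h2] ft0.
have [F dF hF] := @rint_primitive f (B + 1) ltac:(lra) cf.
rewrite (hF f 0); [|by move=> t; rewrite addr0|rewrite normr0; lra].
rewrite !addr0 subr_gt0.
have mono x y : - B <= x -> x <= y -> y <= B -> F x <= F y.
  move=> x1 xy y1; rewrite -subr_ge0.
  have dF' t : x <= t <= y -> is_derive t (1 : R) F (f t).
    by move=> /andP [t1 t2]; apply: dF; apply/andP; split; lra.
  have [||c] := @MVT_segment R F f x y xy.
  - by move=> t; rewrite in_itv /= => /andP [t1 t2]; apply: dF'; rewrite !ltW.
  - apply: derivable_within_continuous => t; rewrite in_itv /= => ht.
    by have [] := dF' t ht.
  by rewrite in_itv /= => hc ->; rewrite mulr_ge0 ?f0 // subr_ge0.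
have /is_derive_has_diff [_ /(_ (f t0 / 2))] : is_derive t0 (1 : R) F (f t0).
  by apply: dF; apply/andP; split; lra.
move=> [|d d0 hd]; first by rewrite divr_gt0.
set w := Num.min (d / 2) (B - t0); have w0 : 0 < w by rewrite lt_min divr_gt0 //= subr_gt0.
have wd : `|w| < d.
  by rewrite gtr0_norm // /w gt_min; apply/orP; left; lra.
have wB : w <= B - t0 by rewrite /w ge_min lexx orbT.
have := hd w wd; rewrite (gtr0_norm w0) => h.
have := ler_norm (- (F (t0 + w) - F t0 - w * f t0)); rewrite normrN => h3.
have wf : 0 < w * f t0 by rewrite mulr_gt0.
have hlt : F t0 < F (t0 + w) by lra.
have m1 := mono (- B) t0 (lexx _) (ltW h1) (ltW h2).
apply: le_lt_trans m1 (lt_le_trans hlt (mono _ _ _ _ (lexx _))); last first.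
  by rewrite -lerBrDl.
by rewrite (le_trans (ltW h1)) // lerDl ltW.
Qed.

End IntervalIntegral.

Section BoxIntegral.
Context {R : realType} {n : nat}.
Variable B : R.
Hypothesis B0 : 0 < B.
Local Notation C := (R[i]).
Local Notation V := ('rV[C]_n).
Local Notation dir := ('I_n * bool)%type.
Implicit Types (F G : V -> R) (f g : V -> C) (z w : V) (i j : dir) (s : seq dir).

Lemma continuousRP F z : {for z, continuous F} <->
  forall e : R, 0 < e -> exists2 d : R, 0 < d &
    forall w, nv (w - z) < d -> `|F w - F z| < e.
Proof.
split.
  move=> cF e e0; have /cF/nbhsVP [d d0 H] : nbhs (F z) [set y | `|y - F z| < e].
    by apply/(nbhs_ballP (F z)); exists e => // y; rewrite /ball /= distrC.
  by exists d.
move=> H P /(nbhs_ballP (F z)) [e /= e0 hP]; have [d d0 hd] := H e e0.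
by apply/nbhsVP; exists d => // w /hd; rewrite distrC => /hP.
Qed.

Lemma continuous_mulr (T : topologicalType) (c : R) (h : T -> R) :
  continuous h -> continuous (fun x => c * h x).
Proof. by move=> ch x; apply: (@continuousM _ _ (cst c)); [exact: cst_continuous|exact: ch]. Qed.

Lemma continuous_line F i z : continuous F -> continuous (fun t : R => F (z + t%:C%C *: dirv i)).
Proof.
move=> cF t P /cF/nbhsVP [d d0 H]; apply/(nbhs_ballP t); exists d => // t'.
rewrite /ball /= distrC => ht; apply: H.
by rewrite opprD addrACA subrr add0r -scalerBl nvZ nv_dirv mulr1 -rmorphB nc_real.
Qed.

(** Uniformity in [t] comes from the compactness of the interval; it gives the continuity of partial
    integrals in the remaining variables. *)
Lemma tube F i z (e : R) : continuous F -> 0 < e -> exists2 d : R, 0 < d &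
  forall w, nv (w - z) < d -> forall t, - B <= t <= B ->
    `|F (w + t%:C%C *: dirv i) - F (z + t%:C%C *: dirv i)| < e.
Proof.
move=> cF e0.
have /compact_near_coveringP/(_ V (nbhs z) (fun w t =>
    `|F (w + t%:C%C *: dirv i) - F (z + t%:C%C *: dirv i)| < e)) :=
  @segment_compact R (- B) B.
move=> h; have : \forall w \near z, `[- B, B]%classic `<=` (fun t =>
    `|F (w + t%:C%C *: dirv i) - F (z + t%:C%C *: dirv i)| < e).
  apply: h => t _.
  have e20 : 0 < e / 2 by rewrite divr_gt0.
  have /continuousRP/(_ _ e20) [d d0 hd] := cF (z + t%:C%C *: dirv i).
  exists (ball t (d / 2), [set w | nv (w - z) < d / 2]).
    split=> /=; first by apply/(nbhs_ballP t); exists (d / 2) => //=; rewrite divr_gt0.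
    by apply/nbhsVP; exists (d / 2) => //; rewrite divr_gt0.
  move=> [t' w] [] /=; rewrite /ball /= distrC => h1 h2.
  have h3 : nv ((t' - t)%:C%C *: dirv i) < d / 2 by rewrite nvZ nv_dirv mulr1 nc_real.
  have k1 : `|F (w + t'%:C%C *: dirv i) - F (z + t%:C%C *: dirv i)| < e / 2.
    apply: hd; rewrite opprD addrACA -scalerBl -rmorphB.
    by apply: le_lt_trans (nvD _ _) _; rewrite [d]splitr ltrD.
  have k2 : `|F (z + t'%:C%C *: dirv i) - F (z + t%:C%C *: dirv i)| < e / 2.
    apply: hd; rewrite opprD addrACA subrr add0r -scalerBl -rmorphB.
    by apply: lt_trans h3 _; rewrite ltr_pdivrMr // ltr_pMr // ltr1n.
  rewrite -(subrK (F (z + t%:C%C *: dirv i)) (F (w + _))) -addrA.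
  apply: le_lt_trans (ler_normD _ _) _; rewrite [e]splitr; apply: ltrD k1 _.
  by rewrite distrC.
by move=> /nbhsVP [d d0 hd]; exists d.
Qed.

Definition pint i F z : R := rint B (fun t => F (z + t%:C%C *: dirv i)).

Lemma continuous_pint i F : continuous F -> continuous (pint i F).
Proof.
move=> cF z; apply/continuousRP => e e0.
have e1 : 0 < e / (2 * B) / 2 by rewrite !divr_gt0 // mulr_gt0.
have [d d0 hd] := tube i z cF e1; exists d => // w /hd h.
have cw := @continuous_line F i w cF; have cz := @continuous_line F i z cF.
have -> : pint i F w - pint i F z =
    rint B (fun t => F (w + t%:C%C *: dirv i) + -1 * F (z + t%:C%C *: dirv i)).
  by rewrite rintD ?rintZ ?mulN1r //; exact: continuous_mulr.
apply: le_lt_trans (_ : 2 * B * (e / (2 * B) / 2) < e).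
  apply: rint_norm => // [t|t ht]; last by rewrite mulN1r ltW // h.
  exact: (cvgD (cw t) (@continuous_mulr _ (-1) _ cz t)).
have -> : 2 * B * (e / (2 * B) / 2) = e / 2.
  by field; apply/eqP => h0; have := B0; lra.
lra.
Qed.

(** Iterated integration along a list of coordinate directions. The intervals are centred at
    the given point, so that the result is still a function of all the coordinates. *)
Definition pints s F : V -> R := foldr pint F s.

Lemma continuous_pints s F : continuous F -> continuous (pints s F).
Proof. by move=> cF; elim: s => //= i s IH; exact: continuous_pint. Qed.

Lemma pintsD s F G z : continuous F -> continuous G ->
  pints s (fun w => F w + G w) z = pints s F z + pints s G z.
Proof.
move=> cF cG; elim: s z => //= i s IH z.
rewrite /pint; under eq_rint do rewrite IH.
by rewrite rintD //; apply: continuous_line; exact: continuous_pints.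
Qed.

Lemma pintsZ s (c : R) F z : continuous F ->
  pints s (fun w => c * F w) z = c * pints s F z.
Proof.
move=> cF; elim: s z => //= i s IH z.
rewrite /pint; under eq_rint do rewrite IH.
by rewrite rintZ //; apply: continuous_line; exact: continuous_pints.
Qed.

Lemma pints_bound s F (M : R) z : continuous F -> (forall w, `|F w| <= M) ->
  `|pints s F z| <= (2 * B) ^+ size s * M.
Proof.
move=> cF hM; elim: s z => [|i s IH] z /=; first by rewrite expr0 mul1r.
rewrite exprS -mulrA; apply: rint_norm => // t ht.
by apply: continuous_line; exact: continuous_pints.
Qed.

Lemma pints_ge0 s F z : continuous F -> (forall w, 0 <= F w) -> 0 <= pints s F z.
Proof.
move=> cF F0; elim: s z => //= i s IH z.
have -> : 0 = rint B (fun _ : R => 0) by rewrite rint_cst // mulr0.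
apply: rint_le => // [t|]; first exact: cvg_cst.
by apply: continuous_line; exact: continuous_pints.
Qed.

Lemma pints_bounded_cvg s (F : nat -> V -> R) (M : R) z :
  (forall k, continuous (F k)) -> (forall k w, `|F k w| <= M) ->
  (forall w, (fun k => F k w) @ \oo --> (0 : R)) ->
  (fun k => pints s (F k) z) @ \oo --> (0 : R).
Proof.
move=> cF hM hF; elim: s z => [|i s IH] z /=; first exact: hF.
apply: (@rint_bounded_cvg _ B _ ((2 * B) ^+ size s * M)) => // [k|k t].
  by apply: continuous_line; exact: continuous_pints.
exact: pints_bound.
Qed.

Lemma pints_vanish s F i (B' : R) z : i \notin s ->
  (forall w, B' <= `|crd i w| -> F w = 0) -> B' <= `|crd i z| -> pints s F z = 0.
Proof.
move=> + F0; elim: s z => [|j s IH] z /=; first by move=> _; exact: F0.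
rewrite inE negb_or => /andP [ij js] hz; rewrite /pint.
have E : forall t, - B <= t <= B -> pints s F (z + t%:C%C *: dirv j) = 0.
  by move=> t _; apply: IH => //; rewrite crdD crdZ crd_dirv (negPf ij) mulr0 addr0.
by rewrite (eq_rint E) rint_cst // mulr0.
Qed.

Lemma pints_translate s F z v :
  pints s (fun w => F (w + v)) z = pints s F (z + v).
Proof.
elim: s z => //= j s IH z; rewrite /pint; apply: eq_rint => t _.
by rewrite IH addrAC.
Qed.

Lemma pints_shift s F i (B' h : R) z : uniq s -> i \in s -> continuous F ->
  0 <= B' -> B' + `|h| <= B -> (forall w, B' <= `|crd i w| -> F w = 0) -> crd i z = 0 ->
  pints s (fun w => F (w + h%:C%C *: dirv i)) z = pints s F z.
Proof.
move=> + + cF B'0 hB F0; elim: s z => //= j s IH z /andP [js us].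
rewrite inE; have [eij|ij] := eqVneq i j => /=.
  subst j; move=> _ cz; have cP := @continuous_pints s F cF.
  rewrite /pint -(rint_shift B0 hB B'0 (@continuous_line _ i z cP)).
    by apply: eq_rint => t _; rewrite pints_translate -addrA -scalerDl -rmorphD.
  move=> t ht; apply: (@pints_vanish s F i B') => //.
  by rewrite crdD crdZ crd_dirv eqxx mulr1 cz add0r.
move=> iS cz; apply: eq_rint => t _; apply: IH => //.
by rewrite crdD crdZ crd_dirv (negPf ij) mulr0 addr0.
Qed.

Lemma pints_gt0 s F z0 : uniq s -> continuous F -> (forall w, 0 <= F w) -> 0 < F z0 ->
  (forall i, `|crd i z0| < B) ->
  0 < pints s F (z0 - \sum_(i <- s) (crd i z0)%:C%C *: dirv i).
Proof.
move=> + cF F0 Fz hz; elim: s => [|i s IH] /=; first by rewrite big_nil subr0.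
move=> /andP [_ /IH h]; rewrite big_cons.
apply: (@rint_gt0 _ B B0 _ (crd i z0)).
- by apply: continuous_line; exact: continuous_pints.
- by move=> t; exact: pints_ge0.
- by rewrite -ltr_norml.
- by rewrite opprD addrA addrAC subrK.
Qed.

(** The integral over the box [|crd i z| <= B], iterated over the [2n] real coordinates. For the
    functions below, which vanish outside such a box, it is the integral over [C^n]. *)
Definition iR F : R := pints (index_enum dir) F 0.
Definition iC f : C := (iR (fun z => complex.Re (f z)) +i* iR (fun z => complex.Im (f z)))%C.

Lemma continuous_Re f : continuous f -> continuous (fun z => complex.Re (f z)).
Proof.
move=> cf z; apply/continuousRP => e e0; have /continuousVP/(_ e e0) [d d0 hd] := cf z.
exists d => // w /hd; apply: le_lt_trans; apply: le_trans (nc_Re _).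
by rewrite raddfB.
Qed.

Lemma continuous_Im f : continuous f -> continuous (fun z => complex.Im (f z)).
Proof.
move=> cf z; apply/continuousRP => e e0; have /continuousVP/(_ e e0) [d d0 hd] := cf z.
exists d => // w /hd; apply: le_lt_trans; apply: le_trans (nc_Im _).
by rewrite raddfB.
Qed.

Lemma eq_iC f g : f =1 g -> iC f = iC g.
Proof. by move=> /funext ->. Qed.

Lemma iCD f g : continuous f -> continuous g -> iC (fun z => f z + g z) = iC f + iC g.
Proof.
move=> cf cg; rewrite /iC /iR.
have -> : (fun z => complex.Re (f z + g z)) = (fun z => complex.Re (f z) + complex.Re (g z)).
  by apply/funext => z; case: (f z) (g z) => ? ? [].
have -> : (fun z => complex.Im (f z + g z)) = (fun z => complex.Im (f z) + complex.Im (g z)).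
  by apply/funext => z; case: (f z) (g z) => ? ? [].
by rewrite !pintsD //; do ?[exact: continuous_Re|exact: continuous_Im].
Qed.

Lemma iCZ (c : C) f : continuous f -> iC (fun z => c * f z) = c * iC f.
Proof.
move=> cf; case: c => a b; rewrite /iC /iR.
have cR := continuous_Re cf; have cI := continuous_Im cf.
have -> : (fun z => complex.Re ((a +i* b)%C * f z)) =
    (fun z => a * complex.Re (f z) + - b * complex.Im (f z)).
  by apply/funext => z; case: (f z) => ? ? /=; rewrite mulNr.
have -> : (fun z => complex.Im ((a +i* b)%C * f z)) =
    (fun z => a * complex.Im (f z) + b * complex.Re (f z)).
  by apply/funext => z; case: (f z).
rewrite !pintsD ?pintsZ //; try exact: continuous_mulr.
by rewrite mulNr.
Qed.

Lemma iC_bound f (M : R) : continuous f -> (forall z, nc (f z) <= M) ->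
  nc (iC f) <= 2 * ((2 * B) ^+ size (index_enum dir) * M).
Proof.
move=> cf hM; apply: le_trans (nc_le _) _.
have -> (x : R) : 2 * x = x + x by ring.
apply: lerD; apply: pints_bound; do ?[exact: continuous_Re|exact: continuous_Im] => w.
  exact: le_trans (nc_Re _) (hM w).
exact: le_trans (nc_Im _) (hM w).
Qed.

Lemma iC_bounded_cvg (f : nat -> V -> C) (M : R) :
  (forall k, continuous (f k)) -> (forall k z, nc (f k z) <= M) ->
  (forall z (e : R), 0 < e -> \forall k \near \oo, nc (f k z) < e) ->
  forall e : R, 0 < e -> \forall k \near \oo, nc (iC (f k)) < e.
Proof.
move=> cf hM h0 e e0; have e20 : 0 < e / 2 by rewrite divr_gt0.
have hR : (fun k => iR (fun z => complex.Re (f k z))) @ \oo --> (0 : R).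
  apply: (@pints_bounded_cvg _ _ M) => [k|k w|w]; first exact: continuous_Re.
    exact: le_trans (nc_Re _) (hM k w).
  apply/cvgrPdist_lt => r /(h0 w); apply: filterS => k; rewrite sub0r normrN.
  exact: le_lt_trans (nc_Re _).
have hI : (fun k => iR (fun z => complex.Im (f k z))) @ \oo --> (0 : R).
  apply: (@pints_bounded_cvg _ _ M) => [k|k w|w]; first exact: continuous_Im.
    exact: le_trans (nc_Im _) (hM k w).
  apply/cvgrPdist_lt => r /(h0 w); apply: filterS => k; rewrite sub0r normrN.
  exact: le_lt_trans (nc_Im _).
move/cvgrPdist_lt/(_ _ e20): hR; move/cvgrPdist_lt/(_ _ e20): hI.
apply: filterS2 => k; rewrite !sub0r !normrN => h1 h2.
by apply: le_lt_trans (nc_le _) _; rewrite [e]splitr addrC ltrD.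
Qed.

Definition supported (B' : R) f := forall z i, B' <= `|crd i z| -> f z = 0.

Lemma iC_shift f i (B' h : R) : continuous f -> 0 <= B' -> B' + `|h| <= B ->
  supported B' f -> iC (fun z => f (z + h%:C%C *: dirv i)) = iC f.
Proof.
move=> cf B'0 hB f0; rewrite /iC /iR.
have cR := continuous_Re cf; have cI := continuous_Im cf.
rewrite (@pints_shift _ (fun z => complex.Re (f z)) i B' h) ?crd0 ?mem_index_enum ?index_enum_uniq //.
  rewrite (@pints_shift _ (fun z => complex.Im (f z)) i B' h) ?crd0 ?mem_index_enum ?index_enum_uniq //.
  by move=> w /f0 ->.
by move=> w /f0 ->.
Qed.

Lemma iC_gt0 F z0 : continuous F -> (forall w, 0 <= F w) -> 0 < F z0 ->
  (forall i, `|crd i z0| < B) -> 0 < iC (fun z => (F z)%:C%C).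
Proof.
move=> cF F0 Fz hz; rewrite ltcE /=; apply/andP; split.
  rewrite /iR; have -> : (fun _ : V => 0) = (fun w => 0 * F w) by apply/funext => w; rewrite mul0r.
  by rewrite pintsZ // mul0r.
have := @pints_gt0 (index_enum dir) F z0 (index_enum_uniq _) cF F0 Fz hz.
by rewrite -dirv_sum subrr.
Qed.

End BoxIntegral.

(** * The divergence theorem for compactly supported functions *)

Section Divergence.
Context {R : realType} {n : nat}.
Local Notation C := (R[i]).
Local Notation V := ('rV[C]_n).
Local Notation dir := ('I_n * bool)%type.
Implicit Types (f g : V -> C) (z w v : V) (i : dir) (j k : 'I_n) (B : R).

Lemma continuous_translate f v : continuous f -> continuous (fun z => f (z + v)).
Proof.
move=> cf z; apply/continuousVP => e e0; have /continuousVP/(_ e e0) [d d0 hd] := cf (z + v).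
exists d => // w hw; apply: hd; suff -> : w + v - (z + v) = w - z by [].
by rewrite opprD addrACA subrr addr0.
Qed.

Lemma continuousVZ (c : C) f : continuous f -> continuous (fun z => c * f z).
Proof. by move=> cf z; apply: continuousM; [exact: continuous_cst|exact: cf]. Qed.

Lemma continuousVD f g : continuous f -> continuous g -> continuous (fun z => f z + g z).
Proof. by move=> cf cg z; apply: continuousD; [exact: cf|exact: cg]. Qed.

Lemma square_compact (B : R) : compact [set x : C | `|complex.Re x| <= B /\ `|complex.Im x| <= B].
Proof.
have -> : [set x : C | `|complex.Re x| <= B /\ `|complex.Im x| <= B] =
   (fun p : R * R => (p.1 +i* p.2)%C) @` (`[- B, B]%classic `*` `[- B, B]%classic).
  apply/seteqP; split.
    move=> [x y] /= [hx hy]; exists (x, y) => //=; rewrite !in_itv /=.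
    by rewrite -!ler_norml.
  by move=> _ /= [[x y] [/= hx hy] <-]; move: hx hy; rewrite !in_itv /= -!ler_norml.
apply: continuous_compact; last by apply: compact_setX; exact: segment_compact.
apply: continuous_subspaceT => -[x y] P /nbhsCP [e e0 hP].
exists (ball x (e / 2), ball y (e / 2)) => /=.
  by split; [apply/(nbhs_ballP x)|apply/(nbhs_ballP y)]; exists (e / 2) => //=; rewrite divr_gt0.
move=> [x' y'] [] /=; rewrite /ball /= => h1 h2; apply: hP.
by apply: le_lt_trans (nc_le _) _; rewrite /= [e]splitr; apply: ltrD; rewrite distrC.
Qed.

Lemma box_compact B : compact [set z : V | forall i, `|crd i z| <= B].
Proof.
have -> : [set z : V | forall i, `|crd i z| <= B] =
   [set z : V | forall k, [set x : C | `|complex.Re x| <= B /\ `|complex.Im x| <= B] (z ord0 k)].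
  apply/seteqP; split=> z /= h.
    by move=> k; have := h (k, true); have := h (k, false); rewrite /crd.
  by move=> [k b]; have := h k; rewrite /crd /= => -[]; case: b.
apply: (@rV_compact _ _ (fun=> [set x : C | `|complex.Re x| <= B /\ `|complex.Im x| <= B])).
move=> k; exact: square_compact.
Qed.

Lemma compact_bounded (K : set V) f : compact K -> (forall z, K z -> {for z, continuous f}) ->
  exists2 M : R, 0 <= M & forall z, K z -> nc (f z) <= M.
Proof.
move=> /compact_near_coveringP cK cf.
have [|M0 [_ hM]] := cK R +oo%R (fun (M : R) z => nc (f z) <= M) _.
  move=> z Kz; have /continuousVP/(_ 1 ltr01) [d d0 hd] := cf z Kz.
  exists ([set w | nv (w - z) < d], [set M | nc (f z) + 1 <= M]).
    split=> /=; first by apply/nbhsVP; exists d.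
    by exists (nc (f z) + 1); split; [exact: num_real|move=> M /= /ltW].
  move=> [w M] [/= /hd h1 h2]; apply: le_trans h2.
  by have := ncD (f w - f z) (f z); rewrite subrK; move=> h3; lra.
exists (Num.max 0 (M0 + 1)); first by rewrite le_max lexx.
by apply: hM; rewrite lt_max; apply/orP; right; rewrite ltrDl.
Qed.

Lemma supported_bounded B f : continuous f -> supported B f ->
  exists2 M : R, 0 <= M & forall z, nc (f z) <= M.
Proof.
move=> cf sf; have [M M0 hM] := @compact_bounded _ f (@box_compact B) (fun z _ => cf z).
exists M => // z; have [[i hi]|h] := pselect (exists i, B < `|crd i z|).
  by rewrite (sf z i (ltW hi)) nc0.
by apply: hM => i /=; rewrite leNgt; apply/negP => hi; apply: h; exists i.
Qed.

Definition diff_quot f i (h : R) z : C := (h^-1)%:C%C * (f (z + h%:C%C *: dirv i) + -1 * f z).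

Lemma continuous_diff_quot f i (h : R) : continuous f -> continuous (diff_quot f i h).
Proof.
move=> cf; apply: continuousVZ; apply: continuousVD; first exact: continuous_translate.
exact: continuousVZ.
Qed.

(** By translation invariance. *)
Lemma iC_diff_quot B B' f i (h : R) : 0 < B -> 0 <= B' -> continuous f -> supported B' f ->
  0 < h -> B' + h <= B -> iC B (diff_quot f i h) = 0.
Proof.
move=> B0 B'0 cf sf h0 hB.
have cs := @continuous_translate f (h%:C%C *: dirv i) cf.
have cN := @continuousVZ (-1) f cf.
rewrite /diff_quot (iCZ B0 _ (@continuousVD _ _ cs cN)) (iCD B0 cs cN) (iCZ B0 _ cf).
have hB' : B' + `|h| <= B by rewrite gtr0_norm.
by rewrite (iC_shift B0 i cf B'0 hB' sf) mulN1r subrr mulr0.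
Qed.

Lemma wirt_lipschitz f (a b : V -> 'I_n -> C) (M : R) z w : (forall z, wirt f z (a z) (b z)) ->
  (forall z j, nc (a z j) <= M) -> (forall z j, nc (b z j) <= M) ->
  nc (f (z + w) - f z) <= 4 * M * nv w.
Proof.
move=> hf ha hb.
have := @wirt_increment R n f z w a b (fun=> 0) (fun=> 0) M.
have -> : wform (fun=> 0) (fun=> 0) w = 0 by apply: big1 => i _; rewrite !mul0r addr0.
by rewrite subr0; apply=> *; rewrite ?subr0.
Qed.

Lemma diff_quot_bound f (L : R) i (h : R) z : (forall z w, nc (f (z + w) - f z) <= L * nv w) ->
  0 < h -> nc (diff_quot f i h z) <= L.
Proof.
move=> hL h0; rewrite /diff_quot ncM nc_real gtr0_norm ?invr_gt0 // mulN1r ler_pdivrMl //.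
apply: le_trans (hL _ _) _.
by rewrite nvZ nc_real nv_dirv mulr1 gtr0_norm // [h * _]mulrC.
Qed.

Lemma diff_quot_cvg f (a b : 'I_n -> C) i z (e : R) : wirt f z a b -> 0 < e ->
  exists2 d : R, 0 < d & forall h : R, 0 < h -> h < d ->
    nc (diff_quot f i h z - wform a b (dirv i)) <= e.
Proof.
move=> [_ hf] e0; have [d d0 hd] := hf e e0; exists d => // h h0 hlt.
have := hd (h%:C%C *: dirv i); rewrite nvZ nc_real nv_dirv mulr1 gtr0_norm // => /(_ hlt).
rewrite wformZ => H.
have hC : (h%:C)%C != 0 :> C by apply/eqP => -[] h'; move: h0; rewrite h' ltxx.
have -> : diff_quot f i h z - wform a b (dirv i) =
  (h^-1)%:C%C * (f (z + h%:C%C *: dirv i) - f z - h%:C%C * wform a b (dirv i)).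
  have hV : (h^-1)%:C%C * (h%:C)%C = 1 :> C by rewrite -rmorphM mulVf ?gt_eqF.
  by rewrite /diff_quot mulN1r [RHS]mulrBr [X in _ = _ - X]mulrA hV mul1r.
by rewrite ncM nc_real gtr0_norm ?invr_gt0 // ler_pdivrMl // [h * e]mulrC.
Qed.

Lemma nc_nat2 : nc (2 : C) = 2.
Proof. by rewrite -[2 : C](rmorph_nat (real_complex R)) nc_real ger0_norm. Qed.

(** In the next two facts [q1 + i q2 - 2 b] is the error made in approximating twice the derivative
    [b] along the conjugate coordinate by difference quotients in the two real directions. *)
Fact quotient_defect_bound (q1 q2 b : C) (M : R) : nc q1 <= 4 * M -> nc q2 <= 4 * M -> nc b <= M ->
  nc (q1 + 'i%C * q2 + -2 * b) <= 10 * M.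
Proof.
move=> h1 h2 h3; apply: le_trans (ncD _ _) _.
apply: le_trans (lerD (ncD _ _) (lexx _)) _; rewrite !ncM nc_i ncN nc_nat2; lra.
Qed.

Fact quotient_defect_lim (q1 q2 a b : C) (e : R) : nc (q1 - (a + b)) <= e -> nc (q2 - 'i%C * (a - b)) <= e ->
  nc (q1 + 'i%C * q2 + -2 * b) <= 2 * e.
Proof.
move=> h1 h2.
have -> : q1 + 'i%C * q2 + -2 * b = (q1 - (a + b)) + 'i%C * (q2 - 'i%C * (a - b)).
  have i2 := sqr_i R; move: ('i%C : C) i2 => I i2.
  have -> : I * (q2 - I * (a - b)) = I * q2 - I ^+ 2 * (a - b) by ring.
  by rewrite i2; ring.
apply: le_trans (ncD _ _) _; rewrite ncM nc_i mul1r; lra.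
Qed.

(** Difference quotients have integral zero and converge boundedly to derivatives. The continuity of
    the one derivative that is integrated suffices, the others being merely bounded: [f] may thus be
    the product of a smooth function and of a complex differentiable one whose derivative is not
    known to be continuous. *)
Lemma iC_dzbar_eq0 B B' (M : R) f (a b : V -> 'I_n -> C) k :
  0 <= B' -> B' < B -> (forall z, wirt f z (a z) (b z)) ->
  (forall z j, nc (a z j) <= M) -> (forall z j, nc (b z j) <= M) ->
  supported B' f -> continuous (fun z => b z k) -> iC B (fun z => b z k) = 0.
Proof.
move=> B'0 BB' hf ha hb sf cb; have B0 : 0 < B by exact: le_lt_trans BB'.
have cf : continuous f by move=> z; exact: wdiff_continuous (wirt_wdiff (hf z)).
have hL z w := wirt_lipschitz z w hf ha hb.
pose h (m : nat) : R := (B - B') / m.+1%:R.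
have h0 m : 0 < h m by rewrite divr_gt0 // subr_gt0.
have hB m : B' + h m <= B.
  rewrite -lerBrDl ler_pdivrMr // ler_peMr ?ler1n // subr_ge0; exact: ltW.
pose q c m := diff_quot f (k, c) (h m).
have cq c m : continuous (q c m) by exact: continuous_diff_quot.
have iq c m : iC B (q c m) = 0 by exact: (@iC_diff_quot B B').
have qM c m z : nc (q c m z) <= 4 * M by exact: diff_quot_bound.
have qcvg c z (e : R) : 0 < e ->
    \forall m \near \oo, nc (q c m z - wform (a z) (b z) (dirv (k, c))) <= e.
  move=> e0; have [d d0 hd] := diff_quot_cvg (k, c) (hf z) e0.
  exists (Num.truncn ((B - B') / d)).+1 => // m /= Nm; apply: hd => //.
  rewrite /h ltr_pdivrMr // mulrC -ltr_pdivrMr //; apply: lt_le_trans (truncnS_gt _) _.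
  by rewrite ler_nat; exact: leq_trans Nm (leqnSn m).
clearbody q; clear hL.
have ci m := @continuousVZ 'i%C _ (cq true m).
have cD m := @continuousVD _ _ (cq false m) (ci m).
have c2 := @continuousVZ (-2) _ cb.
have cg m := @continuousVD _ _ (cD m) c2.
have gM m z := quotient_defect_bound (qM false m z) (qM true m z) (hb z k).
have ig m : iC B (fun z => q false m z + 'i%C * q true m z + -2 * b z k) =
    - 2 * iC B (fun z => b z k).
  rewrite (iCD B0 (cD m) c2) (iCD B0 (cq false m) (ci m)) (iCZ B0 'i%C (cq true m)).
  by rewrite (iCZ B0 (-2) cb) !iq mulr0 !add0r.
apply: nc_eq0; apply/eqP; rewrite eq_le nc_ge0 andbT; apply/ler_addgt0Pr => e e0.
rewrite add0r.
have := iC_bounded_cvg B0 cg gM _ e0; case=> [z r r0|N _ /(_ N (leqnn N)) hN].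
  have r30 : 0 < r / 3 by rewrite divr_gt0.
  apply: filterS2 (qcvg false z _ r30) (qcvg true z _ r30) => m.
  rewrite /dirv /= scale1r wform_e wform_ie => k1 k2.
  apply: le_lt_trans (quotient_defect_lim k1 k2) _; rewrite mulrCA gtr_pMr // ltr_pdivrMr // mul1r.
  by rewrite ltr_nat.
have {hN} : nc (iC B (fun z => q false N z + 'i%C * q true N z + -2 * b z k)) < e := hN.
rewrite ig ncM ncN nc_nat2.
have := nc_ge0 (iC B (fun z => b z k)); move: (nc _) => x x0 hx; lra.
Qed.

Lemma iC_conj B f : 0 < B -> continuous f -> iC B (fun z => (f z)^*%C) = ((iC B f)^*)%C.
Proof.
move=> B0 cf; rewrite /iC /=; congr (_ +i* _)%C.
  by congr (iR _ _); apply/funext => z; case: (f z).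
have -> : (fun z => complex.Im (f z)^*%C) = (fun z => -1 * complex.Im (f z)).
  by apply/funext => z; case: (f z) => ? ? /=; rewrite mulN1r.
by rewrite /iR pintsZ ?mulN1r //; exact: continuous_Im.
Qed.

Lemma supported_dz B f k z i : supported B f -> B < `|crd i z| -> dz k f z = 0 /\ dzbar k f z = 0.
Proof.
move=> sf hz.
have hn : \forall w \near z, 0 = f w.
  apply/nbhsVP; exists (`|crd i z| - B) => [|w hw]; first by rewrite subr_gt0.
  apply/esym; apply: (sf w i).
  have h1 := le_crd i (w - z); have h2 : crd i z = crd i w - crd i (w - z).
    by have := crdD i (w - z) z; rewrite subrK => ->; ring.
  have := ler_normB (crd i w) (crd i (w - z)); rewrite -h2 => h3; lra.
have w0 := wirt_near hn (wirt_cst 0 z).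
by rewrite (wirt_dz _ w0) (wirt_dzbar _ w0).
Qed.

(** The case of [dz] follows from that of [dzbar] by conjugation. *)
Lemma iC_dz_dzbar B B' f k : 0 <= B' -> B' < B -> wclass 1 setT f -> supported B' f ->
  iC B (dz k f) = 0 /\ iC B (dzbar k f) = 0.
Proof.
move=> B'0 BB' hf sf.
have B0 : 0 < B by exact: le_lt_trans BB'.
have cz j : continuous (dz j f) by move=> z; exact: wclass_continuous (wclass_dz j hf) I.
have czb j : continuous (dzbar j f) by move=> z; exact: wclass_continuous (wclass_dzbar j hf) I.
pose B1 := (B' + B) / 2.
have sup1 j : supported B1 (dz j f) /\ supported B1 (dzbar j f).
  have B1' : B' < B1 by rewrite /B1; lra.
  by split=> z i hz; have [] := @supported_dz B' f j z i sf (lt_le_trans B1' hz).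
have bnd j : exists2 d : R, 0 < d & forall z, d * nc (dz j f z) <= 1 /\ d * nc (dzbar j f z) <= 1.
  have [M1 M10 h1] := supported_bounded (cz j) (sup1 j).1.
  have [M2 M20 h2] := supported_bounded (czb j) (sup1 j).2.
  have p : 0 < M1 + M2 + 1 by rewrite ltr_wpDl ?addr_ge0.
  exists (M1 + M2 + 1)^-1; first by rewrite invr_gt0.
  move=> z; rewrite !ler_pdivrMl // !mulr1; have := h1 z; have := h2 z; split; lra.
have [d d0 hd] := finite_radius bnd (fun j d d' dd' h z => conj
  (le_trans (ler_wpM2r (nc_ge0 _) dd') (h z).1) (le_trans (ler_wpM2r (nc_ge0 _) dd') (h z).2)).
have hdz j z : nc (dz j f z) <= d^-1 by rewrite -[d^-1]mulr1 ler_pdivlMl // (hd j z).1.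
have hdzb j z : nc (dzbar j f z) <= d^-1 by rewrite -[d^-1]mulr1 ler_pdivlMl // (hd j z).2.
have hw z : wirt f z (fun j => dz j f z) (fun j => dzbar j f z) by exact: wclass_wdiff hf I.
split; last first.
  exact: (@iC_dzbar_eq0 B B' d^-1 f (fun z j => dz j f z) (fun z j => dzbar j f z) k).
have := @iC_dzbar_eq0 B B' d^-1 (fun z => (f z)^*%C) (fun z j => (dzbar j f z)^*%C)
  (fun z j => (dz j f z)^*%C) k B'0 BB'.
rewrite iC_conj // => h; rewrite -[LHS]conjcK h ?conjc0 //.
- by move=> z; exact: wirt_conj.
- by move=> z j; rewrite nc_conj.
- by move=> z j; rewrite nc_conj.
- by move=> z i /sf ->; rewrite conjc0.
- by move=> z; exact: continuous_conjc (cz k z).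
Qed.

End Divergence.

(** * Bump functions *)

Section Bumps.
Context {R : realType} {n : nat}.
Local Notation C := (R[i]).
Local Notation V := ('rV[C]_n).
Implicit Types (f g rho : V -> C) (z w v : V) (U : set V).
Let hV := @is_norm_nv R n.
Let hC := @is_norm_nc R.

(** Powers of the positive part are as regular as needed, and the relations between them
    ([pospow_mul], [is_derive_pospow]) are polynomial; smooth bumps would have neither. *)
Definition pospow (N : nat) (x : R) : R := (Num.max 0 x) ^+ N.

Lemma pospow_ge0 N x : 0 <= pospow N x.
Proof. by rewrite exprn_ge0 // le_max lexx. Qed.

Lemma pospow_gt0 N x : 0 < x -> 0 < pospow N x.
Proof. by move=> x0; rewrite exprn_gt0 // lt_max x0 orbT. Qed.

Lemma pospow_eq0 N x : (0 < N)%N -> x <= 0 -> pospow N x = 0.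
Proof. by move=> N0 x0; rewrite /pospow max_l // expr0n; case: N N0. Qed.

Lemma pospow_mul N x : (0 < N)%N -> x * pospow N x = pospow N.+1 x.
Proof.
move=> N0; have [x0|x0] := leP x 0; first by rewrite !pospow_eq0 // mulr0.
by rewrite /pospow max_r ?(ltW x0) // exprS.
Qed.

Lemma max0_lip (x y : R) : `|Num.max 0 y - Num.max 0 x| <= `|y - x|.
Proof.
have [x0|x0] := leP x 0; have [y0|y0] := leP y 0.
- by rewrite subrr normr0.
- by rewrite subr0 gtr0_norm //; have := ler_norm (y - x); lra.
- by rewrite sub0r normrN gtr0_norm //; have := ler_norm (- (y - x)); rewrite normrN; lra.
- by [].
Qed.

Lemma is_derive_pospow N x : (0 < N)%N ->
  is_derive x (1 : R) (pospow N.+1) (N.+1%:R * pospow N x).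
Proof.
move=> N0; case: (ltgtP x 0) => x0.
- apply: (@near_eq_is_derive _ _ _ (cst 0)).
  + apply/(nbhs_ballP x); exists (- x) => [|y]; first by rewrite /= oppr_gt0.
    rewrite /ball /= => hy; rewrite pospow_eq0 //.
    by have := ler_norm (- (x - y)); rewrite normrN; lra.
  + by rewrite pospow_eq0 ?mulr0 ?(ltW x0) //; exact: is_derive_cst.
- apply: (@near_eq_is_derive R R R (fun y : R => y ^+ N.+1 : R)).
  + apply/(nbhs_ballP x); exists x => // y; rewrite /ball /= => hy.
    by rewrite /pospow max_r //; have := ler_norm (x - y); lra.
  + have := @is_deriveX _ _ id N.+1 x 1 1 (is_derive_id _ _).
    rewrite /pospow max_r ?(ltW x0) //= [_%:A]mulr1 => h.
    by have -> : (fun y : R => y ^+ N.+1 : R) = id ^+ N.+1 by apply/funext => y; rewrite fctE.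
- rewrite x0 pospow_eq0 // mulr0; apply/is_derive_has_diff; split.
    by exists 0 => // s; rewrite mulr0 normr0 mul0r.
  move=> e e0; exists (Num.min 1 e) => [|s]; first by rewrite lt_min ltr01.
  rewrite lt_min => /andP [s1 se]; rewrite mulr0 subr0 add0r [pospow _ 0]pospow_eq0 // subr0.
  rewrite /pospow normrX exprS; have hm : `|Num.max 0 s| <= `|s|.
    by have := max0_lip 0 s; rewrite !subr0 maxxx subr0.
  rewrite [e * _]mulrC; apply: ler_pM => //.
  apply: le_trans (_ : `|s| ^+ N <= _); first by apply: lerXn2r; rewrite ?nnegrE.
  case: N N0 => // N _; rewrite exprS; apply: le_trans (_ : `|s| * 1 <= _).
    by rewrite ler_wpM2l // exprn_ile1 // ltW.
  by rewrite mulr1 ltW.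
Qed.

(** The chain rule for an outer function that is known to be differentiable on the real line only. *)
Lemma wirt_real_comp (phi : R -> R) (h : V -> R) z (d : R) (a : 'I_n -> C) :
  is_derive (h z) (1 : R) phi d ->
  wirt (fun w => (h w)%:C%C) z a (fun k => (a k)^*%C) ->
  wirt (fun w => (phi (h w))%:C%C) z (fun k => d%:C%C * a k) (fun k => (d%:C%C * a k)^*%C).
Proof.
move=> /is_derive_has_diff hphi [[K K0 hK] hw].
have realL w : wform a (fun k => (a k)^*%C) w = (complex.Re (wform a (fun k => (a k)^*%C) w))%:C%C.
  apply/eqP; rewrite eq_complex /= eqxx; apply/eqP.
  rewrite raddf_sum big1 // => k _.
  by rewrite -conjcM; case: (a k * w 0 k) => x y /=; rewrite subrr.
have hh : has_diff (@nv R n) (fun x : R => `|x|) h z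
    (fun w => complex.Re (wform a (fun k => (a k)^*%C) w)).
  split; first by exists K => // w; apply: le_trans (nc_Re _) (hK w).
  move=> e /hw [r r0 hr]; exists r => // w /hr; apply: le_trans.
  by rewrite realL -!rmorphB nc_real.
have hd : has_diff (@nv R n) (fun x : R => `|x|) (fun w => phi (h w)) z
    (fun w => complex.Re (wform a (fun k => (a k)^*%C) w) * d).
  by apply: (has_diff_comp hV is_norm_real is_norm_real _ hh hphi) => u v; rewrite mulrDl.
case: hd => [[K' K'0 hK'] hd].
have E w : wform (fun k => d%:C%C * a k) (fun k => (d%:C%C * a k)^*%C) w =
    (complex.Re (wform a (fun k => (a k)^*%C) w) * d)%:C%C.
  rewrite rmorphM /= -realL mulrC mulr_sumr; apply: eq_bigr => k _.
  by rewrite conjcM conjc_real mulrDr !mulrA.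
split; first by exists K' => // w; rewrite E nc_real.
by move=> e /hd [r r0 hr]; exists r => // w /hr; rewrite E -!rmorphB nc_real.
Qed.

Definition real_valued rho := forall w, (rho w)^*%C = rho w.

Lemma real_valued_Re rho w : real_valued rho -> (complex.Re (rho w))%:C%C = rho w.
Proof.
move=> h; have := h w; case: (rho w) => x y /= [] yy; congr (_ +i* _)%C; lra.
Qed.

Definition cpospow N rho w : C := (pospow N (complex.Re (rho w)))%:C%C.

Lemma wirt_cpospow N rho z : real_valued rho -> wdiff rho z -> (0 < N)%N ->
  wirt (cpospow N.+1 rho) z (fun k => (N.+1%:R * cpospow N rho z) * dz k rho z)
    (fun k => (N.+1%:R * cpospow N rho z) * dzbar k rho z).
Proof.
move=> hr hd N0; have dconj k : (dz k rho z)^*%C = dzbar k rho z.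
  by rewrite -(wirt_dzbar k (wirt_conj hd)); congr (dzbar k _ z); apply/funext.
have h1 : wirt (fun w => (complex.Re (rho w))%:C%C) z (fun k => dz k rho z) (fun k => (dz k rho z)^*%C).
  have -> : (fun w => (complex.Re (rho w))%:C%C) = rho by apply/funext => w; exact: real_valued_Re.
  by apply: eq_wirt hd => k.
have := wirt_real_comp (is_derive_pospow (complex.Re (rho z)) N0) h1.
apply: eq_wirt => k; rewrite /cpospow.
  by rewrite rmorphM /= rmorph_nat.
by rewrite conjcM conjc_real dconj rmorphM /= rmorph_nat.
Qed.

Lemma wclass_cpospow k U rho : open U -> real_valued rho -> wclass k U rho ->
  wclass k U (cpospow k.+1 rho).
Proof.
move=> oU hr; elim: k => [|k IH] hk.
  split=> [z Uz|]; last exact: I.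
  apply/continuousVP => e e0.
  have /continuousVP/(_ e e0) [d d0 hd] := wclass_continuous hk Uz.
  exists d => // w /hd; apply: le_lt_trans; rewrite /cpospow -rmorphB nc_real /pospow !expr1.
  by apply: le_trans (max0_lip _ _) _; rewrite -raddfB; exact: nc_Re.
have hw z : U z -> wdiff rho z := fun Uz => wclass_wdiff hk Uz.
have hp := IH (wclass_pred hk).
split=> [z Uz|].
  exact: wdiff_continuous (wirt_wdiff (wirt_cpospow hr (hw z Uz) (ltn0Sn k))).
split=> [z Uz|j].
  exact: wirt_wdiff (wirt_cpospow hr (hw z Uz) (ltn0Sn k)).
split.
  apply: (wclass_eq oU (fun z Uz => esym (wirt_dz j (wirt_cpospow hr (hw z Uz) (ltn0Sn k))))).
  exact: (wclassM oU (wclassZ oU _ hp) (wclass_dz j hk)).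
apply: (wclass_eq oU (fun z Uz => esym (wirt_dzbar j (wirt_cpospow hr (hw z Uz) (ltn0Sn k))))).
exact: (wclassM oU (wclassZ oU _ hp) (wclass_dzbar j hk)).
Qed.

Definition sqnorm v : R := \sum_k nc (v 0 k) ^+ 2.
(** Positive exactly on the ball of squared radius [tau] about [z]; the bumps are powers of its
    positive part. *)
Definition ballfun (tau : R) z w : C := (tau - sqnorm (w - z))%:C%C.

Lemma ballfun_real tau z : real_valued (ballfun tau z).
Proof. by move=> w; rewrite conjc_real. Qed.

Lemma sqr_nc (x : C) : (nc x ^+ 2)%:C%C = x * x^*%C.
Proof. by rewrite rmorphXn /= -norm_nc sqr_normc. Qed.

Lemma ballfunE tau z w :
  ballfun tau z w = tau%:C%C - \sum_k (w 0 k - z 0 k) * (w 0 k - z 0 k)^*%C.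
Proof.
rewrite /ballfun rmorphB; congr (_ - _); rewrite /sqnorm rmorph_sum.
by apply: eq_bigr => k _; rewrite -[LHS]/((nc ((w - z) 0 k) ^+ 2)%:C%C) sqr_nc !mxE.
Qed.

Lemma wirt_shift_coord z w k :
  wirt (fun w => w 0 k - z 0 k) w (fun j => (j == k)%:R) (fun=> 0).
Proof.
by apply: eq_wirt (wirtD (wirt_coord k w) (wirt_cst (- z 0 k) w)) => j; rewrite addr0.
Qed.

Lemma wirt_ballfun tau z w :
  wirt (ballfun tau z) w (fun j => - (w 0 j - z 0 j)^*%C) (fun j => - (w 0 j - z 0 j)).
Proof.
have -> : ballfun tau z = fun w => tau%:C%C + -1 * \sum_k (w 0 k - z 0 k) * (w 0 k - z 0 k)^*%C.
  by apply/funext => v; rewrite ballfunE mulN1r.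
have hs := wirt_sum (index_enum 'I_n) (P := xpredT) (fun k _ => wirtM (wirt_shift_coord z w k)
   (wirt_conj (wirt_shift_coord z w k))).
have := wirtD (wirt_cst tau%:C%C w) (wirtM (wirt_cst (-1) w) hs).
apply: eq_wirt => j; rewrite mul0r !add0r mulN1r; congr (- _).
  under eq_bigr do rewrite conjc0 mulr0 addr0.
  rewrite (bigD1 j) // big1 => [|k kj]; first by rewrite eqxx mul1r; exact: addr0.
  by rewrite eq_sym (negPf kj) mul0r.
under eq_bigr do rewrite mul0r add0r conjc_nat.
rewrite (bigD1 j) // big1 => [|k kj]; first by rewrite eqxx mulr1; exact: addr0.
by rewrite eq_sym (negPf kj) mulr0.
Qed.

Lemma wclass_ballfun k tau z : wclass k setT (ballfun tau z).
Proof.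
have oT : open [set: V] by exact: openT.
have hc j : wclass k setT (fun w : V => w 0 j - z 0 j).
  exact: (wclassB oT (wclass_coord _ k j) (wclass_cst _ k _)).
apply: (wclass_eq oT (fun w _ => esym (ballfunE tau z w))).
apply: (wclassB oT (wclass_cst _ k _)); apply: (wclass_sum oT) => j _.
exact: (wclassM oT (hc j) (wclass_conj oT (hc j))).
Qed.

Definition bump N (tau : R) z : V -> C := cpospow N (ballfun tau z).

Lemma bumpE N tau z w : bump N tau z w = (pospow N (tau - sqnorm (w - z)))%:C%C.
Proof. by []. Qed.

Lemma wclass_bump k tau z : wclass k setT (bump k.+1 tau z).
Proof. by apply: wclass_cpospow; [exact: openT|exact: ballfun_real|exact: wclass_ballfun]. Qed.

Lemma bump_eq0 N (tau r : R) z w : (0 < N)%N -> 0 <= r -> tau <= r ^+ 2 ->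
  n%:R * r <= nv (w - z) -> (0 < n)%N -> bump N tau z w = 0.
Proof.
move=> N0 r0 tr hw n0; rewrite bumpE pospow_eq0 // subr_le0; apply: le_trans tr _.
have [k hk] : exists k, r <= nc ((w - z) 0 k).
  apply/not_existsP => h; move: hw; apply/negP; rewrite -ltNge.
  apply: (@lt_le_trans _ _ (\sum_(k < n) r)); last by rewrite sumr_const card_ord mulr_natl.
  have k0 : 'I_n := Ordinal n0.
  rewrite /nv (bigD1 k0) //= [in X in _ < X](bigD1 k0) //=; apply: ltr_leD.
    by rewrite ltNge; apply/negP; exact: h.
  by apply: ler_sum => k _; rewrite leNgt; apply/negP => /ltW; exact: h.
rewrite /sqnorm (bigD1 k) //=; apply: le_trans (_ : nc ((w - z) 0 k) ^+ 2 <= _).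
  by apply: lerXn2r; rewrite ?nnegrE ?nc_ge0.
by rewrite lerDl; apply: sumr_ge0 => j _; rewrite sqr_ge0.
Qed.

Lemma sqnorm_ge0 v : 0 <= sqnorm v.
Proof. by apply: sumr_ge0 => k _; rewrite sqr_ge0. Qed.

Lemma sqnorm0 : sqnorm 0 = 0.
Proof. by apply: big1 => k _; rewrite mxE nc0 expr0n. Qed.

End Bumps.

(* From here on derivatives are handled through the calculus rules only. *)
Opaque dz dzbar.

(** * Regularity of complex differentiable functions *)

Section Regularity.
Context {R : realType} {n : nat}.
Local Notation C := (R[i]).
Local Notation V := ('rV[C]_n).
Implicit Types (f g K : V -> C) (z w v : V) (U : set V).

Lemma pints_le (B : R) s (F G : V -> R) z : 0 < B -> continuous F -> continuous G ->
  (forall w, F w <= G w) -> pints B s F z <= pints B s G z.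
Proof.
move=> B0 cF cG FG; rewrite -subr_ge0 -mulN1r -(pintsZ B0 s (-1) z cF).
have cN : continuous (fun w => -1 * F w) by exact: continuous_mulr.
rewrite -(pintsD B0 s z cG cN); apply: (pints_ge0 B0).
  by move=> x; apply: (@continuousD _ _ _ _ (fun w => -1 * F w)); [exact: cG|exact: cN].
by move=> w; rewrite mulN1r subr_ge0.
Qed.

Lemma iC_le (B : R) f (F : V -> R) : 0 < B -> continuous f -> continuous F ->
  (forall w, nc (f w) <= F w) -> nc (iC B f) <= 2 * iR B F.
Proof.
move=> B0 cf cF h; apply: le_trans (nc_le _) _.
have -> (x : R) : 2 * x = x + x by ring.
have cN : continuous (fun w => -1 * F w) by exact: continuous_mulr.
have key (G : V -> R) : continuous G -> (forall w, `|G w| <= F w) -> `|iR B G| <= iR B F.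
  move=> cG hG; rewrite ler_norml; apply/andP; split.
    rewrite -mulN1r /iR -(pintsZ B0 _ (-1) 0 cF); apply: (pints_le _ _ B0 cN cG) => w.
    by rewrite mulN1r; have := hG w; rewrite ler_norml => /andP [].
  apply: (pints_le _ _ B0 cG cF) => w.
  by have := hG w; rewrite ler_norml => /andP [].
apply: lerD; apply: key.
- exact: continuous_Re.
- by move=> w; apply: le_trans (nc_Re _) (h w).
- exact: continuous_Im.
- by move=> w; apply: le_trans (nc_Im _) (h w).
Qed.

Lemma iC0 (B : R) : 0 < B -> iC B (fun _ : V => 0) = 0.
Proof.
move=> B0; rewrite -[RHS](mul0r (iC B (fun _ : V => 0))) -(iCZ B0 0 (@continuous_cst _ _ 0)).
by apply: eq_iC => w; rewrite mul0r.
Qed.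

Lemma iC_sum (B : R) (I : Type) (s : seq I) (F : I -> V -> C) : 0 < B -> (forall k, continuous (F k)) ->
  iC B (fun w => \sum_(k <- s) F k w) = \sum_(k <- s) iC B (F k) /\
  continuous (fun w => \sum_(k <- s) F k w).
Proof.
move=> B0 cF; elim: s => [|k s [IH cs]].
  rewrite big_nil; split; last first.
    by rewrite (_ : (fun _ => _) = fun=> 0) ?funeqE => [|w]; [exact: continuous_cst|rewrite big_nil].
  by rewrite -[RHS](iC0 B0); apply: eq_iC => w; rewrite big_nil.
have E : (fun w => \sum_(j <- k :: s) F j w) = fun w => F k w + \sum_(j <- s) F j w.
  by apply/funext => w; rewrite big_cons.
rewrite E; split; last exact: (@continuousVD _ _ _ _ (cF k) cs).
by rewrite (iCD B0 (cF k) cs) IH big_cons.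
Qed.

Lemma pospow3_increment (x s : R) :
  `|pospow 3 (x + s) - pospow 3 x - s * (3 * pospow 2 x)| <= s ^+ 2 * (6 * Num.max 0 x + `|s|).
Proof.
rewrite /pospow; have [x0|x0] := leP x 0; have [y0|y0] := leP (x + s) 0.
- by rewrite !expr0n /= !mulr0 !subr0 normr0 add0r mulr_ge0 ?sqr_ge0.
- rewrite !expr0n /= !mulr0 !subr0 add0r normrX (ger0_norm (ltW y0)).
  have s0 : 0 < s by lra.
  rewrite (gtr0_norm s0) -exprSr; apply: lerXn2r; rewrite ?nnegrE; lra.
- have s0 : s < 0 by lra.
  rewrite expr0n /= sub0r (ltr0_norm s0) ler_norml; apply/andP; split.
    have h1 : 0 <= x ^+ 2 * (- s - x) by rewrite mulr_ge0 ?sqr_ge0 //; lra.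
    have h2 : 0 <= s ^+ 2 * x by rewrite mulr_ge0 ?sqr_ge0 // ltW.
    have h3 : 0 <= (- s) ^+ 3 by rewrite exprn_ge0; lra.
    have h4 : 0 <= x ^+ 2 * - s by rewrite mulr_ge0 ?sqr_ge0 //; lra.
    lra.
  have h1 : 0 <= x * (- s) * (- s - x) by rewrite !mulr_ge0 //; lra.
  have h2 : 0 <= x ^+ 3 by rewrite exprn_ge0 // ltW.
  have h3 : 0 <= (- s) ^+ 3 by rewrite exprn_ge0; lra.
  have h4 : 0 <= s ^+ 2 * x by rewrite mulr_ge0 ?sqr_ge0 // ltW.
  lra.
- have -> : (x + s) ^+ 3 - x ^+ 3 - s * (3 * x ^+ 2) = s ^+ 2 * (3 * x + s) by ring.
  rewrite normrM (ger0_norm (sqr_ge0 _)); apply: ler_wpM2l; first exact: sqr_ge0.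
  apply: le_trans (ler_normD _ _) _; rewrite gtr0_norm; last lra.
  by rewrite lerD2r; lra.
Qed.

(** Compactness handles the box; outside of it both values vanish. *)
Lemma uniform_continuity K (b : R) : continuous K -> supported b K ->
  forall e : R, 0 < e -> exists2 d : R, 0 < d &
    forall v w, nv w < d -> nc (K (v + w) - K v) <= e.
Proof.
move=> cK sK e e0; have e20 : 0 < e / 2 by rewrite divr_gt0.
have /compact_near_coveringP cov := @box_compact R n (b + 1).
have H : \forall w \near (0 : V), [set z : V | forall i, `|crd i z| <= b + 1] `<=`
    (fun v => nc (K (v + w) - K v) <= e).
  have h := cov V (nbhs (0 : V)) (fun w v => nc (K (v + w) - K v) <= e).
  apply: h => v _; have /continuousVP/(_ _ e20) [d d0 hd] := cK v.
  exists ([set v' | nv (v' - v) < d / 2], [set w | nv w < d / 2]).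
    split; apply/nbhsVP; exists (d / 2) => //; rewrite ?divr_gt0 // => w.
    by rewrite subr0.
  move=> [v' w] [/= h1 h2].
  have k1 : nc (K v' - K v) < e / 2 by apply: hd; lra.
  have k2 : nc (K (v' + w) - K v) < e / 2.
    apply: hd; rewrite addrAC; apply: le_lt_trans (nvD _ _) _; lra.
  have -> : K (v' + w) - K v' = (K (v' + w) - K v) - (K v' - K v) by rewrite opprB addrA subrK.
  by apply: le_trans (ncD _ _) _; rewrite ncN; lra.
move/nbhsVP: H => [d d0 hd]; exists (Num.min d 1) => [|v w]; first by rewrite lt_min d0 ltr01.
rewrite lt_min => /andP [wd w1].
have [[i hi]|h] := pselect (exists i, b + 1 < `|crd i v|); last first.
  apply: (hd w) => /=; first by rewrite subr0.
  by move=> i /=; rewrite leNgt; apply/negP => hi; apply: h; exists i.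
have bi := le_crd i w; have h1 := ler_normB (crd i (v + w)) (crd i w).
rewrite crdD addrK in h1.
rewrite (sK v i); last lra.
rewrite (sK (v + w) i) ?subrr ?nc0 ?(ltW e0) //; rewrite crdD; lra.
Qed.

(** The mean value bound turns the uniform continuity of the derivatives into uniformity of the
    first order expansion. *)
Lemma uniform_differentiability K (b : R) : wclass 1 setT K -> supported b K ->
  forall e : R, 0 < e -> exists2 d : R, 0 < d & forall v w, nv w < d ->
    nc (K (v + w) - K v - wform (fun k => dz k K v) (fun k => dzbar k K v) w) <= e * nv w.
Proof.
move=> hK sK e e0; have e40 : 0 < e / 4 by rewrite divr_gt0.
have sd k : supported (b + 1) (dz k K) /\ supported (b + 1) (dzbar k K).
  have bb : b < b + 1 by rewrite ltrDl.
  by split=> z i hz; have [] := @supported_dz _ _ b K k z i sK (lt_le_trans bb hz).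
have cz k : continuous (dz k K) by move=> z; exact: wclass_continuous (wclass_dz k hK) I.
have czb k : continuous (dzbar k K) by move=> z; exact: wclass_continuous (wclass_dzbar k hK) I.
have [d1 d10 h1] := @finite_radius R _ (fun k (d : R) => forall v w, nv w < d ->
  nc (dz k K (v + w) - dz k K v) <= e / 4)
  (fun k => uniform_continuity (cz k) (sd k).1 e40)
  (fun k d d' dd' h v w hw => h v w (lt_le_trans hw dd')).
have [d2 d20 h2] := @finite_radius R _ (fun k (d : R) => forall v w, nv w < d ->
  nc (dzbar k K (v + w) - dzbar k K v) <= e / 4)
  (fun k => uniform_continuity (czb k) (sd k).2 e40)
  (fun k d d' dd' h v w hw => h v w (lt_le_trans hw dd')).
exists (Num.min d1 d2) => [|v w]; first by rewrite lt_min d10.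
rewrite lt_min => /andP [w1 w2].
have tw (t : R) : 0 <= t <= 1 -> nv (t%:C%C *: w) <= nv w.
  by move=> /andP [t0 t1]; rewrite nvZ nc_real ger0_norm // ler_piMl // nv_ge0.
have -> : e * nv w = 4 * (e / 4) * nv w by field.
apply: (@wirt_increment R n K v w (fun x k => dz k K x) (fun x k => dzbar k K x)).
- by move=> t _; exact: wclass_wdiff hK I.
- by move=> t k /tw ht; apply: h1; apply: le_lt_trans w1.
- by move=> t k /tw ht; apply: h2; apply: le_lt_trans w2.
Qed.

(** The partial derivatives [a] of [f] are bounded, but nothing is assumed about their continuity:
    this is all that is known at first of a map that intertwines two metrics. *)
Section Goursat.
Variables (f : V -> C) (z0 : V) (R0 M : R) (a : V -> 'I_n -> C).
Hypotheses (R00 : 0 < R0) (n0 : (0 < n)%N).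
Hypothesis hf : forall w, nv (w - z0) < R0 -> wirt f w (a w) (fun=> 0).
Hypothesis ha : forall w k, nv (w - z0) < R0 -> nc (a w k) <= M.

Let B' : R := nv z0 + R0.
Let B : R := B' + 1.
Let B'0 : 0 <= B'. Proof. by rewrite addr_ge0 ?nv_ge0 // ltW. Qed.
Let BB' : B' < B. Proof. by rewrite ltrDl. Qed.
Let B0 : 0 < B. Proof. by rewrite ltr_wpDl. Qed.

(** Test functions with this support condition can be multiplied by [f], which is controlled only
    on the larger ball. *)
Definition cut g := forall w, R0 / 2 < nv (w - z0) -> g w = 0.

Let M0 : 0 <= M.
Proof.
by apply: le_trans (nc_ge0 _) (ha (w := z0) (Ordinal n0) _); rewrite subrr nv0.
Qed.

Let half : R0 / 2 < R0. Proof. by rewrite ltr_pdivrMr // ltr_pMr // ltr1n. Qed.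

Let Mf := nc (f z0) + 4 * M * R0.

Lemma f_bound w : nv (w - z0) < R0 -> nc (f w) <= Mf.
Proof.
move=> hw; rewrite -(subrK (f z0) (f w)); apply: le_trans (ncD _ _) _.
rewrite addrC lerD2l.
have := @wirt_increment R n f z0 (w - z0) a (fun _ _ => 0) (fun=> 0) (fun=> 0) M.
have -> : wform (fun=> 0) (fun=> 0) (w - z0) = 0 by apply: big1 => i _; rewrite !mul0r addr0.
rewrite !subr0 [z0 + (w - z0)]addrC subrK => h.
have seg (t : R) : 0 <= t <= 1 -> nv (z0 + t%:C%C *: (w - z0) - z0) < R0.
  move=> /andP [t0 t1]; rewrite (addrC z0) addrK nvZ nc_real ger0_norm //.
  by apply: le_lt_trans hw; rewrite ler_piMl // nv_ge0.
apply: le_trans (h _ _ _) _.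
- by move=> t /seg; exact: hf.
- by move=> t k /seg; rewrite subr0; exact: ha.
- by move=> *; rewrite nc0.
by rewrite ler_wpM2l ?mulr_ge0 // ltW.
Qed.

Let Mf0 : 0 <= Mf.
Proof. by rewrite addr_ge0 ?nc_ge0 // !mulr_ge0 // ltW. Qed.

Lemma cut_near g w : cut g -> ~ (nv (w - z0) < R0) -> \forall v \near w, 0 = g v.
Proof.
move=> cg /negP; rewrite -leNgt => hw; apply/nbhsVP; exists (R0 / 2); first by rewrite divr_gt0.
move=> v hv; apply/esym/cg.
have := nvD (w - v) (v - z0); rewrite addrA subrK nvB; lra.
Qed.

Lemma cut_mul_continuous g : continuous g -> cut g -> continuous (fun w => f w * g w).
Proof.
move=> cg hg w; have [hw|hw] := pselect (nv (w - z0) < R0).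
  by apply: continuousM; [exact: wdiff_continuous (wirt_wdiff (hf hw))|exact: cg].
apply: (@near_eq_continuous _ _ (fun=> 0)); last exact: continuous_cst.
by apply: filterS (cut_near hg hw) => v <-; rewrite mulr0.
Qed.

Lemma cut_supported g (r : R) : R0 / 2 < r -> cut g -> supported (nv z0 + r) g.
Proof.
move=> hr hg w i hi; apply: hg; have := le_crd i w.
have := nvD (w - z0) z0; rewrite subrK; lra.
Qed.

(** The Cauchy-Riemann equations in the weak form: [f * dzbar k g] is the [k]-th conjugate
    derivative of [f * g]. *)
Lemma weak_dbar g k : wclass 1 setT g -> cut g -> iC B (fun w => f w * dzbar k g w) = 0.
Proof.
move=> hg cg; have R0p := R00.
have cgc : continuous g by move=> z; exact: wclass_continuous hg I.
have sg : supported (nv z0 + 3 / 4 * R0) g by apply: cut_supported => //; lra.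
have sB : nv z0 + 3 / 4 * R0 < B' by rewrite ltrD2l; lra.
have cdz j : continuous (dz j g) by move=> z; exact: wclass_continuous (wclass_dz j hg) I.
have cdzb j : continuous (dzbar j g) by move=> z; exact: wclass_continuous (wclass_dzbar j hg) I.
have sd j : supported B' (dz j g) /\ supported B' (dzbar j g).
  by split=> z i hz; have [] := @supported_dz _ _ _ g j z i sg (lt_le_trans sB hz).
have out w j : ~ (nv (w - z0) < R0) -> dz j g w = 0 /\ dzbar j g w = 0.
  move=> hw; have h := wirt_near (cut_near cg hw) (wirt_cst 0 w).
  by rewrite (wirt_dz _ h) (wirt_dzbar _ h).
have cutd j : cut (dzbar j g).
  move=> w hw; have hn : \forall v \near w, 0 = g v.
    apply/nbhsVP; exists (nv (w - z0) - R0 / 2) => [|v hv]; first by rewrite subr_gt0.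
    apply/esym/cg; have := nvD (w - v) (v - z0); rewrite addrA subrK nvB; lra.
  by rewrite (wirt_dzbar _ (wirt_near hn (wirt_cst 0 w))).
have [Mg Mg0 hMg] := supported_bounded cgc (fun z i h => sg z i (le_trans (ltW sB) h)).
have [d d0 hd] : exists2 d : R, 0 < d & forall j z, d * nc (dz j g z) <= 1 /\ d * nc (dzbar j g z) <= 1.
  apply: finite_radius => [j|j d d' dd' h z]; last first.
    have [h1 h2] := h z; split; apply: le_trans (ler_wpM2r (nc_ge0 _) dd') _; assumption.
  have [M1 M10 h1] := supported_bounded (cdz j) (sd j).1.
  have [M2 M20 h2] := supported_bounded (cdzb j) (sd j).2.
  have p : 0 < M1 + M2 + 1 by rewrite ltr_wpDl ?addr_ge0.
  exists (M1 + M2 + 1)^-1; first by rewrite invr_gt0.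
  move=> z; rewrite !ler_pdivrMl // !mulr1; have := h1 z; have := h2 z; split; lra.
have hdz j z : nc (dz j g z) <= d^-1 by rewrite -[d^-1]mulr1 ler_pdivlMl // (hd j z).1.
have hdzb j z : nc (dzbar j g z) <= d^-1 by rewrite -[d^-1]mulr1 ler_pdivlMl // (hd j z).2.
pose a1 w j := if nv (w - z0) < R0 then a w j * g w + f w * dz j g w else 0.
pose b1 w j := f w * dzbar j g w.
have hb1 w j : ~ (nv (w - z0) < R0) -> b1 w j = 0.
  by move=> /(out _ j) [_ h]; rewrite /b1 h mulr0.
have di : 0 <= d^-1 by rewrite invr_ge0 ltW.
have H1 w : wirt (fun w => f w * g w) w (a1 w) (b1 w).
  have [hw|hw] := pselect (nv (w - z0) < R0).
    apply: eq_wirt (wirtM (hf hw) (wclass_wdiff hg I)) => j; first by rewrite /a1 ifT.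
    by rewrite mul0r add0r.
  have h0 : \forall v \near w, 0 = f v * g v.
    by apply: filterS (cut_near cg hw) => v <-; rewrite mulr0.
  apply: eq_wirt (wirt_near h0 (wirt_cst 0 w)) => j; last by rewrite hb1.
  by rewrite /a1 ifF //; apply/negP.
have H2 w j : nc (a1 w j) <= M * Mg + Mf * d^-1.
  rewrite /a1; case: ifP => hw; last by rewrite nc0 addr_ge0 ?mulr_ge0.
  apply: le_trans (ncD _ _) _; rewrite (ncM (a w j)) (ncM (f w)); apply: lerD.
    by apply: ler_pM; rewrite ?nc_ge0 ?hMg ?ha.
  by apply: ler_pM; rewrite ?nc_ge0 ?hdz ?f_bound.
have H3 w j : nc (b1 w j) <= M * Mg + Mf * d^-1.
  have [hw|hw] := pselect (nv (w - z0) < R0); last first.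
    by rewrite hb1 // nc0 addr_ge0 ?mulr_ge0.
  apply: le_trans (_ : Mf * d^-1 <= _); last by rewrite lerDr mulr_ge0.
  by rewrite (ncM (f w)); apply: ler_pM; rewrite ?nc_ge0 ?hdzb ?f_bound.
have H4 : supported B' (fun w => f w * g w).
  by move=> w i hi; rewrite (sg w i) ?mulr0 //; exact: le_trans (ltW sB) hi.
have H5 := @cut_mul_continuous _ (cdzb k) (cutd k).
exact: (iC_dzbar_eq0 B'0 BB' H1 H2 H3 H4 H5).
Qed.

Let r := R0 / (4 * n%:R).

Let rn : n%:R * r = R0 / 4.
Proof.
have n0' : (n%:R : R) != 0 by rewrite pnatr_eq0 -lt0n.
by rewrite /r; field.
Qed.

Let r0 : 0 < r. Proof. by rewrite divr_gt0 // mulr_gt0 // ltr0n. Qed.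

Lemma bump_cut N tau z : nv (z - z0) < R0 / 4 -> tau <= r ^+ 2 -> cut (bump N.+1 tau z).
Proof.
move=> hz ht w hw; apply: (bump_eq0 _ (ltW r0) ht) => //; rewrite rn.
have := nvD (w - z) (z - z0); rewrite addrA subrK; lra.
Qed.

Lemma continuous_bump N tau z : continuous (bump N.+1 tau z : V -> C).
Proof. by move=> w; apply: wclass_continuous (wclass_bump _ _ _) I. Qed.

(** Average of [f] against the [N]-th power of the ball function of squared radius [tau]. *)
Definition moment N tau z : C := iC B (fun w => f w * bump N tau z w).

Let cmom N tau z : nv (z - z0) < R0 / 4 -> tau <= r ^+ 2 ->
  continuous (fun w => f w * bump N.+1 tau z w).
Proof. by move=> hz ht; apply: cut_mul_continuous; [exact: continuous_bump|exact: bump_cut]. Qed.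

Let gk tau z k (w : V) : C := (w 0 k - z 0 k)^*%C * bump 3 tau z w.

Let dzbar_gk tau z k w : dzbar k (gk tau z k) w =
  bump 3 tau z w - 3 * bump 2 tau z w * ((w 0 k - z 0 k) * (w 0 k - z 0 k)^*%C).
Proof.
have h1 := wirt_conj (wirt_shift_coord z w k).
have h2 := @wirt_cpospow R n 2 (ballfun tau z) w (ballfun_real _ _)
  (wirt_wdiff (wirt_ballfun tau z w)) isT.
rewrite (wirt_dzbar _ (wirtM h1 h2)) (wirt_dzbar _ (wirt_ballfun tau z w)) eqxx conjc1.
rewrite mul1r; congr (_ + _).
rewrite -/(bump 2 tau z w); move: (w 0 k - z 0 k) (bump 2 tau z w) => x b.
by move: (x^*%C) => y; ring.
Qed.

Let wclass_gk tau z k : wclass 1 setT (gk tau z k).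
Proof.
have oT : open [set: V] by exact: openT.
apply: (wclassM oT); last exact: wclass_le (wclass_bump 2 tau z).
apply: (wclass_conj oT); exact: (wclassB oT (wclass_coord _ 1 k) (wclass_cst _ 1 _)).
Qed.

(** Integration by parts against the fields [conj (w_k - z_k)] turns the Cauchy-Riemann equations
    into an Euler equation for the moments in the variable [tau]. *)
Lemma moment_euler tau z : nv (z - z0) < R0 / 4 -> tau <= r ^+ 2 ->
  (n + 3)%:R * moment 3 tau z = 3 * tau%:C%C * moment 2 tau z.
Proof.
move=> hz ht.
have cgk k : cut (gk tau z k) by move=> w hw; rewrite /gk (bump_cut _ hz ht hw) mulr0.
have cg k : continuous (fun w => f w * dzbar k (gk tau z k) w).
  apply: cut_mul_continuous.
    by move=> w; apply: wclass_continuous (wclass_dzbar k (wclass_gk tau z k)) I.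
  by move=> w hw; rewrite dzbar_gk (bump_cut _ hz ht hw) (bump_cut _ hz ht hw); ring.
(* The divergence of the test fields is [(n + 3) * bump 3 - 3 * tau * bump 2]. *)
have := (iC_sum (index_enum 'I_n) B0 cg).1.
rewrite [RHS]big1 => [|k _]; last exact: weak_dbar.
have c3 := cmom (N := 2) hz ht; have c2 := cmom (N := 1) hz ht.
have -> : iC B (fun w => \sum_k f w * dzbar k (gk tau z k) w) =
    (n + 3)%:R * moment 3 tau z + - (3 * tau%:C%C) * moment 2 tau z.
  rewrite /moment -(iCZ B0 _ c3) -(iCZ B0 _ c2).
  rewrite -(iCD B0 (@continuousVZ _ _ _ _ c3) (@continuousVZ _ _ _ _ c2)).
  apply: eq_iC => w; rewrite -mulr_sumr.
  under eq_bigr do rewrite dzbar_gk.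
  rewrite sumrB -mulr_sumr sumr_const card_ord -[_ *+ n]mulr_natl.
  have -> : \sum_k (w 0 k - z 0 k) * (w 0 k - z 0 k)^*%C = tau%:C%C - ballfun tau z w.
    by rewrite ballfunE opprB addrC subrK.
  have E : ballfun tau z w * bump 2 tau z w = bump 3 tau z w.
    by rewrite /ballfun !bumpE -rmorphM; congr (_%:C)%C; rewrite pospow_mul.
  move: E; rewrite natrD.
  move: (ballfun tau z w) (bump 2 tau z w) (bump 3 tau z w) (f w) tau%:C%C n%:R => x b2 b3 y t m E.
  by rewrite -E; ring.
by move/eqP; rewrite mulNr subr_eq0 => /eqP.
Qed.

(** Differentiation under the integral sign, from the polynomial estimate [pospow3_increment]. *)
Lemma moment_diff tau z : nv (z - z0) < R0 / 4 -> 0 <= tau -> tau < r ^+ 2 ->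
  has_diffR nc (fun t => moment 3 t z) tau (fun s => s%:C%C * (3 * moment 2 tau z)).
Proof.
move=> hz t0 ht; split.
  by exists (nc (3 * moment 2 tau z)) => [|s]; rewrite ?nc_ge0 // ncM nc_real mulrC.
move=> e e0.
pose Q : R := 2 * ((2 * B) ^+ size (index_enum ('I_n * bool)%type) * (Mf * (6 * tau + 1))).
have BB0 : 0 <= 2 * B by rewrite mulr_ge0 // ltW.
have t60 : 0 <= 6 * tau + 1 by rewrite addr_ge0 // mulr_ge0.
have Q0 : 0 <= Q by rewrite mulr_ge0 // mulr_ge0 ?exprn_ge0 // mulr_ge0.
exists (Num.min (Num.min 1 (e / (Q + 1))) (r ^+ 2 - tau)).
  by rewrite !lt_min ltr01 subr_gt0 ht andbT divr_gt0 // ltr_wpDl.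
move=> s; rewrite !lt_min => /andP [/andP [s1 s2] s3].
have hts : tau + s <= r ^+ 2 by have := ler_norm s; lra.
have htt := ltW ht.
have cA := cmom (N := 2) hz hts; have cB := cmom (N := 2) hz htt; have cC := cmom (N := 1) hz htt.
have cB' := @continuousVZ _ _ (-1) _ cB; have cC' := @continuousVZ _ _ (- (s%:C%C * 3)) _ cC.
have cAB := @continuousVD _ _ _ _ cA cB'; have cABC := @continuousVD _ _ _ _ cAB cC'.
have -> : moment 3 (tau + s) z - moment 3 tau z - s%:C%C * (3 * moment 2 tau z) =
  iC B (fun w => f w * bump 3 (tau + s) z w + -1 * (f w * bump 3 tau z w)
     + - (s%:C%C * 3) * (f w * bump 2 tau z w)).
  rewrite (iCD B0 cAB cC') (iCD B0 cA cB') (iCZ B0 _ cB) (iCZ B0 _ cC) -/(moment 3 (tau + s) z).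
  rewrite -/(moment 3 tau z) -/(moment 2 tau z).
  move: (moment 3 (tau + s) z) (moment 3 tau z) (moment 2 tau z) s%:C%C => u1 u2 u3 u4.
  by ring.
apply: le_trans (@iC_bound _ _ _ B0 _ (Mf * (s ^+ 2 * (6 * tau + 1))) cABC _) _ => [w|].
  have -> : f w * bump 3 (tau + s) z w + -1 * (f w * bump 3 tau z w)
     + - (s%:C%C * 3) * (f w * bump 2 tau z w) =
     f w * (bump 3 (tau + s) z w - bump 3 tau z w - s%:C%C * (3 * bump 2 tau z w)).
    move: (f w) (bump 3 (tau + s) z w) (bump 3 tau z w) (bump 2 tau z w) s%:C%C => u1 u2 u3 u4 u5.
    by ring.
  have [hw|hw] := ltP (nv (w - z0)) R0; last first.
    have hw' : R0 / 2 < nv (w - z0) by apply: lt_le_trans hw.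
    rewrite (bump_cut _ hz hts hw') (bump_cut _ hz htt hw') (bump_cut _ hz htt hw').
    by rewrite !mulr0 !subr0 mulr0 nc0 mulr_ge0 // mulr_ge0 // sqr_ge0.
  rewrite (ncM (f w)); apply: ler_pM; rewrite ?nc_ge0 ?f_bound // !bumpE.
  set q := sqnorm (w - z).
  have -> : (pospow 3 (tau + s - q))%:C%C - (pospow 3 (tau - q))%:C%C
      - s%:C%C * (3 * (pospow 2 (tau - q))%:C%C) =
      (pospow 3 ((tau - q) + s) - pospow 3 (tau - q) - s * (3 * pospow 2 (tau - q)))%:C%C :> C.
    by rewrite (addrAC tau s) !rmorphB !rmorphM rmorph_nat.
  rewrite nc_real; apply: le_trans (pospow3_increment _ _) _.
  apply: ler_wpM2l; first exact: sqr_ge0.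
  apply: lerD; last exact: ltW.
  rewrite ler_wpM2l // ge_max t0 /=; have := sqnorm_ge0 (w - z); rewrite -/q; lra.
have -> : 2 * ((2 * B) ^+ size (index_enum ('I_n * bool)%type) * (Mf * (s ^+ 2 * (6 * tau + 1)))) =
    s ^+ 2 * Q by rewrite /Q; ring.
have -> : s ^+ 2 = `|s| ^+ 2 by rewrite real_normK // num_real.
rewrite expr2 mulrAC; apply: ler_wpM2r => //.
apply: le_trans (ratio_le (ltW e0) Q0); apply: ler_wpM2r => //; exact: ltW.
Qed.

Lemma moment_small z (e rho : R) : nv (z - z0) < R0 / 4 -> 0 <= rho -> rho <= r -> 0 <= e ->
  (forall w, nv (w - z) < n%:R * rho -> nc (f w) <= e) ->
  nc (moment 3 (rho ^+ 2) z) <= 2 * (e * iR B (fun w => pospow 3 (rho ^+ 2 - sqnorm (w - z)))).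
Proof.
move=> hz rho0 hr e0 he; set P := fun w => _.
have hr2 : rho ^+ 2 <= r ^+ 2 by rewrite lerXn2r // nnegrE // ltW.
have PE w : (P w)%:C%C = bump 3 (rho ^+ 2) z w by [].
have cP : continuous P.
  have := @continuous_Re R n (bump 3 (rho ^+ 2) z) (@continuous_bump _ _ _).
  by congr (continuous _).
rewrite -(pintsZ B0 _ e 0 cP); apply: (iC_le B0 (cmom hz hr2)).
  exact: continuous_mulr.
move=> w; rewrite -PE ncM nc_real.
have Pw : 0 <= P w by exact: pospow_ge0.
rewrite ger0_norm //; have [hw|hw] := ltP (nv (w - z)) (n%:R * rho).
  by rewrite ler_wpM2r // he.
suff -> : P w = 0 by rewrite !mulr0.
have := @bump_eq0 R n 3 (rho ^+ 2) rho z w isT rho0 (lexx _) hw n0.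
by rewrite -PE => /(congr1 (@complex.Re R)).
Qed.

End Goursat.

Lemma iC_real B (F : V -> R) : 0 < B -> continuous F -> iC B (fun w => (F w)%:C%C) = (iR B F)%:C%C.
Proof.
move=> B0 cF; rewrite /iC; congr (_ +i* _)%C.
rewrite -[RHS](mul0r (iR B F)) /iR -(pintsZ B0 _ 0 0 cF); congr (pints _ _ _ _).
by apply/funext => w; rewrite mul0r.
Qed.

Lemma constant_of_diff0 (phi : R -> C) (T : R) :
  (forall t, 0 < t < T -> has_diffR nc phi t (fun=> 0)) ->
  forall s t, 0 < s < T -> 0 < t < T -> phi s = phi t.
Proof.
move=> h s t /andP [s0 sT] /andP [t0 tT].
have conv (u : R) : 0 <= u <= 1 -> 0 < s + u * (t - s) < T.
  move=> /andP [u0 u1]; have [st|st] := leP s t.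
    have k1 : 0 <= u * (t - s) by rewrite mulr_ge0 // subr_ge0.
    have k2 : u * (t - s) <= t - s by rewrite ler_piMl // subr_ge0.
    by apply/andP; split; lra.
  have k1 : 0 <= u * (s - t) by rewrite mulr_ge0 // subr_ge0 ltW.
  have k2 : u * (s - t) <= s - t by rewrite ler_piMl // subr_ge0 ltW.
  by apply/andP; split; lra.
have := @mean_value_bound R (fun u => phi (s + u * (t - s))) (fun=> 0) 0 0.
rewrite mul1r mul0r addr0 (addrC s) subrK => H.
suff : nc (phi t - phi s - 0) <= 2 * 0.
  rewrite subr0 mulr0.
  move=> hle; apply/esym/eqP; rewrite -subr_eq0; apply/eqP/nc_eq0.
  by apply: le_anti; rewrite hle nc_ge0.
apply: H => [u /conv hu|u _]; last by rewrite subr0 nc0.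
have [_ hd] := h _ hu; split.
  by exists 0 => // v; rewrite mulr0 nc0 mul0r.
move=> e e0; have [d d0 hd'] := hd (e / (`|t - s| + 1)) (divr_gt0 e0 (ltr_wpDl (normr_ge0 _) ltr01)).
exists (d / (`|t - s| + 1)) => [|v hv]; first by rewrite divr_gt0 // ltr_wpDl.
have p : 0 < `|t - s| + 1 by rewrite ltr_wpDl.
have := hd' (v * (t - s)); rewrite mulr0 mulrDl addrA => hh.
apply: le_trans (hh _) _.
  rewrite normrM; move: hv; rewrite ltr_pdivlMr //; apply: le_lt_trans.
  by rewrite ler_wpM2l // lerDl.
rewrite normrM mulrCA [X in _ <= X]mulrC; apply: ler_wpM2l => //.
exact: ratio_le (ltW e0) (normr_ge0 _).
Qed.

Section MeanValue.
Variables (f : V -> C) (z0 : V) (R0 M : R) (a : V -> 'I_n -> C).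
Hypotheses (R00 : 0 < R0) (n0 : (0 < n)%N).
Hypothesis hf : forall w, nv (w - z0) < R0 -> wirt f w (a w) (fun=> 0).
Hypothesis ha : forall w k, nv (w - z0) < R0 -> nc (a w k) <= M.

Let r := R0 / (4 * n%:R).
Let r0 : 0 < r. Proof. by rewrite divr_gt0 // mulr_gt0 // ltr0n. Qed.
Let B : R := nv z0 + R0 + 1.
Let B0 : 0 < B. Proof. by rewrite ltr_wpDl // addr_ge0 ?nv_ge0 // ltW. Qed.

Let M0 : 0 <= M.
Proof. by apply: le_trans (nc_ge0 _) (ha (w := z0) (Ordinal n0) _); rewrite subrr nv0. Qed.

Let h1 w : nv (w - z0) < R0 -> wirt (fun _ : V => 1) w (fun=> 0) (fun=> 0).
Proof. by move=> _; exact: wirt_cst. Qed.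
Let hb1 (w : V) (k : 'I_n) : nv (w - z0) < R0 -> nc (0 : C) <= 0.
Proof. by rewrite nc0. Qed.

Let c tau z := moment (fun=> 1) z0 R0 3 tau z.

Let cE tau z : c tau z = (iR B (fun w => pospow 3 (tau - sqnorm (w - z))))%:C%C.
Proof.
rewrite -iC_real //; last first.
  have := @continuous_Re R n (bump 3 tau z) (@continuous_bump _ _ _).
  by congr (continuous _).
by apply: eq_iC => w; rewrite mul1r.
Qed.

Lemma mass_gt0 tau z : 0 < tau -> nv (z - z0) < R0 / 4 -> 0 < c tau z.
Proof.
move=> t0 hz; have -> : c tau z = iC B (fun w => (pospow 3 (tau - sqnorm (w - z)))%:C%C).
  by apply: eq_iC => w; rewrite mul1r.
apply: (@iC_gt0 _ _ _ _ _ z) => //.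
- have := @continuous_Re R n (bump 3 tau z) (@continuous_bump _ _ _).
  by congr (continuous _).
- by move=> w; exact: pospow_ge0.
- by rewrite subrr sqnorm0 subr0 pospow_gt0.
- move=> i; apply: le_lt_trans (le_crd _ _) _; have := nvD (z - z0) z0; rewrite subrK /B; have := R00; lra.
Qed.

(** By the Euler equation the moments of [f] and of [1] have the same logarithmic derivative
    [(n + 3) / tau] with respect to [tau]. *)
Lemma moment_ratio g z : (forall w, nv (w - z0) < R0 -> wirt g w (a w) (fun=> 0)) ->
  nv (z - z0) < R0 / 4 -> forall s t, 0 < s < r ^+ 2 -> 0 < t < r ^+ 2 ->
  moment g z0 R0 3 s z / c s z = moment g z0 R0 3 t z / c t z.
Proof.
move=> hg hz; apply: constant_of_diff0 => t /andP [t0 ht].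
have ct0 : c t z != 0 by rewrite gt_eqF // mass_gt0.
have d1 := moment_diff R00 n0 hg ha hz (ltW t0) ht.
have d2 := moment_diff R00 n0 h1 hb1 hz (ltW t0) ht.
have e1 := moment_euler R00 n0 hg ha hz (ltW ht).
have e2 := moment_euler R00 n0 h1 hb1 hz (ltW ht).
have := has_diffM is_norm_real d1 (has_diff_inv is_norm_real ct0 d2).
apply: has_diff_eqL => s; rewrite -/(c t z) in e2 *.
have n30 : (n + 3)%:R != 0 :> C by rewrite pnatr_eq0 addn3.
move: (n + 3)%:R (moment g z0 R0 3 t z) (moment g z0 R0 2 t z) (moment (fun=> 1) z0 R0 2 t z) (c t z)
  s%:C%C t%:C%C ct0 e1 e2 n30 => N m3 m2 c2 c3 s' t' c30 e1 e2 N0.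
have E : m3 * c2 = m2 * c3.
  apply: (mulfI N0); have -> : N * (m3 * c2) = (N * m3) * c2 by ring.
  rewrite e1; have -> : 3 * t' * m2 * c2 = m2 * (3 * t' * c2) by ring.
  by rewrite -e2; ring.
have -> : s' * (3 * m2) / c3 + m3 * - (s' * (3 * c2) / c3 ^+ 2) =
  3 * s' / c3 ^+ 2 * (m2 * c3 - m3 * c2) by field.
by rewrite E subrr mulr0.
Qed.

(** The moment of [f - f z] is a constant multiple of that of [1] as the radius varies; as the radius
    shrinks the constant becomes arbitrarily small, by the continuity of [f] at [z]. *)
Lemma mean_value_property tau z : nv (z - z0) < R0 / 4 -> 0 < tau < r ^+ 2 ->
  moment f z0 R0 3 tau z = f z * c tau z.
Proof.
move=> hz ht; have [t0 tr] := andP ht; have ct := mass_gt0 t0 hz.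
pose F w := f w + - f z.
have hF w : nv (w - z0) < R0 -> wirt F w (a w) (fun=> 0).
  move=> /hf hw; apply: eq_wirt (wirtD hw (wirt_cst (- f z) w)) => j; exact: addr0.
have zR : nv (z - z0) < R0 by apply: lt_le_trans hz _; have := R00; lra.
have cF : continuous (fun w => F w * bump 3 tau z w).
  exact: (cut_mul_continuous R00 hF (@continuous_bump _ _ _) (bump_cut R00 n0 _ hz (ltW tr))).
have c1 : continuous (fun w => 1 * bump 3 tau z w).
  exact: (cut_mul_continuous R00 h1 (@continuous_bump _ _ _) (bump_cut R00 n0 _ hz (ltW tr))).
have E : moment f z0 R0 3 tau z = moment F z0 R0 3 tau z + f z * c tau z.
  rewrite /c /moment -/B -(iCZ B0 _ c1) -(iCD B0 cF (@continuousVZ _ _ (f z) _ c1)).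
  apply: eq_iC => w; rewrite /F; move: (f w) (f z) (bump 3 tau z w) => x y b; ring.
rewrite E; suff -> : moment F z0 R0 3 tau z = 0 by rewrite add0r.
pose q := moment F z0 R0 3 tau z / c tau z.
suff q0 : q = 0.
  by rewrite -[LHS](divfK (lt0r_neq0 ct)) -/q q0 mul0r.
apply/nc_eq0/le_anti; rewrite nc_ge0 andbT; apply/ler_addgt0Pl => e e0; rewrite addr0.
have e20 : 0 < e / 2 by rewrite divr_gt0.
have /continuousVP/(_ _ e20) [d d0 hd] := wdiff_continuous (wirt_wdiff (hf zR)).
have n0R : 0 < n%:R :> R by rewrite ltr0n.
pose rho := Num.min (r / 2) (d / n%:R).
have rho0 : 0 < rho by rewrite lt_min; apply/andP; split; apply: divr_gt0.
have rhor : rho < r by rewrite gt_min; apply/orP; left; have := r0; lra.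
have hF' w : nv (w - z) < n%:R * rho -> nc (F w) <= e / 2.
  move=> hw; apply/ltW/hd; apply: lt_le_trans hw _.
  by rewrite mulrC -ler_pdivlMr // ge_min lexx orbT.
have hr2 : 0 < rho ^+ 2 < r ^+ 2.
  by rewrite exprn_gt0 //= ltrXn2r // ?nnegrE // ltW.
have cr := mass_gt0 (proj1 (andP hr2)) hz.
have := moment_small R00 n0 hF hz (ltW rho0) (ltW rhor) (ltW e20) hF'.
rewrite -/B /q (moment_ratio hF hz ht hr2) cE; rewrite cE ltcR in cr.
move: cr; move: (iR B _) (moment F z0 R0 3 _ z) => x m x0 hm.
rewrite -fmorphV ncM nc_real ger0_norm ?invr_ge0 ?(ltW x0) // ler_pdivrMr //.
by apply: le_trans hm _; rewrite mulrA mulrCA divff ?mulr1 // pnatr_eq0.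
Qed.

End MeanValue.

Section Smoothing.
Variables (f : V -> C) (z0 : V) (R0 M : R) (a : V -> 'I_n -> C).
Hypotheses (R00 : 0 < R0) (n0 : (0 < n)%N).
Hypothesis hf : forall w, nv (w - z0) < R0 -> wirt f w (a w) (fun=> 0).
Hypothesis ha : forall w k, nv (w - z0) < R0 -> nc (a w k) <= M.

Let B : R := nv z0 + R0 + 1.
Let B0 : 0 < B. Proof. by rewrite ltr_wpDl // addr_ge0 ?nv_ge0 // ltW. Qed.
Let Mf := nc (f z0) + 4 * M * R0.
Let Mf0 : 0 <= Mf.
Proof.
rewrite addr_ge0 ?nc_ge0 // !mulr_ge0 //; last exact: ltW.
by apply: le_trans (nc_ge0 _) (ha (w := z0) (Ordinal n0) _); rewrite subrr nv0.
Qed.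

Definition small_kernel K := forall v, R0 / 4 < nv v -> K v = 0.
Definition smoothing K z : C := iC B (fun w => f w * K (w - z)).
Let U := [set z : V | nv (z - z0) < R0 / 4].

Let oU : open U.
Proof.
rewrite openE => z Uz; apply/nbhsVP; exists (R0 / 4 - nv (z - z0)); first by rewrite subr_gt0.
move=> w hw; have := nvD (w - z) (z - z0); rewrite addrA subrK /U /=; lra.
Qed.

Let cutK K z : small_kernel K -> U z -> cut z0 R0 (fun w => K (w - z)).
Proof.
move=> hK Uz w hw; apply: hK; have := nvD (w - z) (z - z0); rewrite addrA subrK.
move: Uz; rewrite /U /=; lra.
Qed.

Let cK K z : continuous K -> small_kernel K -> U z -> continuous (fun w => f w * K (w - z)).
Proof.
by move=> ck hK Uz; apply: (cut_mul_continuous R00 hf (continuous_translate (v := - z) ck) (cutK hK Uz)).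
Qed.

Let Q : R := 2 * ((2 * B) ^+ size (index_enum ('I_n * bool)%type) * Mf).
Let Q0 : 0 <= Q.
Proof. by rewrite mulr_ge0 // mulr_ge0 // exprn_ge0 // mulr_ge0 // ltW. Qed.

Let smoothing_bound (g : V -> C) (e : R) : 0 <= e -> continuous (fun w => f w * g w) ->
  cut z0 R0 g -> (forall w, nc (g w) <= e) -> nc (iC B (fun w => f w * g w)) <= Q * e.
Proof.
move=> e0 cg hg he; apply: le_trans (iC_bound (M := Mf * e) B0 cg _) _ => [w|].
  have [hw|hw] := ltP (nv (w - z0)) R0.
    rewrite (ncM (f w)); apply: ler_pM; rewrite ?nc_ge0 ?he //.
    exact: (f_bound R00 n0 hf ha).
  rewrite hg ?mulr0 ?nc0 ?mulr_ge0 //; apply: lt_le_trans hw; have := R00; lra.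
by rewrite /Q !mulrA.
Qed.

Lemma small_kernel_d K k : small_kernel K -> small_kernel (dz k K) /\ small_kernel (dzbar k K).
Proof.
move=> hK; suff h v : R0 / 4 < nv v -> wirt K v (fun=> 0) (fun=> 0).
  by split=> v /h hv; [rewrite (wirt_dz _ hv)|rewrite (wirt_dzbar _ hv)].
move=> hv; apply: wirt_near (wirt_cst 0 v).
apply/nbhsVP; exists (nv v - R0 / 4); first by rewrite subr_gt0.
move=> w hw; rewrite hK //; have := nvD (v - w) w; rewrite subrK nvB; lra.
Qed.

Lemma small_kernel_supported K : small_kernel K -> supported (R0 / 2) K.
Proof.
by move=> hK v i hi; apply: hK; have := le_crd i v; have := R00; lra.
Qed.

Lemma continuous_smoothing K z : continuous K -> small_kernel K -> U z ->
  {for z, continuous (smoothing K)}.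
Proof.
move=> ck hK Uz; apply/continuousVP => e e0.
have p : 0 < Q + 1 by rewrite ltr_wpDl.
have e2 : 0 < e / (Q + 1) / 2 by rewrite !divr_gt0.
have [d d0 hd] := uniform_continuity ck (small_kernel_supported hK) e2.
have /nbhsVP [d' d'0 hd'] : nbhs z U by apply: open_nbhs_nbhs.
exists (Num.min d d') => [|w]; first by rewrite lt_min d0.
rewrite lt_min => /andP [w1 /hd' Uw].
have c1 := cK ck hK Uw; have c2 := cK ck hK Uz.
pose g v := K (v - w) - K (v - z).
have gE : (fun v => f v * g v) = (fun v => f v * K (v - w) + -1 * (f v * K (v - z))).
  by apply/funext => v; rewrite /g mulrBr mulN1r.
have -> : smoothing K w - smoothing K z = iC B (fun v => f v * g v).
  rewrite gE (iCD B0 c1 (@continuousVZ _ _ (-1) _ c2)) (iCZ B0 _ c2) mulN1r //.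
apply: le_lt_trans (smoothing_bound (g := g) (ltW e2) _ _ _) _.
- rewrite gE; exact: (@continuousVD _ _ _ _ c1 (@continuousVZ _ _ (-1) _ c2)).
- by move=> v hv; rewrite /g (cutK hK Uw hv) (cutK hK Uz hv) subrr.
- move=> v; rewrite /g; have -> : v - w = (v - z) + (z - w) by rewrite addrA subrK.
  by apply: hd; rewrite nvB.
rewrite mulrCA -mulrA mulrCA; move: p; move: (Q) Q0 => q q0 p.
have := ratio_le (ltW e0) q0; rewrite -mulrA [_^-1 * q]mulrC; nra.
Qed.

(** All the derivatives fall on the kernel, whose expansion is uniform. *)
Lemma wirt_smoothing K z : wclass 1 setT K -> small_kernel K -> U z ->
  wirt (smoothing K) z (fun k => - smoothing (dz k K) z) (fun k => - smoothing (dzbar k K) z).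
Proof.
move=> hK sK Uz; split.
  pose Mw := \sum_k (nc (smoothing (dz k K) z) + nc (smoothing (dzbar k K) z)).
  have le3 (x y t : R) : 0 <= x -> 0 <= y -> 0 <= t -> x <= x + y + t /\ y <= x + y + t.
    by move=> x0 y0 t0; split; lra.
  have Mk k : nc (smoothing (dz k K) z) <= Mw /\ nc (smoothing (dzbar k K) z) <= Mw.
    rewrite /Mw (bigD1 k) //; set S := \sum_(i | _) _.
    have S0 : 0 <= S by apply: sumr_ge0 => i _; rewrite addr_ge0 ?nc_ge0.
    have h1 := nc_ge0 (smoothing (dz k K) z); have h2 := nc_ge0 (smoothing (dzbar k K) z).
    exact: le3.
  have Mw0 : 0 <= Mw by apply: sumr_ge0 => i _; rewrite addr_ge0 ?nc_ge0.
  exists (2 * Mw) => [|w]; first by rewrite mulr_ge0.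
  by apply: nc_wform => k; rewrite ncN; [exact: (Mk k).1|exact: (Mk k).2].
move=> e e0; have p : 0 < Q + 1 by rewrite ltr_wpDl.
have e2 : 0 < e / (Q + 1) by rewrite !divr_gt0.
have [d d0 hd] := uniform_differentiability hK (small_kernel_supported sK) e2.
have /nbhsVP [d' d'0 hd'] : nbhs z U by apply: open_nbhs_nbhs.
exists (Num.min d d') => [|v]; first by rewrite lt_min d0.
rewrite lt_min => /andP [v1 v2].
have Uzv : U (z + v) by apply: hd'; rewrite (addrC z) addrK.
have ck : continuous K by move=> x; exact: wclass_continuous hK I.
have cz k : continuous (dz k K) by move=> x; exact: wclass_continuous (wclass_dz k hK) I.
have czb k : continuous (dzbar k K) by move=> x; exact: wclass_continuous (wclass_dzbar k hK) I.
have c1 := cK ck sK Uzv; have c2 := cK ck sK Uz.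
have c3 k := cK (cz k) (small_kernel_d k sK).1 Uz.
have c4 k := cK (czb k) (small_kernel_d k sK).2 Uz.
pose F k w := v 0 k * (f w * dz k K (w - z)) + (v 0 k)^*%C * (f w * dzbar k K (w - z)).
have cF k : continuous (F k).
  exact: (@continuousVD _ _ _ _ (@continuousVZ _ _ (v 0 k) _ (c3 k)) (@continuousVZ _ _ (v 0 k)^*%C _ (c4 k))).
have [sF csF] := iC_sum (index_enum 'I_n) B0 cF.
pose g w := K (w - z + - v) - K (w - z)
   - wform (fun k => dz k K (w - z)) (fun k => dzbar k K (w - z)) (- v).
have cN2 := @continuousVZ _ _ (-1) _ c2.
have cD2 := @continuousVD _ _ _ _ c1 cN2.
have gE : (fun w => f w * g w) = (fun w => f w * K (w - (z + v)) + -1 * (f w * K (w - z)) + \sum_k F k w).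
  apply/funext => w; rewrite /g opprD addrA !mulrBr mulN1r; congr (_ + _).
  rewrite /wform -mulrN -sumrN mulr_sumr; apply: eq_bigr => k _; rewrite /F !mxE conjcN.
  move: (f w) (dz k K (w - z)) (dzbar k K (w - z)) (v 0 k) => x1 x2 x3 x4.
  by move: (x4^*%C) => x5; ring.
have -> : smoothing K (z + v) - smoothing K z -
   wform (fun k => - smoothing (dz k K) z) (fun k => - smoothing (dzbar k K) z) v
   = iC B (fun w => f w * g w).
  rewrite gE (iCD B0 cD2 csF) (iCD B0 c1 cN2) (iCZ B0 _ c2) mulN1r; congr (_ + _).
  rewrite sF /wform -sumrN; apply: eq_bigr => k _.
  rewrite /F (iCD B0 (@continuousVZ _ _ (v 0 k) _ (c3 k)) (@continuousVZ _ _ (v 0 k)^*%C _ (c4 k))).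
  rewrite (iCZ B0 _ (c3 k)) (iCZ B0 _ (c4 k)) -/(smoothing (dz k K) z) -/(smoothing (dzbar k K) z).
  move: (smoothing (dz k K) z) (smoothing (dzbar k K) z) (v 0 k) => x1 x2 x4.
  by move: (x4^*%C) => x5; ring.
apply: le_trans (smoothing_bound (g := g) (e := e / (Q + 1) * nv v) _ _ _ _) _.
- by rewrite mulr_ge0 ?nv_ge0 // ltW.
- rewrite gE; exact: (@continuousVD _ _ _ _ cD2 csF).
- move=> w hw; rewrite /g (_ : w - z - v = w - (z + v)); last by rewrite opprD addrA.
  rewrite (cutK sK Uzv hw) (cutK sK Uz hw).
  rewrite subrr sub0r /wform big1 ?oppr0 // => k _.
  rewrite (cutK (small_kernel_d k sK).1 Uz hw) (cutK (small_kernel_d k sK).2 Uz hw).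
  by rewrite !mul0r addr0.
- by move=> w; rewrite /g -(nvN v); apply: hd; rewrite nvN.
rewrite mulrA; apply: ler_wpM2r; first exact: nv_ge0.
by rewrite mulrC; exact: ratio_le (ltW e0) Q0.
Qed.

Lemma wclass_smoothing k K : wclass k setT K -> small_kernel K -> wclass k U (smoothing K).
Proof.
elim: k K => [|k IH] K hK sK.
  split=> [z Uz|]; last exact: I.
  by apply: continuous_smoothing sK Uz => x; exact: wclass_continuous hK I.
have hK1 : wclass 1 setT K by exact: wclass_le hK.
split=> [z|].
  by apply: continuous_smoothing => // x; exact: wclass_continuous hK I.
split=> [z Uz|j]; first exact: wirt_wdiff (wirt_smoothing hK1 sK Uz).
split.
  apply: (wclass_eq oU (fun z Uz => esym (wirt_dz j (wirt_smoothing hK1 sK Uz)))).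
  apply: (wclassN oU); apply: IH; [exact: wclass_dz hK|exact: (small_kernel_d j sK).1].
apply: (wclass_eq oU (fun z Uz => esym (wirt_dzbar j (wirt_smoothing hK1 sK Uz)))).
apply: (wclassN oU); apply: IH; [exact: wclass_dzbar hK|exact: (small_kernel_d j sK).2].
Qed.

End Smoothing.

(** By the mean value property [f] is the quotient of the smoothings of [f] and of [1] by a bump,
    and a smoothing is as regular as its kernel. *)
Lemma goursat f z0 (R0 M : R) (a : V -> 'I_n -> C) : 0 < R0 -> (0 < n)%N ->
  (forall w, nv (w - z0) < R0 -> wirt f w (a w) (fun=> 0)) ->
  (forall w k, nv (w - z0) < R0 -> nc (a w k) <= M) ->
  wclass 2 [set w | nv (w - z0) < R0 / 4] f.
Proof.
move=> R00 n0 hf ha; set U := [set w | _].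
pose r := R0 / (4 * n%:R).
have n0R : 0 < n%:R :> R by rewrite ltr0n.
have r0 : 0 < r by rewrite divr_gt0 // mulr_gt0.
have rn : n%:R * r = R0 / 4 by rewrite /r; field; exact: lt0r_neq0.
have r2 : 0 < r ^+ 2 by rewrite exprn_gt0.
have tr : 0 < r ^+ 2 / 2 < r ^+ 2 by apply/andP; split; lra.
pose K := bump 3 (r ^+ 2 / 2) (0 : V).
have hK : wclass 2 setT K by exact: wclass_bump.
have sK : small_kernel R0 K.
  move=> v hv; apply: (@bump_eq0 _ _ _ _ r) => //; first exact: ltW.
    by case/andP: tr => _ /ltW.
  by rewrite subr0 rn ltW.
have oU : open U.
  rewrite openE => z Uz; apply/nbhsVP; exists (R0 / 4 - nv (z - z0)); first by rewrite subr_gt0.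
  move=> w hw; have := nvD (w - z) (z - z0); rewrite addrA subrK /U /=; lra.
have mE g z : moment g z0 R0 3 (r ^+ 2 / 2) z = smoothing g z0 R0 K z.
  by apply: eq_iC => w; rewrite /K !bumpE subr0.
have h1 w : nv (w - z0) < R0 -> wirt (fun _ : V => 1) w (fun=> 0) (fun=> 0).
  by move=> _; exact: wirt_cst.
have hb1 (w : V) (k : 'I_n) : nv (w - z0) < R0 -> nc (0 : C) <= 0 by rewrite nc0.
have c0 z : U z -> smoothing (fun=> 1) z0 R0 K z != 0.
  move=> Uz; rewrite -mE gt_eqF //; apply: (mass_gt0 R00 _ Uz); exact: (proj1 (andP tr)).
have w1 := wclass_smoothing R00 n0 hf ha hK sK.
have w2 := wclass_smoothing R00 n0 h1 hb1 hK sK.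
apply: (wclass_eq oU _ (wclassM oU w1 (wclassV oU c0 w2))) => z Uz.
by rewrite -mE (mean_value_property R00 n0 hf ha Uz tr) mE mulfK ?c0.
Qed.

End Regularity.

(** * Matrices of functions *)

Fact sealing_key : unit.
Proof. by []. Qed.

Section DetPerturbation.
Context {K : comNzRingType} {m : nat}.
Implicit Types (A L : 'M[K]_m).

(** Once the sums are exchanged, the [i]-th term is the determinant of [A] with its [i]-th row replaced
    by that of [L], to be expanded along this row. *)
Lemma leibniz_variation A L :
  \sum_(s : {perm 'I_m}) (-1) ^+ s * (\sum_i L i (s i) * \prod_(j | j != i) A j (s j)) =
  \tr (\adj A *m L).
Proof.
pose X i : 'M[K]_m := \matrix_(k, j) if k == i then L k j else A k j.
under eq_bigr do rewrite mulr_sumr.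
rewrite exchange_big mxtrace_mulC; apply: eq_bigr => i _; rewrite mxE.
transitivity (\det (X i)).
  apply: eq_bigr => s _; congr (_ * _); rewrite [RHS](bigD1 i) //; congr (_ * _).
    by rewrite mxE eqxx.
  by apply: eq_bigr => j ji; rewrite mxE (negPf ji).
rewrite (expand_det_row _ i); apply: eq_bigr => j _; rewrite !mxE eqxx; congr (_ * _).
rewrite /cofactor; congr (_ * \det _); apply/matrixP => k l.
by rewrite !mxE eq_sym (negPf (neq_lift i k)).
Qed.

End DetPerturbation.

Section MatrixCalculus.
Context {R : realType} {n m : nat}.
Local Notation C := (R[i]).
Local Notation V := ('rV[C]_n).
Implicit Types (f g : V -> C) (A B : V -> 'M[C]_m) (z w : V) (U : set V) (b : bool) (j : 'I_n).

(** [pd false] and [pd true] are the two Wirtinger derivatives. *)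
Definition pd b j f z : C := if b then dzbar j f z else dz j f z.
(** Locked, since comparing matrix entries up to conversion would otherwise unfold the partial
    derivatives in them. *)
Definition Dm : bool -> 'I_n -> (V -> 'M[C]_m) -> V -> 'M[C]_m :=
  locked_with sealing_key (fun b j A z => \matrix_(p, q) pd b j (fun w => A w p q) z).

Lemma DmE b j A z p q : Dm b j A z p q = pd b j (fun w => A w p q) z.
Proof. by rewrite /Dm unlock mxE. Qed.

Definition mdiff A z := forall p q, wdiff (fun w => A w p q) z.
Definition mclass k U A := forall p q, wclass k U (fun w => A w p q).

Lemma pdD b j f g z : wdiff f z -> wdiff g z ->
  pd b j (fun w => f w + g w) z = pd b j f z + pd b j g z.
Proof. by case: b => hf hg; [exact: dzbarD|exact: dzD]. Qed.

Lemma pdM b j f g z : wdiff f z -> wdiff g z ->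
  pd b j (fun w => f w * g w) z = pd b j f z * g z + f z * pd b j g z.
Proof. by case: b => hf hg; [exact: dzbarM|exact: dzM]. Qed.

Lemma pd_cst b j (c : C) z : pd b j (fun=> c) z = 0.
Proof. by case: b; [exact: dzbar_cst|exact: dz_cst]. Qed.

Lemma pdZ b j (c : C) f z : wdiff f z -> pd b j (fun w => c * f w) z = c * pd b j f z.
Proof. by move=> hf; rewrite (pdM b j (wdiff_cst c z) hf) pd_cst mul0r add0r. Qed.

Lemma pd_sum b j I (r : seq I) (P : pred I) (F : I -> V -> C) z :
  (forall i, P i -> wdiff (F i) z) ->
  pd b j (fun w => \sum_(i <- r | P i) F i w) z = \sum_(i <- r | P i) pd b j (F i) z.
Proof. by case: b => h; [exact: dzbar_sum|exact: dz_sum]. Qed.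

Lemma near_eq_pd b j f g z : (\forall w \near z, f w = g w) -> wdiff f z ->
  pd b j f z = pd b j g z.
Proof. by case: b => fg hf; [exact: near_eq_dzbar|exact: near_eq_dz]. Qed.

Lemma pd_conj b j f z : wdiff f z -> pd b j (fun w => (f w)^*%C) z = (pd (~~ b) j f z)^*%C.
Proof. by case: b => hf; [exact: dzbar_conj|exact: dz_conj]. Qed.

Lemma wclass_pd b j k U f : wclass k.+1 U f -> wclass k U (pd b j f).
Proof. by case: b => h; [exact: wclass_dzbar|exact: wclass_dz]. Qed.

Lemma wirt_pd f z a c b j : wirt f z a c -> pd b j f z = if b then c j else a j.
Proof. by case: b => h; [exact: wirt_dzbar h|exact: wirt_dz h]. Qed.

Lemma DmM b j A B z : mdiff A z -> mdiff B z ->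
  Dm b j (fun w => A w *m B w) z = Dm b j A z *m B z + A z *m Dm b j B z.
Proof.
move=> hA hB; apply/matrixP => p q; rewrite DmE [RHS]mxE [X in _ = X + _]mxE [X in _ = _ + X]mxE -big_split.
under [fun w => _]eq_fun do rewrite mxE.
rewrite pd_sum => [|i _]; last exact: wdiffM.
by apply: eq_bigr => i _; rewrite pdM // !DmE.
Qed.

Lemma has_diff_det (X : zmodType) (N : X -> R) (F : X -> 'M[C]_m) (x : X) (L : X -> 'M[C]_m) :
  is_norm N -> (forall p q, has_diff N nc (fun y : X => F y p q) x (fun v : X => L v p q)) ->
  has_diff N nc (fun y : X => \det (F y)) x (fun v : X => \tr (\adj (F x) *m L v)).
Proof.
move=> hN h.
have hp (s : {perm 'I_m}) := has_diffZ hN ((-1) ^+ s) (has_diff_prod hN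
  (index_enum_uniq 'I_m) (fun i => h i (s i))).
have := has_diff_sum hN (index_enum {perm 'I_m}) (P := xpredT) (fun s _ => hp s).
by apply: has_diff_eqL => w; rewrite -leibniz_variation.
Qed.

Lemma wirt_det A z : mdiff A z -> wirt (fun w => \det (A w)) z
  (fun j => \tr (\adj (A z) *m Dm false j A z)) (fun j => \tr (\adj (A z) *m Dm true j A z)).
Proof.
move=> hA; pose L w : 'M[C]_m :=
  \matrix_(p, q) wform (fun j => dz j (fun w => A w p q) z) (fun j => dzbar j (fun w => A w p q) z) w.
have hL p q : has_diff (@nv R n) nc (fun w => A w p q) z (fun w => L w p q).
  by apply: has_diff_eqL (hA p q) => w; rewrite mxE.
apply: has_diff_eqL (has_diff_det (@is_norm_nv R n) hL) => w.
have -> : L w = \sum_j (w 0 j *: Dm false j A z + (w 0 j)^*%C *: Dm true j A z).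
  apply/matrixP => p q; rewrite mxE summxE; apply: eq_bigr => j _.
  by rewrite !mxE !DmE mulrC [X in _ + X]mulrC.
rewrite mulmx_sumr raddf_sum; apply: eq_bigr => j _ /=.
by rewrite mulmxDr mxtraceD -!scalemxAr !mxtraceZ mulrC [X in _ + X]mulrC.
Qed.

Lemma pd_det b j A z : mdiff A z -> pd b j (fun w => \det (A w)) z = \tr (\adj (A z) *m Dm b j A z).
Proof. by move=> /wirt_det h; rewrite (wirt_pd b j h); case: b. Qed.

Section Closure.
Variable (U : set V).
Hypothesis oU : open U.

Lemma mclass_mdiff k A z : mclass k.+1 U A -> U z -> mdiff A z.
Proof. by move=> hA Uz p q; exact: wclass_wdiff (hA p q) Uz. Qed.

Lemma mclass_Dm b j k A : mclass k.+1 U A -> mclass k U (Dm b j A).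
Proof.
move=> hA p q; apply: (wclass_eq oU _ (wclass_pd b j (hA p q))) => z _.
by rewrite DmE.
Qed.

Lemma mclassM k A B : mclass k U A -> mclass k U B -> mclass k U (fun w => A w *m B w).
Proof.
move=> hA hB p q; have := wclass_sum oU (k := k) (index_enum 'I_m) (P := xpredT)
  (fun i _ => wclassM oU (hA p i) (hB i q)).
by apply: wclass_eq => // z _; rewrite mxE.
Qed.

Lemma mclass_tr k A : mclass k U A -> wclass k U (fun w => \tr (A w)).
Proof. by move=> hA; apply: (wclass_sum oU) => i _; exact: hA. Qed.

End Closure.
End MatrixCalculus.

Section Inverse.
Context {R : realType} {n : nat}.
Local Notation C := (R[i]).
Local Notation V := ('rV[C]_n).
Variables (U : set V).
Hypothesis oU : open U.

Lemma wclass_det m k (A : V -> 'M[C]_m) : mclass k U A -> wclass k U (fun w => \det (A w)).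
Proof.
move=> hA; apply: (wclass_sum oU) => s _; apply: (wclassZ oU).
by apply: (wclass_prod oU) => i _; exact: hA.
Qed.

Lemma mclass_adj m k (A : V -> 'M[C]_m) : mclass k U A -> mclass k U (fun w => \adj (A w)).
Proof.
move=> hA p q; have h : mclass k U (fun w => row' q (col' p (A w))).
  by move=> i j; apply: (wclass_eq oU _ (hA (lift q i) (lift p j))) => z _; rewrite !mxE.
apply: (wclass_eq oU _ (wclassZ oU ((-1) ^+ (q + p)) (wclass_det h))) => z _.
by rewrite mxE.
Qed.

Variables (m : nat) (A : V -> 'M[C]_m).
Hypothesis uA : forall z, U z -> A z \in unitmx.

Lemma mclass_inv k : mclass k U A -> mclass k U (fun w => invmx (A w)).
Proof.
move=> hA p q.
have d0 z : U z -> \det (A z) != 0 by move=> /uA; rewrite unitmxE unitfE.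
apply: (wclass_eq oU _ (wclassM oU (wclassV oU d0 (wclass_det hA)) (mclass_adj hA p q))) => z Uz.
by rewrite /invmx (uA Uz) [RHS]mxE.
Qed.

Lemma Dm_inv b j z : mclass 1 U A -> U z ->
  Dm b j (fun w => invmx (A w)) z = - (invmx (A z) *m Dm b j A z *m invmx (A z)).
Proof.
move=> hA Uz; have hAz := mclass_mdiff hA Uz; have hI := mclass_mdiff (mclass_inv hA) Uz.
have E : Dm b j (fun w => A w *m invmx (A w)) z = 0.
  apply/matrixP => p q; rewrite DmE mxE.
  rewrite -[RHS](pd_cst b j ((1%:M : 'M[C]_m) p q) z); apply/esym/near_eq_pd; last exact: wdiff_cst.
  apply: (open_near_eq oU Uz) => w Uw; rewrite mulmxV //; exact: uA.
move: E; rewrite DmM // => /(congr1 (mulmx (invmx (A z)))).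
rewrite mulmx0 mulmxDr !mulmxA mulVmx ?uA // mul1mx => /eqP.
by rewrite addrC addr_eq0 => /eqP.
Qed.

Lemma pd_det_unit b j z : mclass 1 U A -> U z ->
  pd b j (fun w => \det (A w)) z = \det (A z) * \tr (invmx (A z) *m Dm b j A z).
Proof.
move=> hA Uz; rewrite pd_det; last exact: mclass_mdiff hA Uz.
rewrite -mxtraceZ scalemxAl; congr (\tr (_ *m _)).
rewrite /invmx uA // scalerA mulfV ?scale1r //.
by have := uA Uz; rewrite unitmxE unitfE.
Qed.

End Inverse.

(** * Extension by zero *)

Section Extension.
Context {R : realType} {n : nat}.
Local Notation C := (R[i]).
Local Notation V := ('rV[C]_n).
Implicit Types (f g : V -> C) (z w : V) (U K : set V).

Lemma wclass_union k U U' f : wclass k U f -> wclass k U' f -> wclass k (U `|` U') f.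
Proof.
elim: k f => [|k IH] f; first by move=> [h _] [h' _]; split=> // z [/h|/h'].
move=> [h [hd hk]] [h' [hd' hk']]; split=> [z [/h|/h']//|]; split=> [z [/hd|/hd']//|j].
by split; apply: IH; [exact: (hk j).1|exact: (hk' j).1|exact: (hk j).2|exact: (hk' j).2].
Qed.

Definition ext U g z : C := if `[< U z >] then g z else 0.

Lemma ext_in U g z : U z -> ext U g z = g z.
Proof. by move=> Uz; rewrite /ext ifT //; apply/asboolP. Qed.

Lemma ext_out U g z : ~ U z -> ext U g z = 0.
Proof. by move=> Uz; rewrite /ext ifF //; apply/asboolP. Qed.

Variables (U K : set V).
Hypotheses (oU : open U) (cK : closed K) (KU : K `<=` U).

Lemma ext_off g z : (forall z, U z -> ~ K z -> g z = 0) -> ~ K z -> ext U g z = 0.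
Proof.
move=> h nK; have [Uz|Uz] := pselect (U z); last exact: ext_out.
by rewrite ext_in ?h.
Qed.

(** [U] and the complement of [K] cover the space, and the extension vanishes on the latter. *)
Lemma wclass_ext k g : (forall z, U z -> ~ K z -> g z = 0) -> wclass k U g ->
  wclass k setT (ext U g).
Proof.
move=> g0 hg; have oK : open (~` K) by exact: closed_openC.
have h1 : wclass k U (ext U g) by apply: (wclass_eq oU _ hg) => z Uz; rewrite ext_in.
have h2 : wclass k (~` K) (ext U g).
  by apply: (wclass_eq oK _ (wclass_cst _ k 0)) => z Kz; rewrite ext_off.
apply: wclass_sub (wclass_union h1 h2) => z _.
by have [Kz|Kz] := pselect (K z); [left; exact: KU|right].
Qed.

Lemma pd_ext b j g z : (forall z, U z -> ~ K z -> g z = 0) -> wclass 1 U g ->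
  pd b j (ext U g) z = ext U (pd b j g) z.
Proof.
move=> g0 hg; have hw := wclass_wdiff (wclass_ext g0 hg) (I : setT z).
have [Uz|Uz] := pselect (U z).
  rewrite ext_in //; apply: near_eq_pd => //; apply: (open_near_eq oU Uz) => w Uw.
  exact: ext_in.
rewrite ext_out // -[RHS](pd_cst b j (0 : C) z); apply: near_eq_pd => //.
have nK : (~` K) z by move=> /KU.
apply: (open_near_eq (closed_openC cK) nK) => w; exact: ext_off.
Qed.

End Extension.

(** * First order expansions that are uniform in the space variable *)

Section UniformExpansion.
Context {R : realType} {X : Type}.
Local Notation C := (R[i]).
Variable K : set X.
Implicit Types (f g : C -> X -> C) (l m : X -> C).

(** A first order expansion in a complex parameter at [0] that is uniform in [x], together with
    bounds on its coefficients: what differentiation under the integral sign needs, in a form that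
    passes to products and determinants. *)
Definition uexp f l (l' : X -> C) : Prop :=
  (exists2 M : R, 0 <= M & forall x, K x -> [/\ nc (f 0 x) <= M, nc (l x) <= M & nc (l' x) <= M]) /\
  forall e : R, 0 < e -> exists2 d : R, 0 < d & forall zeta x, nc zeta < d -> K x ->
    nc (f zeta x - f 0 x - (zeta * l x + zeta^*%C * l' x)) <= e * nc zeta.

Lemma eq_uexp f g l l' m m' : (forall zeta x, K x -> f zeta x = g zeta x) ->
  (forall x, K x -> l x = m x) -> (forall x, K x -> l' x = m' x) -> uexp f l l' -> uexp g m m'.
Proof.
move=> fg lm lm' [[M M0 hM] h]; split.
  by exists M => // x Kx; rewrite -fg -?lm -?lm' //; exact: hM.
by move=> e /h [d d0 hd]; exists d => // zeta x hz Kx; rewrite -!fg -?lm -?lm' //; exact: hd.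
Qed.

Lemma uexp_affine (a b : X -> C) (M : R) : (forall x, K x -> nc (a x) <= M) ->
  (forall x, K x -> nc (b x) <= M) -> uexp (fun zeta x => a x + zeta * b x) b (fun=> 0).
Proof.
move=> ha hb; split.
  exists `|M| => // x Kx; have := ler_norm M; have := ha x Kx; have := hb x Kx.
  by rewrite nc0 mul0r addr0 normr_ge0 => *; split=> //; lra.
move=> e e0; exists 1 => // zeta x _ _.
rewrite mul0r addr0 mulr0 addr0 (addrC (a x)) addrK subrr nc0 mulr_ge0 ?nc_ge0 //; exact: ltW.
Qed.

Lemma uexp_conj f l l' : uexp f l l' ->
  uexp (fun zeta x => (f zeta x)^*%C) (fun x => (l' x)^*%C) (fun x => (l x)^*%C).
Proof.
move=> [[M M0 hM] h]; split.
  by exists M => // x /hM []; rewrite !nc_conj.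
move=> e /h [d d0 hd]; exists d => // zeta x hz Kx.
have := hd zeta x hz Kx; rewrite -[in X in X -> _]nc_conj.
congr (nc _ <= _); rewrite !conjcB conjcD !conjcM conjcK; congr (_ - _); exact: addrC.
Qed.

Lemma uexpD f g l l' m m' : uexp f l l' -> uexp g m m' ->
  uexp (fun zeta x => f zeta x + g zeta x) (fun x => l x + m x) (fun x => l' x + m' x).
Proof.
move=> [[M M0 hM] h] [[N N0 hN] k]; split.
  exists (M + N); first exact: addr_ge0.
  move=> x Kx; have [h1 h2 h3] := hM x Kx; have [k1 k2 k3] := hN x Kx.
  by split; apply: le_trans (ncD _ _) _; exact: lerD.
move=> e e0; have e20 : 0 < e / 2 by rewrite divr_gt0.
have [d d0 hd] := h _ e20; have [d' d'0 hd'] := k _ e20.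
exists (Num.min d d') => [|zeta x]; first by rewrite lt_min d0.
rewrite lt_min => /andP [h1 h2] Kx.
have -> : f zeta x + g zeta x - (f 0 x + g 0 x) - (zeta * (l x + m x) + zeta^*%C * (l' x + m' x)) =
  (f zeta x - f 0 x - (zeta * l x + zeta^*%C * l' x)) +
  (g zeta x - g 0 x - (zeta * m x + zeta^*%C * m' x)).
  move: (f zeta x) (f 0 x) (g zeta x) (g 0 x) (l x) (l' x) (m x) (m' x) zeta^*%C => *; ring.
apply: le_trans (ncD _ _) _.
have := hd _ _ h1 Kx; have := hd' _ _ h2 Kx; lra.
Qed.

Fact product_estimate (M e t rf rg : R) : 0 <= M -> 0 < e -> 0 <= t -> t <= 1 ->
  t * (8 * M * M + 4 * M + 1) <= e ->
  0 <= rf -> rf * (8 * M + 2) <= e * t -> 0 <= rg -> rg * (8 * M + 2) <= e * t -> rg <= t ->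
  rf * (M + 2 * M * t + rg) + M * rg + 2 * M * t * (2 * M * t + rg) <= e * t.
Proof.
move=> M0 e0 t0 t1 ht rf0 hrf rg0 hrg rgt.
have a1 : rf * (M + 2 * M * t + rg) <= rf * (3 * M + 1).
  by apply: ler_wpM2l => //; nra.
have a2 : 2 * M * t * (2 * M * t + rg) <= 2 * M * t * (2 * M * t + t).
  by apply: ler_wpM2l; [rewrite !mulr_ge0|lra].
have a3 : t * t * (8 * M * M + 4 * M + 1) <= e * t by nra.
have a4 : 0 <= rf * M by rewrite mulr_ge0.
have a5 : 0 <= t * t by rewrite mulr_ge0.
nra.
Qed.

Lemma uexpM f g l l' m m' : uexp f l l' -> uexp g m m' ->
  uexp (fun zeta x => f zeta x * g zeta x) (fun x => l x * g 0 x + f 0 x * m x)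
    (fun x => l' x * g 0 x + f 0 x * m' x).
Proof.
move=> [[M1 M10 hM1] h] [[M2 M20 hM2] k].
pose M := M1 + M2; have M0 : 0 <= M by exact: addr_ge0.
have hM x : K x -> [/\ nc (f 0 x) <= M, nc (l x) <= M & nc (l' x) <= M].
  by move=> /hM1 [a b c]; split; apply: ler_wpDr.
have hN x : K x -> [/\ nc (g 0 x) <= M, nc (m x) <= M & nc (m' x) <= M].
  by move=> /hM2 [a b c]; split; apply: ler_wpDl.
split.
  exists (M * M + M * M); first by rewrite addr_ge0 // mulr_ge0.
  move=> x Kx; have [h1 h2 h3] := hM x Kx; have [k1 k2 k3] := hN x Kx.
  split; first by rewrite ncM ler_wpDr ?mulr_ge0 // ler_pM ?nc_ge0.
    by apply: le_trans (ncD _ _) _; rewrite !ncM lerD // ler_pM ?nc_ge0.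
  by apply: le_trans (ncD _ _) _; rewrite !ncM lerD // ler_pM ?nc_ge0.
move=> e e0; have q0 : 0 < 8 * M + 2 by lra.
have e10 : 0 < e / (8 * M + 2) by rewrite divr_gt0.
have e20 : 0 < Num.min 1 (e / (8 * M + 2)) by rewrite lt_min ltr01.
have p0 : 0 < 8 * M * M + 4 * M + 1 by rewrite ltr_wpDl // addr_ge0 // !mulr_ge0.
have [d d0 hd] := h _ e20; have [d' d'0 hd'] := k _ e20.
exists (Num.min (Num.min 1 (e / (8 * M * M + 4 * M + 1))) (Num.min d d')) => [|zeta x].
  by rewrite !lt_min ltr01 d0 d'0 divr_gt0.
rewrite !lt_min => /andP [/andP [z1 z2] /andP [z3 z4]] Kx.
have [h1 h2 h3] := hM x Kx; have [k1 k2 k3] := hN x Kx.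
set t := nc zeta in z1 z2 z3 z4 *; have t0 : 0 <= t by exact: nc_ge0.
pose L := zeta * l x + zeta^*%C * l' x; pose N := zeta * m x + zeta^*%C * m' x.
pose rf := f zeta x - f 0 x - L; pose rg := g zeta x - g 0 x - N.
have hL : nc L <= 2 * M * t.
  apply: le_trans (ncD _ _) _; rewrite !ncM nc_conj -/t -mulrA [M * t]mulrC.
  have := ler_wpM2l t0 h2; have := ler_wpM2l t0 h3; lra.
have hNN : nc N <= 2 * M * t.
  apply: le_trans (ncD _ _) _; rewrite !ncM nc_conj -/t -mulrA [M * t]mulrC.
  have := ler_wpM2l t0 k2; have := ler_wpM2l t0 k3; lra.
have hmin (y : R) : y <= Num.min 1 (e / (8 * M + 2)) * t -> y * (8 * M + 2) <= e * t /\ y <= t.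
  move=> hy; split; last by apply: le_trans hy _; rewrite ler_piMl // ge_min lexx.
  rewrite -ler_pdivlMr // mulrAC; apply: le_trans hy _.
  by apply: ler_wpM2r => //; rewrite ge_min lexx orbT.
have [f1 f2] := hmin _ (hd zeta x z3 Kx); have [g1 g2] := hmin _ (hd' zeta x z4 Kx).
rewrite -/L -/rf in f1 f2; rewrite -/N -/rg in g1 g2.
have -> : f zeta x * g zeta x - f 0 x * g 0 x -
    (zeta * (l x * g 0 x + f 0 x * m x) + zeta^*%C * (l' x * g 0 x + f 0 x * m' x)) =
   rf * (g 0 x + N + rg) + f 0 x * rg + L * (N + rg).
  rewrite /rf /rg /L /N.
  move: (f zeta x) (f 0 x) (g zeta x) (g 0 x) (l x) (l' x) (m x) (m' x) zeta^*%C => *; ring.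
have z2' : t * (8 * M * M + 4 * M + 1) <= e by rewrite -ler_pdivlMr // ltW.
have := product_estimate M0 e0 t0 (ltW z1) z2' (nc_ge0 rf) f1 (nc_ge0 rg) g1 g2.
apply: le_trans.
apply: le_trans (ncD _ _) _; apply: lerD; last first.
  rewrite (ncM L); apply: ler_pM; rewrite ?nc_ge0 //.
  by apply: le_trans (ncD _ _) _; rewrite lerD2r.
apply: le_trans (ncD _ _) _; apply: lerD; last by rewrite (ncM (f 0 x)) ler_wpM2r ?nc_ge0.
rewrite (ncM rf); apply: ler_wpM2l; rewrite ?nc_ge0 //.
by apply: le_trans (ncD _ _) _; rewrite lerD2r; apply: le_trans (ncD _ _) _; rewrite lerD.
Qed.

Lemma uexp_cst (c : C) : uexp (fun _ _ => c) (fun=> 0) (fun=> 0).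
Proof.
split; first by exists (nc c) => [|x _]; rewrite ?nc0 ?nc_ge0.
move=> e e0; exists 1 => // zeta x _ _.
by rewrite subrr !mulr0 addr0 subrr nc0 mulr_ge0 ?nc_ge0 ?ltW.
Qed.

Lemma uexp_sum I (r : seq I) (F : I -> C -> X -> C) (l l' : I -> X -> C) :
  (forall i, uexp (F i) (l i) (l' i)) -> uexp (fun zeta x => \sum_(i <- r) F i zeta x)
    (fun x => \sum_(i <- r) l i x) (fun x => \sum_(i <- r) l' i x).
Proof.
move=> h; elim: r => [|i r IH].
  by apply: eq_uexp (uexp_cst 0) => *; rewrite big_nil.
by apply: eq_uexp (uexpD (h i) IH) => *; rewrite big_cons.
Qed.

Lemma uexp_prod (I : eqType) (r : seq I) (F : I -> C -> X -> C) (l : I -> X -> C) :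
  uniq r -> (forall i, uexp (F i) (l i) (fun=> 0)) ->
  uexp (fun zeta x => \prod_(i <- r) F i zeta x)
    (fun x => \sum_(i <- r) l i x * \prod_(j <- r | j != i) F j 0 x) (fun=> 0).
Proof.
move=> + h; elim: r => [|i r IH] /=.
  by move=> _; apply: eq_uexp (uexp_cst 1) => *; rewrite ?big_nil.
move=> /andP [ir /IH {}IH]; apply: eq_uexp (uexpM (h i) IH) => [*|x _|x _].
- by rewrite big_cons.
- rewrite !big_cons eqxx /=; congr (_ * _ + _).
    rewrite big_seq [RHS]big_seq_cond; apply: eq_bigl => j.
    by case jr: (j \in r) => //=; apply/esym; apply: contraNneq ir => <-.
  rewrite mulr_sumr [LHS]big_seq [RHS]big_seq; apply: eq_bigr => j jr.
  by rewrite big_cons ifT 1?mulrCA //; apply: contraNneq ir => ->.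
- by rewrite mul0r mulr0 addr0.
Qed.

Lemma uexp_det (d : nat) (A B : X -> 'M[C]_d) (M : R) :
  (forall x p q, K x -> nc (A x p q) <= M) -> (forall x p q, K x -> nc (B x p q) <= M) ->
  uexp (fun zeta x => \det (A x + zeta *: B x)) (fun x => \tr (\adj (A x) *m B x)) (fun=> 0).
Proof.
move=> hA hB.
have ha (p q : 'I_d) := uexp_affine (fun x Kx => hA x p q Kx) (fun x Kx => hB x p q Kx).
have hp (s : {perm 'I_d}) := uexpM (uexp_cst ((-1) ^+ s)) (uexp_prod (index_enum_uniq 'I_d)
   (fun i => ha i (s i))).
apply: eq_uexp (uexp_sum (index_enum {perm 'I_d}) hp) => [zeta x _|x _|x _].
- apply: eq_bigr => s _; congr (_ * _); apply: eq_bigr => i _; by rewrite !mxE.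
- rewrite -leibniz_variation; apply: eq_bigr => s _; rewrite mul0r add0r; congr (_ * _).
  by apply: eq_bigr => i _; congr (_ * _); apply: eq_bigr => j _; rewrite mul0r addr0.
- by rewrite big1 // => s _; rewrite mul0r mulr0 addr0.
Qed.

End UniformExpansion.

(** * Change of variables by isotopy *)

Section Holomorphic.
Context {R : realType} {n : nat}.
Local Notation C := (R[i]).
Local Notation V := ('rV[C]_n).
Implicit Types (F f g : V -> C) (T W : V -> V) (z w p : V) (zeta : C).

(** The transpose of the usual Jacobian matrix, because vectors are rows. *)
Definition Jm : (V -> V) -> V -> 'M[C]_n :=
  locked_with sealing_key (fun T z => \matrix_(i, q) dz i (fun w => T w 0 q) z).

Definition holo (U : set V) T := (forall q, wclass 2 U (fun w => T w 0 q)) /\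
  forall z j q, U z -> dzbar j (fun w => T w 0 q) z = 0.

(** The pull back by [T] of the density [F] against Lebesgue measure: the real Jacobian determinant
    of a holomorphic map is the squared modulus of the complex one. *)
Definition pull F T z : C := F (T z) * (\det (Jm T z) * (\det (Jm T z))^*%C).

Lemma JmE T z i q : Jm T z i q = dz i (fun w => T w 0 q) z.
Proof. by rewrite /Jm unlock mxE. Qed.

Section Rules.
Variable U : set V.
Hypothesis oU : open U.
Variables (T W : V -> V).
Hypotheses (hT : holo U T) (hW : holo U W).

Lemma holo_wirt z q : U z -> wirt (fun w => T w 0 q) z (fun j => Jm T z j q) (fun=> 0).
Proof.
move=> Uz; apply: eq_wirt (wclass_wdiff (hT.1 q) Uz) => j; first by rewrite JmE.
exact: hT.2.
Qed.

Lemma holoDZ zeta : holo U (fun z => T z + zeta *: W z).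
Proof.
have E q : (fun z => T z 0 q + zeta * W z 0 q) = (fun z => (T z + zeta *: W z) 0 q).
  by apply/funext => z; rewrite !mxE.
split=> [q|z j q Uz]; rewrite -E.
  exact: (wclassD oU (hT.1 q) (wclassZ oU zeta (hW.1 q))).
have d1 := wclass_wdiff (hT.1 q) Uz; have d2 := wclass_wdiff (hW.1 q) Uz.
rewrite (dzbarD j d1 (wdiffM (wdiff_cst zeta z) d2)) (hT.2 _ _ _ Uz).
by rewrite -[dzbar _ _ _]/(pd true _ _ _) pdZ // /pd (hW.2 _ _ _ Uz) mulr0 addr0.
Qed.

Lemma Jm_affine zeta z : U z -> Jm (fun z => T z + zeta *: W z) z = Jm T z + zeta *: Jm W z.
Proof.
move=> Uz; apply/matrixP => j q; rewrite JmE [RHS]mxE JmE [X in _ = _ + X]mxE JmE.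
have E : (fun z => T z 0 q + zeta * W z 0 q) = (fun z => (T z + zeta *: W z) 0 q).
  by apply/funext => w; rewrite !mxE.
have d1 := wclass_wdiff (hT.1 q) Uz; have d2 := wclass_wdiff (hW.1 q) Uz.
rewrite -E (dzD j d1 (wdiffM (wdiff_cst zeta z) d2)).
by rewrite -[dz _ (fun w => zeta * _) _]/(pd false _ _ _) pdZ.
Qed.

Lemma mclass_Jm : mclass 1 U (Jm T).
Proof.
move=> j q; apply: (wclass_eq oU _ (wclass_dz j (hT.1 q))) => z _; by rewrite JmE.
Qed.

Lemma dzbar_Jm j z : U z -> Dm true j (Jm T) z = 0.
Proof.
move=> Uz; apply/matrixP => i q; rewrite DmE /pd [RHS]mxE.
have -> : (fun w => Jm T w i q) = dz i (fun w => T w 0 q) by apply/funext => w; rewrite JmE.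
rewrite -(dz_dzbarC oU (hT.1 q) Uz i j) -(dz_cst (0 : C) z i).
apply: near_eq_dz; last exact: wclass_wdiff (wclass_dzbar j (hT.1 q)) Uz.
by apply: (open_near_eq oU Uz) => w Uw; rewrite hT.2.
Qed.

Lemma dz_Jm_sym i k q z : U z -> Dm false i (Jm T) z k q = Dm false k (Jm T) z i q.
Proof.
move=> Uz; rewrite (DmE false i (Jm T) z k q) (DmE false k (Jm T) z i q) /pd.
have E l : (fun w => Jm T w l q) = dz l (fun w => T w 0 q) by apply/funext => w; rewrite JmE.
by rewrite !E (dz_dzC oU (hT.1 q) Uz).
Qed.

Hypothesis uJ : forall z, U z -> Jm T z \in unitmx.

Lemma wclass_solve i : wclass 1 U (fun w => (W w *m invmx (Jm T w)) 0 i).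
Proof.
have hI := mclass_inv oU uJ mclass_Jm.
have := wclass_sum oU (index_enum 'I_n) (P := xpredT)
  (fun q _ => wclassM oU (wclass_pred (hW.1 q)) (hI q i)).
by apply: wclass_eq => // z _; rewrite mxE.
Qed.

(** The Piola identity, by which the rows of the adjugate of a Jacobian matrix are divergence free;
    it rests on the symmetry of the second derivatives of [T]. *)
Lemma piola z : U z ->
  \sum_i dz i (fun w => \det (Jm T w) * (W w *m invmx (Jm T w)) 0 i) z =
  \det (Jm T z) * \tr (invmx (Jm T z) *m Jm W z).
Proof.
move=> Uz; set J := Jm T z; set Ji := invmx J; pose D i := Dm false i (Jm T) z.
have hJ := mclass_Jm; have hI := mclass_inv oU uJ hJ.
have dD : wdiff (fun w => \det (Jm T w)) z by exact: wclass_wdiff (wclass_det oU hJ) Uz.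
have dW q : wdiff (fun w => W w 0 q) z by exact: wclass_wdiff (hW.1 q) Uz.
have dI q i : wdiff (fun w => invmx (Jm T w) q i) z by exact: wclass_wdiff (hI q i) Uz.
have E i : dz i (fun w => \det (Jm T w) * (W w *m invmx (Jm T w)) 0 i) z =
    \det J * (\tr (Ji *m D i) * (W z *m Ji) 0 i + (Jm W z *m Ji) i i
      - (W z *m Ji *m (D i *m Ji)) 0 i).
  have S : (fun w => (W w *m invmx (Jm T w)) 0 i) =
      (fun w => \sum_q W w 0 q * invmx (Jm T w) q i) by apply/funext => w; rewrite mxE.
  rewrite (dzM i dD (wclass_wdiff (wclass_solve i) Uz)).
  rewrite -[dz i (fun w => \det _) z]/(pd false i _ z) (pd_det_unit uJ false i hJ Uz) -/J -/Ji.
  rewrite -/(D i) -mulrA -mulrDr -addrA; congr (_ * (_ + _)).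
  rewrite S (dz_sum _ (P := xpredT) _ (fun q _ => wdiffM (dW q) (dI q i))).
  have -> : (Jm W z *m Ji) i i = \sum_q dz i (fun w => W w 0 q) z * Ji q i.
    by rewrite mxE; apply: eq_bigr => q _; rewrite JmE.
  rewrite mulmxA -(mulmxA (W z)) -(mulmxA (W z)) mxE -sumrB; apply: eq_bigr => q _.
  rewrite (dzM i (dW q) (dI q i)); congr (_ + _); rewrite -mulrN; congr (_ * _).
  have := Dm_inv oU uJ false i hJ Uz => /matrixP /(_ q i).
  by rewrite (DmE false i _ z q i) /pd => ->; rewrite mxE.
under eq_bigr do rewrite E.
rewrite -mulr_sumr; congr (_ * _); rewrite sumrB big_split /=.
have -> : \sum_i (Jm W z *m Ji) i i = \tr (Ji *m Jm W z) by rewrite mxtrace_mulC.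
rewrite addrAC -[RHS]add0r; congr (_ + _); apply/eqP; rewrite subr_eq0; apply/eqP.
set X := W z *m Ji.
transitivity (\sum_k \sum_i X 0 k * (D i *m Ji) k i).
  apply: eq_bigr => k _; rewrite -mulr_sumr mulrC; congr (_ * _).
  rewrite mxtrace_mulC; apply: eq_bigr => i _; rewrite mxE [RHS]mxE; apply: eq_bigr => q _.
  by rewrite /D dz_Jm_sym.
by rewrite exchange_big; apply: eq_bigr => i _; rewrite [RHS]mxE.
Qed.

Lemma wirt_pull_fun F z : U z -> wdiff F (T z) -> wirt (fun w => F (T w)) z
  (fun j => \sum_q dz q F (T z) * Jm T z j q) (fun j => \sum_q dzbar q F (T z) * (Jm T z j q)^*%C).
Proof.
move=> Uz hF; have := wirt_comp (fun q => holo_wirt q Uz) hF.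
apply: eq_wirt => j; apply: eq_bigr => q _; rewrite ?conjc0 ?mulr0 ?addr0 ?add0r //.
Qed.

Lemma wclass_T_comp F : wclass 1 setT F -> wclass 1 U (fun w => F (T w)).
Proof.
move=> hF; apply: (wclass_comp oU (U' := setT) _ (fun q => wclass_pred (hT.1 q)) hF).
by [].
Qed.

(** The flux of the density carried by the velocity [W], in the source coordinates of [T];
    [pull_variation] is its divergence, and also the derivative at [0] of the pull back by
    [T + zeta W] along [zeta]. *)
Definition flux F i z : C :=
  F (T z) * (\det (Jm T z))^*%C * (\det (Jm T z) * (W z *m invmx (Jm T z)) 0 i).

Lemma wclass_flux F i : wclass 1 setT F -> wclass 1 U (flux F i).
Proof.
move=> hF; have hd := wclass_det oU mclass_Jm.
exact: (wclassM oU (wclassM oU (wclass_T_comp hF) (wclass_conj oU hd)) (wclassM oU hd (wclass_solve i))).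
Qed.

Definition pull_variation F z : C :=
  \det (Jm T z) * (\det (Jm T z))^*%C *
  ((\sum_q dz q F (T z) * W z 0 q) + F (T z) * \tr (invmx (Jm T z) *m Jm W z)).

Lemma div_flux F z : wclass 1 setT F -> U z -> \sum_i dz i (flux F i) z = pull_variation F z.
Proof.
move=> hF Uz; have hJ := mclass_Jm; have hd := wclass_det oU hJ.
have dF : wdiff F (T z) by exact: wclass_wdiff hF I.
have h1 := wirt_pull_fun Uz dF.
have h2 := wirt_conj (wirt_det (mclass_mdiff hJ Uz)).
have dbar0 j : \tr (\adj (Jm T z) *m Dm true j (Jm T) z) = 0.
  by rewrite dzbar_Jm // mulmx0 mxtrace0.
have E i : dz i (flux F i) z =
    (\sum_q dz q F (T z) * Jm T z i q) * (\det (Jm T z))^*%C *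
      (\det (Jm T z) * (W z *m invmx (Jm T z)) 0 i) +
    F (T z) * (\det (Jm T z))^*%C *
      dz i (fun w => \det (Jm T w) * (W w *m invmx (Jm T w)) 0 i) z.
  have h3 : wdiff (fun w => \det (Jm T w) * (W w *m invmx (Jm T w)) 0 i) z.
    exact: wclass_wdiff (wclassM oU hd (wclass_solve i)) Uz.
  rewrite /flux (dzM i (wirt_wdiff (wirtM h1 h2)) h3) (wirt_dz i (wirtM h1 h2)).
  by rewrite dbar0 conjc0 mulr0 addr0.
under eq_bigr do rewrite E.
rewrite big_split /= -mulr_sumr piola // /pull_variation mulrDr; congr (_ + _); last first.
  by move: (F _) (\det _) (\tr _) => u d t; move: (d^*%C) => d'; ring.
have -> : \sum_q dz q F (T z) * W z 0 q =
   \sum_i (\sum_q dz q F (T z) * Jm T z i q) * (W z *m invmx (Jm T z)) 0 i.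
  under [RHS]eq_bigr do rewrite mulr_suml.
  rewrite exchange_big; apply: eq_bigr => q _.
  rewrite -{1}[W z]mulmx1 -(mulVmx (uJ Uz)) mulmxA mxE mulr_sumr; apply: eq_bigr => i _.
  by rewrite [X in _ * X]mulrC mulrA.
rewrite mulr_sumr; apply: eq_bigr => i _.
move: (\sum_q _) (\det _) (_ 0 i) => u d t; move: (d^*%C) => d'; ring.
Qed.

End Rules.
End Holomorphic.

Section CompactFamilies.
Context {R : realType} {n : nat}.
Local Notation C := (R[i]).
Local Notation V := ('rV[C]_n).

Lemma compact_family_bounded (I : finType) (K : set V) (f : I -> V -> C) : compact K ->
  (forall i z, K z -> {for z, continuous (f i)}) ->
  exists2 M : R, 0 <= M & forall i z, K z -> nc (f i z) <= M.
Proof.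
move=> cK cf.
have H i : exists M, 0 <= M /\ forall z, K z -> nc (f i z) <= M.
  by have [M M0 hM] := compact_bounded cK (cf i); exists M.
have [M hM] := boolp.choice H.
exists (\sum_i M i) => [|i z Kz]; first by apply: sumr_ge0 => i _; exact: (hM i).1.
apply: le_trans ((hM i).2 z Kz) _; rewrite (bigD1 i) // lerDl; apply: sumr_ge0 => j _.
exact: (hM j).1.
Qed.

Lemma closed_ball_nv (p : V) (s : R) : closed [set z : V | nv (z - p) <= s].
Proof.
rewrite -openC openE => z /= /negP; rewrite -ltNge => hz; apply/nbhsVP.
exists (nv (z - p) - s); first by rewrite subr_gt0.
move=> w hw /=; apply/negP; rewrite -ltNge.
have := nvD (z - w) (w - p); rewrite addrA subrK nvB; lra.
Qed.

Lemma open_ball_nv (p : V) (s : R) : open [set z : V | nv (z - p) < s].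
Proof.
rewrite openE => z /= hz; apply/nbhsVP; exists (s - nv (z - p)); first by rewrite subr_gt0.
move=> w hw /=; have := nvD (w - z) (z - p); rewrite addrA subrK; lra.
Qed.

Lemma compact_ball_nv (p : V) (s : R) : compact [set z : V | nv (z - p) <= s].
Proof.
apply: (subclosed_compact (@closed_ball_nv p s) (@box_compact R n (nv p + s))) => z /= hz i.
have := le_crd i z; have := nvD (z - p) p; rewrite subrK; lra.
Qed.

End CompactFamilies.

Section Isotopy.
Context {R : realType} {n : nat}.
Local Notation C := (R[i]).
Local Notation V := ('rV[C]_n).
Variables (p : V) (s t B : R).
Hypotheses (st : s < t) (s0 : 0 <= s) (hB : nv p + s < B).
Let U := [set z : V | nv (z - p) < t].
Let K := [set z : V | nv (z - p) <= s].
Let oU : open U. Proof. exact: open_ball_nv. Qed.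
Let cK : closed K. Proof. exact: closed_ball_nv. Qed.
Let KU : K `<=` U. Proof. by move=> z /= h; apply: le_lt_trans h st. Qed.
Let B0 : 0 < B. Proof. by apply: le_lt_trans hB; rewrite addr_ge0 ?nv_ge0. Qed.

Variables (F : V -> C) (b : R).
Hypotheses (hF : wclass 1 setT F) (sF : supported b F).

Lemma tr_adj m (A L : 'M[C]_m) : A \in unitmx -> \tr (\adj A *m L) = \det A * \tr (invmx A *m L).
Proof.
move=> uA; rewrite -mxtraceZ scalemxAl; congr (\tr (_ *m _)).
by rewrite /invmx uA scalerA mulfV ?scale1r //; move: uA; rewrite unitmxE unitfE.
Qed.

Lemma wclass_pull T G : holo U T -> wclass 1 setT G -> wclass 1 U (pull G T).
Proof.
move=> hT hG; have hd := wclass_det oU (mclass_Jm oU hT).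
exact: (wclassM oU (wclass_T_comp oU hT hG) (wclassM oU hd (wclass_conj oU hd))).
Qed.

Variables (T W : V -> V).
Hypotheses (hT : holo U T) (hW : holo U W).
Hypothesis uJ : forall z, U z -> Jm T z \in unitmx.

(** The variation of the pulled back density is the divergence of a compactly supported field. *)
Lemma iC_pull_variation G : wclass 1 setT G -> (forall z, U z -> ~ K z -> G (T z) = 0) ->
  [/\ continuous (ext U (pull_variation T W G)), iC B (ext U (pull_variation T W G)) = 0
    & forall z, ~ K z -> ext U (pull_variation T W G) z = 0].
Proof.
move=> hG G0.
have f0 i z : U z -> ~ K z -> flux T W G i z = 0 by move=> Uz Kz; rewrite /flux G0 // !mul0r.
have hf i := wclass_ext oU cK KU (f0 i) (wclass_flux oU hT hW uJ i hG).
have cf i : continuous (dz i (ext U (flux T W G i))).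
  by move=> z; exact: wclass_continuous (wclass_dz i (hf i)) I.
have E : ext U (pull_variation T W G) = fun z => \sum_i dz i (ext U (flux T W G i)) z.
  apply/funext => z.
  have E i : dz i (ext U (flux T W G i)) z = ext U (dz i (flux T W G i)) z.
    exact: (pd_ext oU cK KU false i z (f0 i) (wclass_flux oU hT hW uJ i hG)).
  under eq_bigr do rewrite E.
  have [Uz|Uz] := pselect (U z); last first.
    by rewrite ext_out // big1 // => i _; rewrite ext_out.
  rewrite ext_in // -(div_flux oU hT hW uJ hG Uz); apply: eq_bigr => i _.
  by rewrite ext_in.
have [iE cE] := iC_sum (index_enum 'I_n) B0 cf.
have sf i z : ~ K z -> ext U (flux T W G i) z = 0 by apply: (ext_off (K := K)); exact: f0.
split; first by rewrite E.
  rewrite E iE big1 // => i _.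
  have B'0 : 0 <= (nv p + s + B) / 2.
    by rewrite divr_ge0 // !addr_ge0 ?nv_ge0 // ltW.
  have B'B : (nv p + s + B) / 2 < B by have := hB; lra.
  apply: (iC_dz_dzbar i B'0 B'B (hf i) _).1 => z j hz; apply: sf => hK; have hK' : nv (z - p) <= s := hK.
  have := le_crd j z; have := nvD (z - p) p; rewrite subrK; have := hB; lra.
move=> z nK; rewrite E big1 // => i _.
have := wirt_near _ (wirt_cst (0 : C) z) => /(_ (ext U (flux T W G i))) h.
apply: (wirt_dz i (h _)); apply: (open_near_eq (closed_openC cK) nK) => w Kw.
by rewrite sf.
Qed.

Variables (r : R).
Hypothesis r0 : 0 < r.
Hypothesis van : forall zeta z, nc zeta < r -> U z -> ~ K z -> F (T z + zeta *: W z) = 0.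

Let pullZ zeta := pull F (fun z => T z + zeta *: W z).

Let van0 z : U z -> ~ K z -> F (T z) = 0.
Proof. by move=> Uz Kz; have := van (zeta := 0) _ Uz Kz; rewrite scale0r addr0; apply; rewrite nc0. Qed.

Let conjF z := (F z)^*%C.

(** The coefficient of the conjugate parameter is the conjugate of the variation for the conjugate
    density, so that it is a conjugate divergence. *)
Lemma pullZ_uexp : uexp K pullZ (pull_variation T W F)
  (fun z => (pull_variation T W conjF z)^*%C).
Proof.
have cptK : compact K by exact: compact_ball_nv.
have bnd f : wclass 0 U f -> exists2 M : R, 0 <= M & forall z, K z -> nc (f z) <= M.
  by move=> hf; apply: (compact_bounded cptK) => z /KU Uz; exact: wclass_continuous hf Uz.
have [MW MW0 hMW] : exists2 M : R, 0 <= M & forall q z, K z -> nc (W z 0 q) <= M.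
  by apply: compact_family_bounded => // q z /KU Uz; exact: wclass_continuous (hW.1 q) Uz.
have [M1 M10 hM1] : exists2 M : R, 0 <= M & forall (iq : 'I_n * 'I_n) z, K z -> nc (Jm T z iq.1 iq.2) <= M.
  apply: compact_family_bounded => // iq z /KU Uz; exact: wclass_continuous (mclass_Jm oU hT _ _) Uz.
have [M2 M20 hM2] : exists2 M : R, 0 <= M & forall (iq : 'I_n * 'I_n) z, K z -> nc (Jm W z iq.1 iq.2) <= M.
  apply: compact_family_bounded => // iq z /KU Uz; exact: wclass_continuous (mclass_Jm oU hW _ _) Uz.
have uD : uexp K (fun zeta z => \det (Jm T z + zeta *: Jm W z))
    (fun z => \tr (\adj (Jm T z) *m Jm W z)) (fun=> 0).
  apply: (@uexp_det _ _ _ _ _ _ (M1 + M2)) => z i q Kz.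
    by apply: ler_wpDr => //; exact: (hM1 (i, q)).
  by apply: ler_wpDl => //; exact: (hM2 (i, q)).
have hFT : wclass 0 U (fun z => F (T z)) by exact: wclass_pred (wclass_T_comp oU hT hF).
have hW0 q : wclass 0 U (fun w => W w 0 q) by exact: wclass_le (hW.1 q).
have hT0 q : wclass 0 U (fun w => T w 0 q) by exact: wclass_le (hT.1 q).
have hdT (g : V -> C) : wclass 0 setT g -> wclass 0 U (fun z => g (T z)).
  by move=> hg; apply: (wclass_comp oU (U' := setT) _ hT0 hg).
have hlF : wclass 0 U (fun z => \sum_q dz q F (T z) * W z 0 q).
  apply: (wclass_sum oU) => q _; exact: (wclassM oU (hdT _ (wclass_dz q hF)) (hW0 q)).
have hlF' : wclass 0 U (fun z => \sum_q dzbar q F (T z) * (W z 0 q)^*%C).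
  apply: (wclass_sum oU) => q _.
  exact: (wclassM oU (hdT _ (wclass_dzbar q hF)) (wclass_conj oU (hW0 q))).
have uF : uexp K (fun zeta z => F (T z + zeta *: W z))
    (fun z => \sum_q dz q F (T z) * W z 0 q) (fun z => \sum_q dzbar q F (T z) * (W z 0 q)^*%C).
  have [N1 N10 hN1] := bnd _ hFT; have [N2 N20 hN2] := bnd _ hlF; have [N3 N30 hN3] := bnd _ hlF'.
  split.
    exists (N1 + N2 + N3); first by rewrite !addr_ge0.
    move=> z Kz; rewrite scale0r addr0.
    have := hN1 z Kz; have := hN2 z Kz; have := hN3 z Kz; move: (nc _) (nc _) (nc _) => x y u *.
    split; lra.
  move=> e e0; pose N := n%:R * MW; have N0 : 0 <= N by rewrite mulr_ge0.
  have N1p : 0 < N + 1 by rewrite ltr_wpDl.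
  have e1 : 0 < e / (N + 1) by rewrite divr_gt0.
  have [d d0 hd] := uniform_differentiability hF sF e1.
  exists (d / (N + 1)) => [|zeta z hz Kz]; first by rewrite divr_gt0.
  have hWz : nv (W z) <= N.
    apply: le_trans (_ : \sum_(q < n) MW <= _); last by rewrite sumr_const card_ord /N mulr_natl.
    by apply: ler_sum => q _; exact: hMW.
  have hnv : nv (zeta *: W z) <= nc zeta * (N + 1).
    by rewrite nvZ; apply: ler_wpM2l; [exact: nc_ge0|apply: le_trans hWz _; rewrite lerDl].
  have := hd (T z) (zeta *: W z); rewrite scale0r addr0.
  have -> : wform (fun k => dz k F (T z)) (fun k => dzbar k F (T z)) (zeta *: W z) =
     zeta * (\sum_q dz q F (T z) * W z 0 q) + zeta^*%C * (\sum_q dzbar q F (T z) * (W z 0 q)^*%C).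
    rewrite !mulr_sumr -big_split; apply: eq_bigr => q _; rewrite mxE conjcM /=.
    by rewrite mulrCA (mulrCA _ (zeta^*%C)).
  move=> h; apply: le_trans (h _) _.
    by apply: le_lt_trans hnv _; rewrite -ltr_pdivlMr.
  apply: le_trans (ler_wpM2l (ltW e1) hnv) _.
  by rewrite mulrCA -mulrA mulVf ?mulr1 1?mulrC // lt0r_neq0.
apply: eq_uexp (uexpM uF (uexpM uD (uexp_conj uD))) => [zeta z /KU Uz|z /KU Uz|z /KU Uz].
- by rewrite /pullZ /pull (Jm_affine hT hW zeta Uz).
- rewrite !scale0r !addr0 conjc0 mulr0 addr0 (tr_adj _ (uJ Uz)) /pull_variation.
  move: (\sum_q _) (\det _) (F _) (\tr _) => u d f x; move: (d^*%C) => d'; ring.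
- rewrite !scale0r !addr0 mul0r add0r (tr_adj _ (uJ Uz)) /pull_variation.
  have -> : \sum_q dz q conjF (T z) * W z 0 q = (\sum_q dzbar q F (T z) * (W z 0 q)^*%C)^*%C.
    rewrite conjc_sum; apply: eq_bigr => q _; rewrite conjcM conjcK; congr (_ * _).
    by rewrite /conjF dz_conj //; exact: wclass_wdiff hF I.
  rewrite /conjF; move: (\sum_q _) (\det _) (F _) (\tr _) => u d f x.
  rewrite !(conjcM, conjcD, conjcK); move: (d^*%C) (x^*%C) => d' x'; ring.
Qed.

Lemma isotopy_derivative : has_diff nc nc (fun zeta => iC B (ext U (pullZ zeta))) 0 (fun=> 0).
Proof.
split; first by exists 0 => // w; rewrite nc0 mul0r.
move=> e e0.
have oT : open [set: V] by exact: openT.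
have hcF : wclass 1 setT conjF by exact: (wclass_conj oT hF).
have [c1 i1 o1] := iC_pull_variation hF van0.
have [c2 i2 o2] := iC_pull_variation hcF (fun z Uz Kz => etrans (congr1 conjc (van0 Uz Kz)) (conjc0 _)).
have c2' : continuous (fun z => (ext U (pull_variation T W conjF) z)^*%C).
  by move=> z; apply: continuous_conjc; exact: c2.
have hP zeta : nc zeta < r -> wclass 1 setT (ext U (pullZ zeta)) /\ forall z, ~ K z -> ext U (pullZ zeta) z = 0.
  move=> hz; have h0 z : U z -> ~ K z -> pullZ zeta z = 0.
    by move=> Uz Kz; rewrite /pullZ /pull van // mul0r.
  split; last by move=> z; exact: (ext_off (K := K)).
  exact: (wclass_ext oU cK KU h0 (wclass_pull (holoDZ oU hT hW zeta) hF)).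
pose Q : R := 2 * ((2 * B) ^+ size (index_enum ('I_n * bool)%type)).
have Q0 : 0 <= Q by rewrite mulr_ge0 // exprn_ge0 // mulr_ge0 // ltW.
have [_ hu] := pullZ_uexp.
have Qp : 0 < Q + 1 by rewrite ltr_wpDl.
have e1 : 0 < e / (Q + 1) by rewrite divr_gt0.
have [d d0 hd] := hu _ e1.
exists (Num.min d r) => [|zeta]; first by rewrite lt_min d0.
rewrite lt_min add0r subr0 => /andP [z1 z2].
have n0 : nc (0 : C) < r by rewrite nc0.
have [hz oz] := hP _ z2; have [h0 o0] := hP _ n0.
have cz : continuous (ext U (pullZ zeta)) by move=> z; exact: wclass_continuous hz I.
have c0 : continuous (ext U (pullZ 0)) by move=> z; exact: wclass_continuous h0 I.
have d1 := @continuousVZ _ _ (-1) _ c0.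
have d2 := @continuousVZ _ _ (- zeta) _ c1.
have d3 := @continuousVZ _ _ (- zeta^*%C) _ c2'.
have d12 := @continuousVD _ _ _ _ d1 d2; have d123 := @continuousVD _ _ _ _ d12 d3.
have -> : iC B (ext U (pullZ zeta)) - iC B (ext U (pullZ 0)) =
  iC B (fun z => ext U (pullZ zeta) z + (-1 * ext U (pullZ 0) z +
   - zeta * ext U (pull_variation T W F) z +
   - zeta^*%C * (ext U (pull_variation T W conjF) z)^*%C)).
  rewrite (iCD B0 cz d123) (iCD B0 d12 d3) (iCD B0 d1 d2) (iCZ B0 _ c0) (iCZ B0 _ c1) (iCZ B0 _ c2').
  by rewrite (iC_conj B0 c2) i1 i2 conjc0 !mulr0 !addr0 mulN1r.
apply: le_trans (iC_bound (M := e / (Q + 1) * nc zeta) B0 (@continuousVD _ _ _ _ cz d123) _) _.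
  move=> z; have [Kz|Kz] := pselect (K z); last first.
    rewrite (oz z Kz) (o0 z Kz) (o1 z Kz) (o2 z Kz) conjc0 !mulr0 !addr0 nc0.
    by rewrite mulr_ge0 ?nc_ge0 // ltW.
  rewrite !(ext_in _ (KU Kz)).
  have := hd zeta z z1 Kz; congr (nc _ <= _).
  move: (pullZ zeta z) (pullZ 0 z) (pull_variation T W F z) (_^*%C) (_^*%C) => *; ring.
rewrite mulrA -/Q mulrA; apply: ler_wpM2r; first exact: nc_ge0.
by rewrite mulrC; exact: ratio_le (ltW e0) Q0.
Qed.

End Isotopy.

Section MatrixNorm.
Context {R : realType} {n : nat}.
Local Notation C := (R[i]).
Local Notation V := ('rV[C]_n).
Implicit Types (N A : 'M[C]_n) (v : V).

Definition mxn N : R := \sum_i \sum_j nc (N i j).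

Lemma mxn_ge0 N : 0 <= mxn N.
Proof. by apply: sumr_ge0 => i _; apply: sumr_ge0 => j _; exact: nc_ge0. Qed.

Lemma nv_mulmx v N : nv (v *m N) <= mxn N * nv v.
Proof.
rewrite /mxn exchange_big mulr_suml; apply: ler_sum => j _; rewrite mxE.
apply: le_trans (nc_sum _ _ _) _; rewrite mulr_suml; apply: ler_sum => i _.
by rewrite ncM mulrC; apply: ler_wpM2l; [exact: nc_ge0|exact: nv_coord].
Qed.

Lemma mxn_le N (e : R) : (forall i j, nc (N i j) <= e) -> mxn N <= n%:R * (n%:R * e).
Proof.
move=> h; have -> : n%:R * (n%:R * e) = \sum_(i < n) \sum_(j < n) e.
  by rewrite !sumr_const card_ord !mulr_natl.
by apply: ler_sum => i _; apply: ler_sum => j _; exact: h.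
Qed.

Lemma unitmx_lower_bound A (k : R) : 0 < k -> (forall v, k * nv v <= nv (v *m A)) -> A \in unitmx.
Proof.
move=> k0 h; rewrite unitmxE unitfE; apply/negP => /det0P [v v0 vA].
have := h v; rewrite vA nv0 leNgt; apply/negP/negPn.
by rewrite mulr_gt0 // nv_gt0.
Qed.

(** A path from [0] to [1] in the complex plane, bent by the parameter [c]. *)
Definition zpath (c t : R) : C := (t +i* (c * (t * (1 - t))))%C.

Lemma zpath0 c : zpath c 0 = 0.
Proof. by rewrite /zpath mul0r mulr0. Qed.

Lemma zpath1 c : zpath c 1 = 1.
Proof. by rewrite /zpath subrr !mulr0. Qed.

Lemma zpath_diff c t : has_diffR nc (zpath c) t (fun s => s%:C%C * (1 +i* (c * (1 - 2 * t)))%C).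
Proof.
split.
  by exists (nc (1 +i* (c * (1 - 2 * t)))%C : R) => [|s]; rewrite ?nc_ge0 // ncM nc_real mulrC.
move=> e e0; have p : 0 < `|c| + 1 by rewrite ltr_wpDl.
exists (e / (`|c| + 1)) => [|s hs]; first by rewrite divr_gt0.
have -> : zpath c (t + s) - zpath c t - s%:C%C * (1 +i* (c * (1 - 2 * t)))%C =
   'i%C * (- (c * (s * s)))%:C%C.
  by apply/eqP; rewrite eq_complex /=; apply/andP; split; apply/eqP; ring.
rewrite ncM nc_i mul1r nc_real normrN !normrM mulrA; apply: ler_wpM2r => //.
rewrite ltr_pdivlMr // in hs; rewrite mulrC; apply: le_trans (ltW hs).
by apply: ler_wpM2l => //; rewrite lerDl.
Qed.

Lemma zpath_bound c t : 0 <= t <= 1 -> nc (zpath c t) <= 1 + `|c|.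
Proof.
move=> /andP [t0 t1].
have -> : zpath c t = t%:C%C + 'i%C * (c * (t * (1 - t)))%:C%C.
  by apply/eqP; rewrite eq_complex /=; apply/andP; split; apply/eqP; ring.
apply: le_trans (ncD _ _) _; rewrite ncM nc_i mul1r !nc_real normrM.
rewrite (ger0_norm t0); apply: lerD => //; rewrite ler_piMr //.
by rewrite ger0_norm; [nra|rewrite mulr_ge0 // subr_ge0].
Qed.

(** The determinant of the pencil is a nonzero polynomial, and a path that is bent strongly enough
    avoids its finitely many roots. *)
Lemma pencil_path N : \det (1%:M + N) != 0 ->
  exists c : R, forall t : R, 0 <= t <= 1 -> \det (1%:M + zpath c t *: N) != 0.
Proof.
move=> d1; pose P : {poly C} := \det (1%:M + 'X *: map_mx polyC N).
have PE x : P.[x] = \det (1%:M + x *: N).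
  rewrite -horner_evalE /P -det_map_mx; congr (\det _); apply/matrixP => i j.
  rewrite mxE -[LHS]/(((1%:M + 'X *: map_mx polyC N) i j).[x]) !mxE hornerD hornerM hornerX hornerC.
  by case: (i == j); rewrite ?mulr1n ?mulr0n -?polyC1 -?polyC0 hornerC.
have [r rE] := closed_field_poly_normal P.
have P0 : P != 0.
  apply: contraNneq (oner_neq0 C) => P0; have := PE 0.
  by rewrite P0 horner0 scale0r addr0 det1 => ->.
have rootP x : root P x -> x \in r.
  by rewrite rE rootZ ?lead_coef_eq0 // root_prod_XsubC.
(* The absolute value of the only parameter whose path passes through [x]. *)
pose f (x : C) : R := `|complex.Im x / (complex.Re x * (1 - complex.Re x))|.
exists (\sum_(x <- r) f x + 1) => t /andP [t0 t1].
set c := _ + 1; rewrite -PE; apply/negP => hroot.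
have zr : zpath c t \in r by apply: rootP.
have tn0 : t != 0.
  by apply: contraTneq hroot => ->; rewrite zpath0 PE scale0r addr0 det1 oner_neq0.
have tn1 : t != 1.
  by apply: contraTneq hroot => ->; rewrite zpath1 PE scale1r.
have q0 : t * (1 - t) != 0 by rewrite mulf_neq0 // subr_eq0 eq_sym.
have : f (zpath c t) <= \sum_(x <- r) f x.
  rewrite (perm_big _ (perm_to_rem zr)) big_cons lerDl; apply: sumr_ge0 => x _.
  exact: normr_ge0.
have -> : f (zpath c t) = `|c| by rewrite /f /= mulfK.
have := ler_norm c; have : c = \sum_(x <- r) f x + 1 by [].
by move=> cE h1 h2; have := le_trans h1 h2; rewrite cE gerDl ler10.
Qed.

(** Compactness of the path makes the norms of the inverses uniformly bounded. *)
Lemma pencil_lower_bound N c :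
  (forall t : R, 0 <= t <= 1 -> \det (1%:M + zpath c t *: N) != 0) ->
  exists2 k : R, 0 < k <= 1 & forall t v, 0 <= t <= 1 -> k * nv v <= nv (v *m (1%:M + zpath c t *: N)).
Proof.
move=> hd; have /compact_near_coveringP cov := @segment_compact R 0 1.
have H : \forall k \near (0 : R), [set` `[0, 1]] `<=`
    (fun t => forall v, k * nv v <= nv (v *m (1%:M + zpath c t *: N))).
  have h := cov R (nbhs (0 : R)) (fun k t => forall v, k * nv v <= nv (v *m (1%:M + zpath c t *: N))).
  apply: h => t; rewrite /= in_itv /= => ht.
  set A := 1%:M + zpath c t *: N; set m := mxn (invmx A).
  have uA : A \in unitmx by rewrite unitmxE unitfE; exact: hd.
  have m1 : 0 < m + 1 by rewrite ltr_wpDl // mxn_ge0.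
  have hA v : nv v <= (m + 1) * nv (v *m A).
    rewrite -{1}(mulmx1 v) -(mulmxV uA) mulmxA; apply: le_trans (nv_mulmx _ _) _.
    by apply: ler_wpM2r; rewrite ?nv_ge0 // lerDl.
  pose k0 := (m + 1)^-1 / 2; have k00 : 0 < k0 by rewrite divr_gt0 // invr_gt0.
  have N1 : 0 < mxn N + 1 by rewrite ltr_wpDl // mxn_ge0.
  have e0 : 0 < k0 / (mxn N + 1) by rewrite divr_gt0.
  have [d d0 hdd] := has_diff_cont (@is_norm_nc R) (zpath_diff c t) e0.
  exists ([set t' | `|t' - t| < d], [set k | k < k0]).
    split; apply/nbhs_ballP.
      by exists d => // t'; rewrite /ball /= distrC.
    by exists k0 => // k; rewrite /ball /= sub0r normrN; apply: le_lt_trans; exact: ler_norm.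
  move=> [t' k] [/= ht' hk] v.
  have hz : nc (zpath c t' - zpath c t) < k0 / (mxn N + 1).
    by have := hdd (t' - t) ht'; rewrite (addrC t) subrK.
  have E : v *m (1%:M + zpath c t' *: N) = v *m A + (zpath c t' - zpath c t) *: (v *m N).
    rewrite scalemxAr -mulmxDr; congr (_ *m _); rewrite /A -addrA -scalerDl; congr (_ + _ *: _).
    by rewrite addrC subrK.
  have h1 : nv ((zpath c t' - zpath c t) *: (v *m N)) <= k0 * nv v.
    rewrite nvZ; apply: le_trans (ler_wpM2l (nc_ge0 _) (nv_mulmx v N)) _.
    rewrite mulrA; apply: ler_wpM2r; first exact: nv_ge0.
    apply: le_trans (ler_wpM2r (mxn_ge0 _) (ltW hz)) _.
    exact: ratio_le (ltW k00) (mxn_ge0 _).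
  have h2 : 2 * k0 * nv v <= nv (v *m A).
    have -> : 2 * k0 = (m + 1)^-1 by rewrite /k0; field; exact: lt0r_neq0.
    by rewrite ler_pdivrMl.
  have h3 : nv (v *m A) <= nv (v *m (1%:M + zpath c t' *: N)) + nv ((zpath c t' - zpath c t) *: (v *m N)).
    rewrite E; move: (v *m A) (_ *: _) => x y.
    by have := nvD (x + y) (- y); rewrite addrK nvN.
  have h4 : k * nv v <= k0 * nv v by apply: ler_wpM2r; [exact: nv_ge0|exact: ltW].
  apply: le_trans h4 _; rewrite -(lerD2r (k0 * nv v)).
  have -> : k0 * nv v + k0 * nv v = 2 * k0 * nv v by ring.
  by apply: le_trans h2 (le_trans h3 _); rewrite lerD2l.
move/nbhs_ballP: H => [k k0 hk]; exists (Num.min (k / 2) 1).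
  by rewrite lt_min ltr01 divr_gt0 //= ge_min lexx orbT.
move=> t v ht; have mk : 0 <= Num.min (k / 2) 1 by rewrite le_min ler01 divr_ge0 // ltW.
apply: (hk (Num.min (k / 2) 1)); last by rewrite /= in_itv.
rewrite /ball /= sub0r normrN ger0_norm // gt_min; apply/orP; left.
by rewrite ltr_pdivrMr // ltr_pMr // ltr1n.
Qed.

End MatrixNorm.

Section IsotopyInvariance.
Context {R : realType} {n : nat}.
Local Notation C := (R[i]).
Local Notation V := ('rV[C]_n).
Variables (p : V) (s t B : R).
Hypotheses (st : s < t) (s0 : 0 <= s) (hB : nv p + s < B).
Let U := [set z : V | nv (z - p) < t].
Let K := [set z : V | nv (z - p) <= s].
Variables (F : V -> C) (b : R) (T W : V -> V).
Hypotheses (hF : wclass 1 setT F) (sF : supported b F) (hT : holo U T) (hW : holo U W).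

(** The derivative of the integral vanishes at each point of the path. The condition on [F] keeps the
    support of the pulled back density inside the smaller ball, so that there are no boundary
    terms. *)
Lemma isotopy_invariance (c : R) :
  (forall u z, 0 <= u <= 1 -> U z -> Jm T z + zpath c u *: Jm W z \in unitmx) ->
  (forall u, 0 <= u <= 1 -> exists2 r : R, 0 < r & forall zeta z, nc (zeta - zpath c u) < r ->
     U z -> ~ K z -> F (T z + zeta *: W z) = 0) ->
  iC B (ext U (pull F (fun z => T z + W z))) = iC B (ext U (pull F T)).
Proof.
move=> hu hv; have oU : open U by exact: open_ball_nv.
pose E zeta := iC B (ext U (pull F (fun z => T z + zeta *: W z))).
have hE u : 0 <= u <= 1 -> has_diff nc nc E (zpath c u) (fun=> 0).
  move=> hu01; have [r r0 hr] := hv u hu01.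
  have hTu := holoDZ oU hT hW (zpath c u).
  have uJ z : U z -> Jm (fun z => T z + zpath c u *: W z) z \in unitmx.
    by move=> Uz; rewrite (Jm_affine hT hW _ Uz); exact: hu.
  have van zeta z : nc zeta < r -> U z -> ~ K z -> F (T z + zpath c u *: W z + zeta *: W z) = 0.
    move=> hz Uz Kz; rewrite -addrA -scalerDl; apply: hr => //.
    by rewrite addrC addKr.
  apply: (has_diff_shift (N := nc)).
  have -> : (fun x => E (zpath c u + x)) =
      (fun x => iC B (ext U (pull F (fun z => T z + zpath c u *: W z + x *: W z)))).
    apply/funext => x; rewrite /E; congr (iC B (ext U (pull F _))); apply/funext => z.
    by rewrite scalerDl addrA.
  exact: (isotopy_derivative st s0 hB hF sF hTu hW uJ r0 van).
have hphi u : 0 <= u <= 1 -> has_diffR nc (fun u => E (zpath c u)) u (fun s => s%:C%C * 0).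
  move=> hu01; have := has_diff_comp is_norm_real is_norm_nc is_norm_nc
    (fun _ _ => esym (addr0 0)) (zpath_diff c u) (hE u hu01).
  by apply: has_diff_eqL => x; rewrite mulr0.
have e0 (u : R) : 0 <= u <= 1 -> nc (0 - 0 : C) <= 0 by rewrite subr0 nc0.
have := mean_value_bound hphi e0.
rewrite zpath0 zpath1 /E subr0 mulr0 => h.
have E1 : (fun z => T z + 1 *: W z) = (fun z => T z + W z) by apply/funext => z; rewrite scale1r.
have E0 : (fun z => T z + 0 *: W z) = T by apply/funext => z; rewrite scale0r addr0.
rewrite E1 E0 in h; apply: subr0_eq; apply: nc_eq0; apply: le_anti.
by rewrite h nc_ge0.
Qed.

End IsotopyInvariance.

Section LocalChange.
Context {R : realType} {n : nat}.
Local Notation C := (R[i]).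
Local Notation V := ('rV[C]_n).
Local Notation dir := ('I_n * bool)%type.
Implicit Types (F : V -> C) (p q z v w : V).

Lemma nv_sum (I : Type) (r : seq I) (f : I -> V) : nv (\sum_(i <- r) f i) <= \sum_(i <- r) nv (f i).
Proof.
elim: r => [|i r IH]; first by rewrite !big_nil nv0.
by rewrite !big_cons; apply: le_trans (nvD _ _) _; rewrite lerD2l.
Qed.

(** One coordinate direction at a time; the bound on [B] leaves room for the supports of all the
    intermediate translates. *)
Lemma iC_translation F q v B : continuous F -> (forall w, 1 <= nv (w - q) -> F w = 0) ->
  1 + nv q + (size (index_enum dir)).+1%:R * nv v <= B ->
  iC B (fun z => F (z + v)) = iC B F.
Proof.
move=> cF sF hB; rewrite {1}(dirv_sum v).
have nvv := nv_ge0 v; have nvq := nv_ge0 q.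
have key (r : seq dir) : (size r <= size (index_enum dir))%N ->
    iC B (fun z => F (z + \sum_(i <- r) (crd i v)%:C%C *: dirv i)) = iC B F.
  elim: r => [|i r IH] hr; first by apply: eq_iC => z; rewrite big_nil addr0.
  have hr' : (size r <= size (index_enum dir))%N by exact: ltnW.
  rewrite -(IH hr'); set S := \sum_(i <- r) _.
  have hS : nv S <= (size (index_enum dir))%:R * nv v.
    apply: le_trans (nv_sum _ _) _.
    apply: le_trans (_ : (size r)%:R * nv v <= _); last by rewrite ler_wpM2r // ler_nat.
    rewrite -[(size r)%:R]/((size r)%:R) -sum1_size natr_sum mulr_suml; apply: ler_sum => j _.
    by rewrite nvZ nv_dirv mulr1 nc_real mul1r le_crd.
  have cS : continuous (fun z => F (z + S)) by exact: continuous_translate.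
  have Bp : 0 < B by apply: lt_le_trans hB; rewrite ltr_wpDr ?mulr_ge0 // ltr_pwDl.
  rewrite -(@iC_shift _ _ B Bp (fun z => F (z + S)) i (1 + nv q + (size (index_enum dir))%:R * nv v) (crd i v) cS).
  - by apply: eq_iC => z; rewrite big_cons -/S addrA.
  - by rewrite !addr_ge0 // mulr_ge0.
  - apply: le_trans hB; rewrite -natr1 mulrDl mul1r addrA lerD2l; exact: le_crd.
  move=> z j hz; apply: sF; have := le_crd j z; have := nvD (z + S - q) (q - S).
  have -> : z + S - q + (q - S) = z by rewrite addrA subrK addrK.
  have := nvD q (- S); rewrite nvN; move: hz hS; move: (_%:R * nv v) (nv S) (nv (q - S)) (nv z) (nv (z + S - q)) `|crd j z| (nv q) => *; lra.
exact: key.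
Qed.

Lemma holo_affine (q p : V) : (forall U : set V, holo U (fun z => q + (z - p))) /\
  forall z, Jm (fun z => q + (z - p)) z = 1%:M.
Proof.
have h z k : wirt (fun z => (q + (z - p)) 0 k) z (fun j => (j == k)%:R) (fun=> 0).
  have -> : (fun z => (q + (z - p)) 0 k) = (fun z : V => q 0 k + (z 0 k - p 0 k)).
    by apply/funext => w; rewrite !mxE.
  by apply: eq_wirt (wirtD (wirt_cst (q 0 k) z) (wirt_shift_coord p z k)) => j; rewrite add0r.
split=> [U|]; first split.
- move=> k; have -> : (fun z => (q + (z - p)) 0 k) = (fun z : V => z 0 k + (q 0 k - p 0 k)).
    by apply/funext => w; rewrite !mxE addrCA.
  have := wclassD openT (wclass_coord setT 2 k) (wclass_cst setT 2 (q 0 k - p 0 k)).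
  by apply: wclass_sub.
- by move=> z j k _; rewrite (wirt_dzbar j (h z k)).
- by move=> z; apply/matrixP => i j; rewrite JmE (wirt_dz i (h z j)) mxE.
Qed.

Fact pencil_identity (q w y x : V) (a b : C) :
  q + w + a *: (y - (q + w)) - q =
  w + b *: (x - w) + ((a - b) *: (x - w) + a *: (y - q - x)).
Proof. by apply/matrixP => i j; rewrite !mxE; ring. Qed.

Fact expansion_perturbation (k v x y w : R) : 0 < k -> 0 <= v ->
  k * v <= x -> y <= k / 4 * v -> x <= w + y -> k / 2 * v <= w.
Proof. by move=> k0 v0; have := mulr_ge0 (ltW k0) v0; lra. Qed.

Fact expansion_perturbation2 (k v x y y' u w : R) :
  k * v <= x -> y <= k / 4 * v -> y' <= k / 4 * v -> u <= y + y' -> x <= w + u -> k / 2 * v <= w.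
Proof. lra. Qed.

(** Join the translation that takes [p] to [T p] to [T] by maps [S + zeta W], along a path on which
    the pencil of their Jacobian matrices at [p] stays invertible. On a small ball the maps
    of the path shrink distances to [p] at most by a fixed factor, so that the support of the pulled back
    density stays away from the boundary of the ball and the integral is constant along the path. For
    the translation the substitution rule is translation invariance. *)
Lemma local_change_of_variables (Uo : set V) (T : V -> V) p B : open Uo -> Uo p -> holo Uo T ->
  Jm T p \in unitmx ->
  1 + nv (T p) + (size (index_enum dir)).+1%:R * nv (T p - p) <= B ->
  exists t rho : R, [/\ 0 < t, 0 < rho, (forall z, nv (z - p) < t -> Uo z) &
    forall F, wclass 1 setT F -> (forall w, rho <= nv (w - T p) -> F w = 0) ->
      iC B (ext [set z | nv (z - p) < t] (pull F T)) = iC B F].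
Proof.
move=> oUo Uop hT uA hB; set q := T p in hB *; set A := Jm T p in uA.
have nvqp := nv_ge0 (q - p); have nvq := nv_ge0 q.
have pB : nv p < B.
  apply: lt_le_trans hB; have := nvD (p - q) q; rewrite subrK nvB -natr1.
  have : 0 <= (size (index_enum dir))%:R * nv (q - p) by rewrite mulr_ge0.
  lra.
have [c hc] : exists c : R, forall t : R, 0 <= t <= 1 -> \det (1%:M + zpath c t *: (A - 1%:M)) != 0.
  by apply: pencil_path; rewrite addrC subrK; move: uA; rewrite unitmxE unitfE.
have [k /andP [k0 k1] hk] := pencil_lower_bound hc.
pose L : R := 2 + `|c|; have L0 : 0 < L by rewrite ltr_pwDl.
pose n1 : R := n%:R + 1; have n10 : 0 < n1 by rewrite ltr_wpDl.
(* With this tolerance the deviation from the affine pencil costs at most [k / 4]. *)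
pose e : R := k / (4 * L * (n1 * n1)).
have e0 : 0 < e by rewrite divr_gt0 // !mulr_gt0.
have [Ut Ut0 hUt] : exists2 d : R, 0 < d & forall z, nv (z - p) < d -> Uo z.
  by apply/nbhsVP; exact: open_nbhs_nbhs.
have [d1 d10 hd1] : exists2 d : R, 0 < d & forall j w, nv w < d ->
    nc (T (p + w) 0 j - T p 0 j - (w *m A) 0 j) <= e * nv w.
  apply: finite_radius => [j|j d d' dd' h w hw]; last by apply: h; exact: lt_le_trans hw dd'.
  have [_ /(_ e e0) [d d0 hd]] := holo_wirt hT j Uop; exists d => // w /hd.
  by congr (nc (_ - _) <= _); rewrite mxE; apply: eq_bigr => i _; rewrite mul0r addr0 mulrC.
have [d2 d20 hd2] : exists2 d : R, 0 < d & forall (ij : 'I_n * 'I_n) z, nv (z - p) < d ->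
    nc (Jm T z ij.1 ij.2 - A ij.1 ij.2) <= e.
  apply: finite_radius => [ij|j d d' dd' h w hw]; last by apply: h; exact: lt_le_trans hw dd'.
  have /continuousVP/(_ _ e0) [d d0 hd] :=
    wclass_continuous (mclass_Jm oUo hT ij.1 ij.2) Uop.
  by exists d => // z /hd /ltW.
pose t := Num.min (Num.min Ut (B - nv p)) (Num.min (Num.min d1 d2) 1).
have t0 : 0 < t by rewrite !lt_min Ut0 d10 d20 ltr01 subr_gt0 pB.
pose s := t / 2; have s0 : 0 < s by rewrite divr_gt0.
have st : s < t by rewrite ltr_pdivrMr // ltr_pMr // ltr1n.
(* The maps of the path shrink distances at most by [k / 2]: outside the ball of radius [s] they
   take values outside the ball of radius [rho]. *)
pose rho := k / 2 * s; have rho0 : 0 < rho by rewrite !mulr_gt0 // divr_gt0.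
have [[tU tp] [[t1 t2] t3]] : (t <= Ut /\ t <= B - nv p) /\ ((t <= d1 /\ t <= d2) /\ t <= 1).
  by rewrite /t !ge_min !lexx ?orbT.
have rt : rho < t.
  apply: le_lt_trans st; rewrite /rho ler_piMl //; first exact: ltW.
  by rewrite ler_pdivrMr // mul1r; apply: le_trans k1 _; rewrite ler1n.
exists t, rho; split=> // [z hz|F hF sF]; first by apply: hUt; exact: lt_le_trans hz tU.
pose U := [set z : V | nv (z - p) < t]; pose K := [set z : V | nv (z - p) <= s].
have oU : open U by exact: open_ball_nv.
have UUo : U `<=` Uo by move=> z hz; apply: hUt; exact: lt_le_trans hz tU.
have hTU : holo U T.
  by split=> [j|z j l /UUo Uz]; [exact: wclass_sub (hT.1 j)|exact: hT.2].
have [hS' JS] := holo_affine q p.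
have hS := hS' U; pose S z := q + (z - p); pose W z := T z - S z.
have WE : W = (fun z => T z + (-1) *: S z) by apply/funext => z; rewrite scaleN1r.
have hW : holo U W by rewrite WE; exact: holoDZ.
have JW z : U z -> Jm W z = Jm T z - 1%:M.
  by move=> Uz; rewrite WE (Jm_affine hTU hS _ Uz) JS scaleN1r.
have zb u : 0 <= u <= 1 -> nc (zpath c u) <= L - 1.
  have -> : L - 1 = 1 + `|c| by rewrite /L; ring.
  exact: zpath_bound.
have small : n1 * n1 * e * L = k / 4.
  by rewrite /e; field; rewrite !lt0r_neq0.
have nn1 : n%:R <= n1 by rewrite lerDl.
have hJ z v zeta : U z -> nc zeta <= L -> nv (zeta *: (v *m (Jm T z - A))) <= k / 4 * nv v.
  move=> Uz hz; rewrite nvZ; apply: le_trans (ler_wpM2l (nc_ge0 _) (nv_mulmx _ _)) _.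
  rewrite mulrA; apply: ler_wpM2r; first exact: nv_ge0.
  rewrite -small [leRHS]mulrC; apply: ler_pM => //; rewrite ?nc_ge0 ?mxn_ge0 //.
  apply: le_trans (mxn_le (e := e) _) _ => [i j|].
    rewrite !mxE; apply: (hd2 (i, j)); exact: lt_le_trans Uz t2.
  rewrite mulrA; apply: ler_wpM2r; first exact: ltW.
  by apply: ler_pM.
have hE z zeta : U z -> nc zeta <= L -> nv (zeta *: (T z - q - (z - p) *m A)) <= k / 4 * nv (z - p).
  move=> Uz hz; rewrite nvZ.
  have h1 : nv (T z - q - (z - p) *m A) <= n%:R * (e * nv (z - p)).
    have -> : n%:R * (e * nv (z - p)) = \sum_(j < n) (e * nv (z - p)).
      by rewrite sumr_const card_ord mulr_natl.
    apply: ler_sum => j _; have := hd1 j (z - p) (lt_le_trans Uz t1).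
    by rewrite [p + _]addrC subrK !mxE.
  apply: le_trans (ler_pM (nc_ge0 _) (nv_ge0 _) hz h1) _.
  have -> : L * (n%:R * (e * nv (z - p))) = n%:R * e * L * nv (z - p) by ring.
  rewrite -small; apply: ler_wpM2r; first exact: nv_ge0.
  apply: ler_wpM2r; first exact: ltW.
  apply: ler_wpM2r; first exact: ltW.
  apply: le_trans nn1 _; rewrite ler_peMr ?(ltW n10) //; by rewrite /n1 lerDr.
have JST zeta z : U z -> Jm S z + zeta *: Jm W z = 1%:M + zeta *: (A - 1%:M) + zeta *: (Jm T z - A).
  move=> Uz; rewrite JW // JS -addrA -scalerDr; congr (_ + _ *: _).
  by rewrite [RHS]addrC addrA subrK.
have uST u z : 0 <= u <= 1 -> U z -> Jm S z + zpath c u *: Jm W z \in unitmx.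
  move=> hu Uz; rewrite JST //; apply: (@unitmx_lower_bound _ _ _ (k / 2)); first by rewrite divr_gt0.
  move=> v; rewrite mulmxDr -scalemxAr.
  have h1 := hk u v hu; have zL : nc (zpath c u) <= L by apply: le_trans (zb u hu) _; rewrite gerBl.
  have := hJ z v _ Uz zL; move: h1; set x := v *m (1%:M + _); set y := zpath c u *: _.
  move=> h1 h2; apply: (expansion_perturbation k0 (nv_ge0 v) h1 h2).
  by have := nvD (x + y) (- y); rewrite addrK nvN.
have van u : 0 <= u <= 1 -> exists2 r : R, 0 < r & forall zeta z, nc (zeta - zpath c u) < r ->
     U z -> ~ K z -> F (S z + zeta *: W z) = 0.
  move=> hu; pose m := mxn (A - 1%:M); have m0 : 0 <= m by exact: mxn_ge0.
  have m1 : 0 < m + 1 by rewrite ltr_wpDl.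
  exists (Num.min 1 (k / 4 / (m + 1))); first by rewrite lt_min ltr01 !divr_gt0.
  move=> zeta z; rewrite lt_min => /andP [r1 r2] Uz Kz.
  have sz : s < nv (z - p) by rewrite ltNge; apply/negP.
  have zL : nc zeta <= L.
    rewrite -(subrK (zpath c u) zeta); apply: le_trans (ncD _ _) _.
    by have h := lerD (ltW r1) (zb u hu); rewrite [1 + _]addrC subrK in h.
  apply: sF; set w := z - p.
  have -> : S z + zeta *: W z - q = w *m (1%:M + zpath c u *: (A - 1%:M)) +
     ((zeta - zpath c u) *: (w *m (A - 1%:M)) + zeta *: (T z - q - w *m A)).
    rewrite /W /S -/w mulmxDr mulmx1 -scalemxAr mulmxBr mulmx1; exact: pencil_identity.
  have h1 := hk u w hu; have h2 := hE z zeta Uz zL.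
  have h3 : nv ((zeta - zpath c u) *: (w *m (A - 1%:M))) <= k / 4 * nv w.
    rewrite nvZ; apply: le_trans (ler_wpM2l (nc_ge0 _) (nv_mulmx _ _)) _.
    rewrite mulrA; apply: ler_wpM2r; first exact: nv_ge0.
    apply: le_trans (ler_wpM2r m0 (ltW r2)) _; apply: ratio_le => //.
    by rewrite divr_ge0 // ltW.
  move: h1 h2 h3 sz; rewrite -/w /rho.
  set x := w *m _; set y := (_ - _) *: _; set y' := zeta *: _.
  move=> h1 h2 h3 sz; apply: le_trans (_ : k / 2 * nv w <= _).
    by rewrite ler_wpM2l ?divr_ge0 // ltW.
  apply: (expansion_perturbation2 h1 h3 h2); first exact: nvD.
  by have := nvD (x + (y + y')) (- (y + y')); rewrite addrK nvN.
have bF : supported (nv q + rho) F.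
  move=> z i hz; apply: sF; have := le_crd i z; have := nvD (z - q) q; rewrite subrK => h1 h2.
  by have := le_trans hz (le_trans h2 h1); rewrite addrC lerD2r.
have sB : nv p + s < B by rewrite addrC -ltrBrDr; exact: lt_le_trans st tp.
have := isotopy_invariance st (ltW s0) sB hF bF hS hW uST van.
have -> : (fun z => S z + W z) = T by apply/funext => z; rewrite /W addrC subrK.
move=> ->; rewrite -(@iC_translation F q (q - p) B _ _ hB).
- congr (iC B _); apply/funext => z.
  have Sq : z + (q - p) = S z by rewrite /S addrCA.
  rewrite Sq; have [Uz|Uz] := pselect (U z).
    by rewrite ext_in // /pull JS det1 conjc1 !mulr1.
  rewrite ext_out // sF // /S addrC addKr; apply: le_trans (ltW rt) _.
  by rewrite leNgt; apply/negP.
- by move=> z; exact: wclass_continuous hF I.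
- move=> w hw; apply: sF; apply: le_trans hw; apply: le_trans (ltW rt) t3.
Qed.

End LocalChange.

(** * Positive definite Hermitian matrices *)

Section Hermitian.
Context {R : realType} {n : nat}.
Local Notation C := (R[i]).
Implicit Types (A B H : 'M[C]_n) (v w : 'rV[C]_n).

Lemma ctrE m1 m2 (A : 'M[C]_(m1, m2)) i j : (A ^t*) i j = (A j i)^*%C.
Proof. by rewrite !mxE. Qed.

Lemma ctrM m1 m2 m3 (A : 'M[C]_(m1, m2)) (B : 'M[C]_(m2, m3)) :
  (A *m B) ^t* = (B ^t*) *m (A ^t*).
Proof. by rewrite trmx_mul map_mxM. Qed.

Lemma ctrBZ m1 m2 (A B : 'M[C]_(m1, m2)) (t : C) : (A - t *: B) ^t* = A ^t* - t^*%C *: B ^t*.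
Proof. by apply/matrixP => i j; rewrite !mxE rmorphB rmorphM. Qed.

Definition posdef H := H ^t* = H /\ forall v, v != 0 -> 0 < (v *m H *m v ^t*) 0 0.

Variable H : 'M[C]_n.
Hypothesis pH : posdef H.

Lemma posdef_unit : H \in unitmx.
Proof.
rewrite unitmxE unitfE; apply/negP => /det0P [v v0 vH].
by have := pH.2 v v0; rewrite vH mul0mx mxE ltxx.
Qed.

Lemma posdef_inv : (invmx H) ^t* = invmx H.
Proof. by rewrite trmx_inv map_invmx pH.1. Qed.

Lemma posdef_inv_form v : v != 0 -> 0 < (v *m invmx H *m v ^t*) 0 0.
Proof.
move=> v0; have w0 : v *m invmx H != 0.
  by apply: contraNneq v0 => h; rewrite -(mulmxKV posdef_unit v) h mul0mx.
have := pH.2 _ w0; rewrite ctrM posdef_inv -(mulmxA v) mulVmx ?posdef_unit //.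
by rewrite mulmx1 mulmxA.
Qed.

Lemma posdef_inv_diag k : 0 < invmx H k k.
Proof.
have d0 : delta_mx 0 k != 0 :> 'rV[C]_n.
  by apply/eqP => /matrixP /(_ 0 k); rewrite !mxE !eqxx => /eqP; rewrite oner_eq0.
have := posdef_inv_form d0; rewrite -rowE mxE (bigD1 k) //= ctrE !mxE !eqxx conjc1 mulr1.
by rewrite big1 ?addr0 // => j jk; rewrite ctrE [delta_mx _ _ _ _]mxE (negPf jk) andbF conjc0 mulr0.
Qed.

Lemma posdef_form_ge0 v : 0 <= (v *m H *m v ^t*) 0 0.
Proof.
have [->|v0] := eqVneq v 0; first by rewrite !mul0mx mxE.
exact: ltW (pH.2 v v0).
Qed.

(** The Cauchy-Schwarz inequality between [v] and the dual of a coordinate vector. *)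
Lemma posdef_coord v k : v 0 k * (v 0 k)^*%C <= (v *m H *m v ^t*) 0 0 * invmx H k k.
Proof.
set b := invmx H k k; have b0 : 0 < b := posdef_inv_diag k.
have bc : b^*%C = b by have := posdef_inv => /matrixP /(_ k k); rewrite ctrE.
set w := delta_mx 0 k *m invmx H : 'rV[C]_n.
have wH : w *m H = delta_mx 0 k by rewrite /w -mulmxA mulVmx ?posdef_unit // mulmx1.
have Hw : H *m w ^t* = (delta_mx 0 k : 'rV[C]_n) ^t* by rewrite -wH (ctrM w H) pH.1.
have wk : (w ^t*) k 0 = b by rewrite ctrE /w -rowE mxE -/b bc.
have dk (A : 'cV[C]_n) : ((delta_mx 0 k : 'rV[C]_n) *m A) 0 0 = A k 0 by rewrite -rowE mxE.
have vk : (v *m (delta_mx 0 k : 'rV[C]_n) ^t*) 0 0 = v 0 k.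
  rewrite mxE (bigD1 k) //= ctrE mxE !eqxx conjc1 mulr1 big1 ?addr0 // => j jk.
  by rewrite ctrE mxE (negPf jk) andbF conjc0 mulr0.
move: wH Hw wk; clearbody w; move=> wH Hw wk.
set t := v 0 k / b; set x := v 0 k; set a := (v *m H *m v ^t*) 0 0.
have := posdef_form_ge0 (v - t *: w).
rewrite ctrBZ.
have -> : ((v - t *: w) *m H *m (v ^t* - t^*%C *: w ^t*)) 0 0 =
   a - t^*%C * x - t * (x^*%C - t^*%C * b).
  have -> : (v - t *: w) *m H = v *m H - t *: delta_mx 0 k by rewrite mulmxBl -scalemxAl wH.
  rewrite mulmxBl !mulmxBr -!scalemxAl -!scalemxAr -(mulmxA v H (w ^t*)) Hw.
  have mB (A B : 'M[C]_1) : (A - B) 0 0 = A 0 0 - B 0 0 by rewrite !mxE.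
  have mZ (z : C) (A : 'M[C]_1) : (z *: A) 0 0 = z * A 0 0 by rewrite mxE.
  rewrite !(mB, mZ) vk !dk wk ctrE -/x -/a; move: (t^*%C) (x^*%C) => t' x'; ring.
have tc : t^*%C = x^*%C / b.
  by rewrite /t -/x conjcM; congr (_ * _); rewrite conjc_inv bc.
have bn0 : b != 0 by rewrite gt_eqF.
have -> : a - t^*%C * x - t * (x^*%C - t^*%C * b) = a - x * x^*%C / b.
  by rewrite tc /t -/x; move: (x^*%C) => y; field.
by rewrite subr_ge0 ler_pdivrMr.
Qed.

Lemma posdef_det : 0 < \det H.
Proof.
have nH : H \is normalmx by apply/normalmxP; rewrite pH.1.
have /orthomx_spectralP := nH; set P := spectralmx H; set sp := spectral_diag H => E.
have uP : P \is unitarymx by exact: spectral_unitarymx.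
have Pu : P \in unitmx by exact: unitarymx_unit.
have D : P *m H *m P ^t* = diag_mx sp.
  by rewrite E -(invmx_unitary uP) !mulmxA mulmxV // mul1mx mulmxK.
have spE k : 0 < sp 0 k.
  have r0 : row k P != 0.
    apply: contraTneq Pu => r0; rewrite unitmxE unitfE negbK.
    by rewrite (expand_det_row _ k) big1 // => j _; move/matrixP/(_ 0 j): r0; rewrite !mxE => ->; rewrite mul0r.
  have := pH.2 _ r0; suff -> : (row k P *m H *m (row k P) ^t*) 0 0 = sp 0 k by [].
  transitivity ((P *m H *m P ^t*) k k); last by rewrite D mxE eqxx mulr1n.
  rewrite -row_mul mxE [RHS]mxE; apply: eq_bigr => j _; rewrite !ctrE !mxE.
  by congr (_ * _).
rewrite E !det_mulmx det_inv mulrAC mulVf ?mul1r; last by rewrite -unitfE -unitmxE.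
by rewrite det_diag; apply: prodr_gt0.
Qed.

End Hermitian.

(** * The Chern connection in a coordinate chart *)

Section ChernConnection.
Context {R : realType} {n : nat}.
Local Notation C := (R[i]).
Local Notation V := ('rV[C]_n).
Variables (U : set V).
Hypothesis oU : open U.
Implicit Types (H : V -> 'M[C]_n) (z : V) (i j k l : 'I_n).

(** The connection matrices of the Chern connection. *)
Definition Gam H k z : 'M[C]_n := Dm false k H z *m invmx (H z).

(** The trace of the torsion of the Chern connection. *)
Definition eta H k z : C := \tr (Gam H k z) - \sum_i Gam H i z k i.
Definition etaV H z : 'cV[C]_n := \col_k eta H k z.
(** The coordinates of the conjugate-type vector field that is dual to [eta] for the metric. *)
Definition Yv H z : 'cV[C]_n := invmx (H z) *m etaV H z.

Section Metric.
Variable H : V -> 'M[C]_n.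
Hypotheses (hH : mclass 2 U H) (pH : forall z, U z -> posdef (H z)).

Let uH z : U z -> H z \in unitmx.
Proof. by move=> /pH; exact: posdef_unit. Qed.

Let hH1 : mclass 1 U H. Proof. by move=> i j; exact: wclass_pred (hH i j). Qed.

Lemma mclass_Gam k : mclass 1 U (Gam H k).
Proof. exact: (mclassM oU (mclass_Dm oU false k hH) (mclass_inv oU uH hH1)). Qed.

Lemma wclass_eta k : wclass 1 U (eta H k).
Proof.
apply: (wclassB oU (mclass_tr oU (mclass_Gam k))); apply: (wclass_sum oU) => i _.
exact: mclass_Gam.
Qed.

Lemma YvE z l : Yv H z l 0 = \sum_k invmx (H z) l k * eta H k z.
Proof. by rewrite mxE; apply: eq_bigr => k _; rewrite mxE. Qed.

Lemma wclass_Yv l : wclass 1 U (fun z => Yv H z l 0).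
Proof.
apply: (wclass_eq oU (fun z _ => esym (YvE z l))); apply: (wclass_sum oU) => k _.
exact: (wclassM oU (mclass_inv oU uH hH1 l k) (wclass_eta k)).
Qed.

Lemma Dm_Gam k l z : U z -> Dm true l (Gam H k) z *m H z =
  Dm true l (Dm false k H) z - Dm false k H z *m invmx (H z) *m Dm true l H z.
Proof.
move=> Uz; have d1 := mclass_mdiff (mclass_Dm oU false k hH) Uz.
have d2 := mclass_mdiff (mclass_inv oU uH hH1) Uz.
rewrite /Gam (DmM true l d1 d2) (Dm_inv oU uH true l hH1 Uz) mulmxDl mulmxKV ?uH //.
by rewrite mulmxN mulNmx !mulmxA mulmxKV ?uH.
Qed.

Lemma chern_curvatureE i j k l z : U z ->
  chern_curvature H i j k l z = - (Dm true l (Gam H k) z *m H z) i j.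
Proof.
move=> Uz; rewrite Dm_Gam // [in RHS]mxE opprD; congr (_ + _).
  rewrite DmE /pd; congr (- _).
  have -> : (fun w => Dm false k H w i j) = dz k (fun w => H w i j).
    by apply/funext => w; rewrite DmE.
  by rewrite (dz_dzbarC oU (hH i j) Uz).
rewrite [in RHS]mxE opprK mxE; apply: eq_bigr => p _.
rewrite mxE mulr_suml; apply: eq_bigr => q _; rewrite !DmE /pd.
rewrite mulrC; move: (dz _ _ _) (dzbar _ _ _) (invmx _ _ _) => x y u; ring.
Qed.

Lemma curvature_scalar (r : 'I_n -> 'I_n -> C) z : U z ->
  (forall k l, Dm true l (Gam H k) z = - (r k l)%:M) ->
  chern_scalar H z = n%:R * \sum_k \sum_l invmx (H z) l k * r k l.
Proof.
move=> Uz hr; rewrite /chern_scalar mulr_sumr; apply: eq_bigr => k _; rewrite mulr_sumr.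
apply: eq_bigr => l _; rewrite mulrCA; congr (_ * _).
transitivity (r k l * \tr (invmx (H z) *m H z)); last first.
  by rewrite mulVmx ?uH // mxtrace1 mulrC.
rewrite /ricci1 exchange_big mulr_sumr; apply: eq_bigr => j _; rewrite mxE mulr_sumr.
have mN (A : 'M[C]_n) a b : (- A) a b = - A a b by rewrite mxE.
have mZ c (A : 'M[C]_n) a b : (c *: A) a b = c * A a b by rewrite mxE.
apply: eq_bigr => i _; rewrite chern_curvatureE // hr mulNmx mul_scalar_mx mN opprK mZ.
by rewrite mulrCA.
Qed.

Lemma flat_connection (r : 'I_n -> 'I_n -> C) z : U z ->
  (forall i j k l, chern_curvature H i j k l z = r k l * H z i j) ->
  forall k l, Dm true l (Gam H k) z = - (r k l)%:M.
Proof.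
move=> Uz h k l.
have E : Dm true l (Gam H k) z *m H z = - (r k l)%:M *m H z.
  apply/matrixP => i j; rewrite mulNmx mul_scalar_mx [RHS]mxE [in RHS]mxE -h.
  by rewrite chern_curvatureE // opprK.
by rewrite -[LHS](mulmxK (uH Uz)) E mulmxK ?uH.
Qed.

Section Flat.
Variable r : V -> 'I_n -> 'I_n -> C.
Hypothesis hr : forall z, U z -> forall k l, Dm true l (Gam H k) z = - (r z k l)%:M.

(** The derivatives of the connection matrices are scalar: the trace counts all their diagonal
    entries, the other sum a single one. *)
Lemma dzbar_eta k l z : U z -> dzbar l (eta H k) z = - ((n%:R - 1) * r z k l).
Proof.
move=> Uz; have dG k' := mclass_mdiff (mclass_Gam k') Uz.
have dtr : wdiff (fun z => \tr (Gam H k z)) z by exact: wclass_wdiff (mclass_tr oU (mclass_Gam k)) Uz.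
have ds : wdiff (fun z => \sum_i Gam H i z k i) z.
  by apply: wclass_wdiff (wclass_sum oU _ (fun i _ => mclass_Gam i k i)) Uz.
have dN : wdiff (fun z => -1 * \sum_i Gam H i z k i) z by exact: (wdiffM (wdiff_cst (-1) z) ds).
have -> : eta H k = fun z => \tr (Gam H k z) + -1 * \sum_i Gam H i z k i.
  by apply/funext => w; rewrite mulN1r.
rewrite -[LHS]/(pd true l _ z) (pdD true l dtr dN) (pdZ true l (-1) ds).
rewrite (pd_sum true l _ (P := xpredT) (fun i _ => dG k i i)).
rewrite (pd_sum true l _ (P := xpredT) (fun i _ => dG i k i)).
have E k' i j : pd true l (fun w => Gam H k' w i j) z = - (r z k' l *+ (i == j)).
  by rewrite -DmE hr // !mxE.
under eq_bigr do rewrite E eqxx mulr1n.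
under [X in _ + -1 * X]eq_bigr do rewrite E.
rewrite !sumrN sumr_const card_ord (bigD1 k) //= eqxx big1 => [|i ik]; last first.
  by rewrite eq_sym (negPf ik).
rewrite -mulr_natl mulr1n; move: (r z k l) => x; ring.
Qed.

(** Since [H] is Hermitian, conjugation exchanges the two kinds of derivatives of [H]; in this form
    [eta] occurs in the divergence of [det H * inverse of H]. *)
Lemma conj_eta l z : U z -> (eta H l z)^*%C =
  \tr (invmx (H z) *m Dm true l H z) - \sum_i (invmx (H z) *m Dm true i H z) i l.
Proof.
move=> Uz; have [sH _] := pH Uz.
have GE k : (Gam H k z) ^t* = invmx (H z) *m Dm true k H z.
  rewrite ctrM (posdef_inv (pH Uz)); congr (_ *m _); apply/matrixP => i j.
  rewrite ctrE (DmE false) (DmE true).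
  rewrite -(@pd_conj _ _ true k _ _ (wclass_wdiff (hH j i) Uz)).
  apply: near_eq_pd; last by apply: wdiff_conj; exact: wclass_wdiff (hH j i) Uz.
  apply: (open_near_eq oU Uz) => w Uw; have [sHw _] := pH Uw.
  by rewrite -[in RHS]sHw ctrE.
rewrite /eta conjcB; congr (_ - _).
  rewrite -GE /mxtrace conjc_sum; apply: eq_bigr => i _; by rewrite ctrE.
by rewrite conjc_sum; apply: eq_bigr => i _; rewrite -GE ctrE.
Qed.

(** The derivatives of [det H] and of the inverse of [H] combine, by [conj_eta], into the square
    norm of [eta]; the derivative of [eta] itself is the curvature term. *)
Lemma div_Y z : U z ->
  \sum_l dzbar l (fun w => \det (H w) * Yv H w l 0) z =
  \det (H z) * ((\row_l (eta H l z)^*%C *m invmx (H z) *m etaV H z) 0 0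
    - (n%:R - 1) * \sum_k \sum_l invmx (H z) l k * r z k l).
Proof.
move=> Uz; set Hi := invmx (H z); pose D l := Dm true l H z.
have mN (A : 'M[C]_n) i j : (- A) i j = - A i j by rewrite mxE.
have hI := mclass_inv oU uH hH1.
have dI l k : wdiff (fun w => invmx (H w) l k) z by exact: wclass_wdiff (hI l k) Uz.
have dE k : wdiff (eta H k) z by exact: wclass_wdiff (wclass_eta k) Uz.
have dD : wdiff (fun w => \det (H w)) z by exact: wclass_wdiff (wclass_det oU hH1) Uz.
have E l : dzbar l (fun w => \det (H w) * Yv H w l 0) z = \det (H z) *
    (\tr (Hi *m D l) * (Hi *m etaV H z) l 0 - (Hi *m D l *m Hi *m etaV H z) l 0
     - (n%:R - 1) * \sum_k Hi l k * r z k l).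
  rewrite -[LHS]/(pd true l _ z) (pdM true l dD (wclass_wdiff (wclass_Yv l) Uz)).
  rewrite (pd_det_unit uH true l hH1 Uz) -/Hi -/(D l) -/(Yv H z) -mulrA -mulrDr; congr (_ * _).
  rewrite -addrA; congr (_ + _).
  have -> : (fun w => Yv H w l 0) = fun w => \sum_k invmx (H w) l k * eta H k w.
    by apply/funext => w; exact: YvE.
  rewrite (pd_sum true l _ (P := xpredT) (fun k _ => wdiffM (dI l k) (dE k))).
  rewrite [X in _ = - X - _]mxE -sumrN mulr_sumr -sumrB; apply: eq_bigr => k _.
  rewrite (pdM true l (dI l k) (dE k)) -DmE (Dm_inv oU uH true l hH1 Uz) -/Hi -/(D l).
  rewrite mN -[pd true l _ z]/(dzbar l (eta H k) z).
  rewrite dzbar_eta // [etaV _ _ _ _]mxE -/Hi.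
  move: (_ l k) (Hi l k) (eta H k z) (r z k l) => u v x y; ring.
under eq_bigr do rewrite E.
rewrite -mulr_sumr; congr (_ * _); rewrite sumrB -mulr_sumr; congr (_ - _ * _); last first.
  exact: exchange_big.
rewrite sumrB.
have EW : (\row_l (eta H l z)^*%C *m Hi *m etaV H z) 0 0 =
   \sum_l (eta H l z)^*%C * (Hi *m etaV H z) l 0.
  by rewrite -mulmxA mxE; apply: eq_bigr => l _; rewrite mxE.
rewrite EW; under [RHS]eq_bigr do rewrite conj_eta // mulrBl.
rewrite sumrB; congr (_ - _).
under [RHS]eq_bigr do rewrite mulr_suml.
rewrite exchange_big; apply: eq_bigr => l _.
by rewrite -(mulmxA (Hi *m D l)) mxE.
Qed.

(** The square norm is nonnegative, and the curvature term is [(n - 1) / n] times the opposite of the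
    scalar curvature: this is where its sign and the dimension enter. *)
Lemma div_Y_gt0 z : U z -> (2 <= n)%N -> chern_scalar H z < 0 ->
  0 < \sum_l dzbar l (fun w => \det (H w) * Yv H w l 0) z.
Proof.
move=> Uz n2 hs; rewrite div_Y //; apply: mulr_gt0; first exact: posdef_det (pH Uz).
have n0 : 0 < n%:R :> C by rewrite ltr0n; exact: leq_trans n2.
have s0 : \sum_k \sum_l invmx (H z) l k * r z k l < 0.
  by move: hs; rewrite (curvature_scalar Uz (hr Uz)) pmulr_rlt0.
rewrite addrC -mulrN; apply: ltr_wpDr.
  set w := \row_l _; have -> : etaV H z = w ^t*.
    by apply/matrixP => i j; rewrite ctrE [LHS]mxE [w _ _]mxE conjcK.
  have [->|w0] := eqVneq w 0; first by rewrite !mul0mx mxE.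
  exact: ltW (posdef_inv_form (pH Uz) w0).
by apply: mulr_gt0; [rewrite subr_gt0 ltr1n|rewrite oppr_gt0].
Qed.

End Flat.
End Metric.

(** The connection matrices change by a multiple of the identity. *)
Lemma conformal_flat H H' (E : V -> C) (r : V -> 'I_n -> 'I_n -> C) :
  mclass 2 U H -> mclass 2 U H' -> (forall z, U z -> posdef (H z)) ->
  wclass 2 U E -> (forall z, U z -> E z != 0) -> (forall z, U z -> H' z = E z *: H z) ->
  (forall z, U z -> forall k l, Dm true l (Gam H k) z = - (r z k l)%:M) ->
  forall z, U z -> forall k l,
    Dm true l (Gam H' k) z = - (r z k l - dzbar l (fun w => dz k E w / E w) z)%:M.
Proof.
move=> hH hH' pH hE E0 HE hr z Uz k l.
have uH w : U w -> H w \in unitmx by move=> /pH; exact: posdef_unit.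
have mD (A B : 'M[C]_n) i j : (A + B) i j = A i j + B i j by rewrite mxE.
have mZ c (A : 'M[C]_n) i j : (c *: A) i j = c * A i j by rewrite mxE.
have GE w : U w -> Gam H' k w = (dz k E w / E w)%:M + Gam H k w.
  move=> Uw; have DE : Dm false k H' w = dz k E w *: H w + E w *: Dm false k H w.
    apply/matrixP => i j; rewrite DmE mD !mZ DmE.
    have dE := wclass_wdiff hE Uw; have dH := wclass_wdiff (hH i j) Uw.
    rewrite -[dz k E w]/(pd false k E w) -(pdM false k dE dH).
    apply: near_eq_pd; first by apply: (open_near_eq oU Uw) => v Uv; rewrite HE // mxE.
    exact: wclass_wdiff (hH' i j) Uw.
  have iE : invmx (H' w) = (E w)^-1 *: invmx (H w).
    by rewrite HE // invmxZ // unitmxZ ?unitfE ?E0 ?uH.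
  rewrite /Gam DE iE mulmxDl -!scalemxAl -!scalemxAr !scalerA mulmxV ?uH // divff ?E0 // scale1r.
  by rewrite scalemx1.
have hq : wclass 1 U (fun w => dz k E w / E w).
  exact: (wclassM oU (wclass_dz k hE) (wclassV oU E0 (wclass_pred hE))).
have hG := mclass_Gam hH pH k.
apply/matrixP => i j.
have d1 : wdiff (fun w => (dz k E w / E w) * (i == j)%:R) z.
  exact: (wdiffM (wclass_wdiff hq Uz) (wdiff_cst _ z)).
have d2 : wdiff (fun w => Gam H k w i j) z by exact: wclass_wdiff (hG i j) Uz.
rewrite DmE -(@near_eq_pd _ _ _ _ (fun w => (dz k E w / E w) * (i == j)%:R + Gam H k w i j)).
- rewrite (pdD true l d1 d2) -DmE hr // (pdM true l (wclass_wdiff hq Uz) (wdiff_cst _ z)) pd_cst mulr0 addr0.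
  rewrite !mxE /pd; move: (dzbar _ _ _) (r z k l) => x y.
  by case: (i == j); rewrite ?mulr1 ?mulr0 ?mulr1n ?mulr0n ?oppr0 ?add0r // opprB.
- by apply: (open_near_eq oU Uz) => w Uw; rewrite GE // !mxE mulr_natr.
- exact: wdiffD.
Qed.

End ChernConnection.

(** * Coordinate changes *)

Section FrechetDerivative.
Context {R : realType} {n : nat}.
Local Notation C := (R[i]).
Local Notation V := ('rV[C]_n).

Lemma norm_coord (x : V) q : `|x 0 q| <= `|x|.
Proof.
rewrite [leRHS]/Num.norm /= mx_normE -[leLHS]nngE num_le.
exact: (@le_bigmax _ _ _ _ (fun i : 'I_1 * 'I_n => `|x i.1 i.2|%:nng) (0, q)).
Qed.

Lemma norm_le_nv (x : V) : `|x| <= (nv x)%:C%C.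
Proof.
rewrite [leLHS]/Num.norm /=; have [->|x0] := eqVneq (mx_norm x) 0; first by rewrite lecR nv_ge0.
have [[i j] ->] := mx_norm_neq0 x0; rewrite /= norm_nc lecR ord1; exact: nv_coord.
Qed.

Lemma differentiable_wirt (f : V -> V) z q : differentiable f z ->
  wirt (fun w => f w 0 q) z (fun j => jacobian f z j q) (fun=> 0).
Proof.
move=> df; have E w : wform (fun j => jacobian f z j q) (fun=> 0) w = ('d f z w) 0 q.
  rewrite -(mul_rV_lin1 ('d f z)) [RHS]mxE; apply: eq_bigr => j _.
  by rewrite mul0r addr0 mulrC.
pose M : R := \sum_j nc (jacobian f z j q).
split.
  exists (2 * M) => [|w].
    by rewrite mulr_ge0 //; apply: sumr_ge0 => j _; exact: nc_ge0.
  apply: nc_wform => j; last by rewrite nc0; apply: sumr_ge0 => k _; exact: nc_ge0.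
  by rewrite /M (bigD1 j) //= lerDl; apply: sumr_ge0 => k _; exact: nc_ge0.
move=> e e0; have /eqaddoP h := diff_locally df.
have e0' : 0 < e%:C%C by rewrite ltcR.
have /nbhsVP [d d0 hd] := h _ e0'; exists d => // w hw.
have := hd w; rewrite subr0 => /(_ hw).
rewrite /= !fctE /= => hh.
rewrite -lecR -norm_nc E.
have -> : f (z + w) 0 q - f z 0 q - ('d f z w) 0 q = (f (w + z) - (f z + 'd f z w)) 0 q.
  by rewrite !mxE opprD addrA addrC [w + z]addrC [LHS]addrC.
apply: le_trans (norm_coord _ _) (le_trans hh _).
rewrite rmorphM /=; apply: ler_wpM2l; [exact: ltW|exact: norm_le_nv].
Qed.

Lemma wclass_local k (U : set V) (f : V -> C) :
  (forall z, U z -> exists2 U', U' z & wclass k U' f) -> wclass k U f.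
Proof.
elim: k f => [|k IH] f h.
  by split=> // z /h [U' U'z hf]; exact: wclass_continuous hf U'z.
split=> [z /h [U' U'z hf]|]; first exact: wclass_continuous hf U'z.
split=> [z /h [U' U'z hf]|j]; first exact: wclass_wdiff hf U'z.
split; apply: IH => z /h [U' U'z hf]; exists U' => //; [exact: wclass_dz hf|exact: wclass_dzbar hf].
Qed.

End FrechetDerivative.

Section Regularity.
Context {R : realType} {n : nat}.
Local Notation C := (R[i]).
Local Notation V := ('rV[C]_n).
Variables (U Ub : set V) (T : V -> V) (Ha Hb : V -> 'M[C]_n).
Hypotheses (n0 : (0 < n)%N) (oU : open U) (oUb : open Ub).
Hypotheses (TU : forall z, U z -> Ub (T z)) (dT : forall z, U z -> differentiable T z).
Hypotheses (hHa : mclass 0 U Ha) (hHb : mclass 0 Ub Hb).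
Hypotheses (pa : forall z, U z -> posdef (Ha z)) (pb : forall z, Ub z -> posdef (Hb z)).
Hypothesis HT : forall z, U z -> Ha z = jacobian T z *m Hb (T z) *m (jacobian T z) ^t*.

Lemma jacobian_Jm z : U z -> jacobian T z = Jm T z.
Proof.
move=> Uz; apply/matrixP => i j; rewrite JmE.
by rewrite (wirt_dz i (differentiable_wirt j (dT Uz))).
Qed.

(** The diagonal entries of [Ha] are the square lengths for [Hb] of the rows of the Jacobian matrix.
    The entries of the latter are thus locally bounded, by the Cauchy-Schwarz inequality, and the
    regularity theorem applies to the coordinates of [T]. *)
Lemma transition_holo : holo U T.
Proof.
have cT q z : U z -> {for z, continuous (fun w => T w 0 q)}.
  by move=> Uz; exact: wdiff_continuous (wirt_wdiff (differentiable_wirt q (dT Uz))).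
have cTV z : U z -> {for z, continuous T} by move=> Uz; exact: differentiable_continuous (dT Uz).
have bnd q z : U z -> exists R0 M : R, [/\ 0 < R0, (forall w, nv (w - z) < R0 -> U w) &
    forall w k, nv (w - z) < R0 -> nc (jacobian T w k q) <= M].
  move=> Uz; have [r r0 hr] : exists2 d : R, 0 < d & forall w, nv (w - z) < d -> U w.
    by apply/nbhsVP; exact: open_nbhs_nbhs.
  have ca k : {for z, continuous (fun w => Ha w k k)} := wclass_continuous (hHa k k) Uz.
  have cb : {for z, continuous (fun w => invmx (Hb (T w)) q q)}.
    have ub w : Ub w -> Hb w \in unitmx by move=> /pb; exact: posdef_unit.
    apply: (@continuous_comp _ _ _ T (fun v => invmx (Hb v) q q)); first exact: cTV.
    exact: wclass_continuous (mclass_inv oUb ub hHb q q) (TU Uz).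
  have [d1 d10 hd1] : exists2 d : R, 0 < d & forall k w, nv (w - z) < d -> nc (Ha w k k - Ha z k k) <= 1.
    apply: finite_radius => [k|k d d' dd' h w hw]; last by apply: h; exact: lt_le_trans hw dd'.
    by have /continuousVP/(_ _ ltr01) [d d0 hd] := ca k; exists d => // w /hd /ltW.
  have /continuousVP/(_ _ ltr01) [d2 d20 hd2] := cb.
  pose A : R := 1 + \sum_k nc (Ha z k k); pose B : R := 1 + nc (invmx (Hb (T z)) q q).
  have A1 : 1 <= A by rewrite lerDl; apply: sumr_ge0 => k _; exact: nc_ge0.
  have B1 : 1 <= B by rewrite lerDl nc_ge0.
  exists (Num.min r (Num.min d1 d2)), (A * B); split; first by rewrite !lt_min r0 d10 d20.
    by move=> w; rewrite lt_min => /andP [/hr].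
  move=> w k; rewrite !lt_min => /andP [/hr Uw /andP [w1 w2]].
  have hA : nc (Ha w k k) <= A.
    rewrite -(subrK (Ha z k k) (Ha w k k)); apply: le_trans (ncD _ _) _; apply: lerD; first exact: hd1.
    by rewrite (bigD1 k) //= lerDl; apply: sumr_ge0 => j _; exact: nc_ge0.
  have hB : nc (invmx (Hb (T w)) q q) <= B.
    rewrite -(subrK (invmx (Hb (T z)) q q) (invmx (Hb (T w)) q q)).
    by apply: le_trans (ncD _ _) _; rewrite lerD2r; exact/ltW/hd2.
  set v := row k (jacobian T w).
  have := posdef_coord (pb (TU Uw)) v q.
  have -> : (v *m Hb (T w) *m v ^t*) 0 0 = Ha w k k.
    rewrite HT // /v -row_mul [in RHS]mxE [in LHS]mxE; apply: eq_bigr => j _.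
    by rewrite [row _ _ _ _]mxE !ctrE [row _ _ _ _]mxE.
  rewrite -sqr_nc [v 0 q]mxE => h.
  have h2 : nc (jacobian T w k q) ^+ 2 <= A * B.
    rewrite -lecR; apply: le_trans (h) _.
    have a0 : 0 <= Ha w k k * invmx (Hb (T w)) q q.
      by apply: le_trans (h); rewrite lecR sqr_ge0.
    rewrite -(ger0_norm a0) norm_nc lecR ncM.
    by apply: ler_pM; rewrite ?nc_ge0.
  have AB1 : 1 <= A * B by rewrite -[1]mulr1 ler_pM.
  have x0 := nc_ge0 (jacobian T w k q).
  have [x1|x1] := leP (nc (jacobian T w k q)) 1; first exact: le_trans x1 AB1.
  by apply: le_trans h2; rewrite expr2 ler_peMr // ltW.
split=> [q|z j q Uz]; last by rewrite (wirt_dzbar j (differentiable_wirt q (dT Uz))).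
apply: wclass_local => z Uz; have [R0 [M [R00 hU hM]]] := bnd q z Uz.
exists [set w | nv (w - z) < R0 / 4]; first by rewrite /= subrr nv0 divr_gt0.
apply: (@goursat _ _ _ _ _ M (fun w k => jacobian T w k q)) => // w /hU Uw.
exact: differentiable_wirt (dT Uw).
Qed.

End Regularity.

Section Transition.
Context {R : realType} {n : nat}.
Local Notation C := (R[i]).
Local Notation V := ('rV[C]_n).
Variables (U Ub : set V) (T : V -> V) (Ha Hb : V -> 'M[C]_n).
Hypotheses (oU : open U) (oUb : open Ub) (TU : forall z, U z -> Ub (T z)) (hT : holo U T).
Hypotheses (hHa : mclass 2 U Ha) (hHb : mclass 2 Ub Hb).
Hypotheses (pa : forall z, U z -> posdef (Ha z)) (pb : forall z, Ub z -> posdef (Hb z)).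
Hypothesis HT : forall z, U z -> Ha z = Jm T z *m Hb (T z) *m (Jm T z) ^t*.

Lemma det_ctr (A : 'M[C]_n) : \det (A ^t*) = (\det A)^*%C.
Proof. by rewrite det_map_mx det_tr. Qed.

Lemma transition_det z : U z ->
  \det (Ha z) = \det (Hb (T z)) * (\det (Jm T z) * (\det (Jm T z))^*%C).
Proof.
move=> Uz; rewrite HT // !det_mulmx det_ctr; move: (\det (Jm T z)) (\det _) => d e.
by move: (d^*%C) => d'; ring.
Qed.

Lemma transition_unit z : U z -> Jm T z \in unitmx.
Proof.
move=> Uz; have := posdef_unit (pa Uz); rewrite HT // !unitmx_mul => /andP [/andP [h _] _].
exact: h.
Qed.

Lemma transition_Gam k z : U z -> Gam Ha k z =
  (Dm false k (Jm T) z + Jm T z *m \sum_p Jm T z k p *: Gam Hb p (T z)) *m invmx (Jm T z).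
Proof.
move=> Uz; have Ubz := TU Uz; set J := Jm T z; have uJ : J \in unitmx := transition_unit Uz.
have uA := posdef_unit (pa Uz); have uB := posdef_unit (pb Ubz).
have hJ := mclass_Jm oU hT.
have dF i j : wdiff (fun w => Hb w i j) (T z) by exact: wclass_wdiff (hHb i j) Ubz.
have dB : mdiff (fun w => Hb (T w)) z.
  by move=> i j; exact: wirt_wdiff (wirt_pull_fun hT Uz (dF i j)).
have dJ := mclass_mdiff hJ Uz.
have dC : mdiff (fun w => (Jm T w) ^t*) z.
  move=> i j; have -> : (fun w => ((Jm T w) ^t*) i j) = fun w => (Jm T w j i)^*%C.
    by apply/funext => w; rewrite ctrE.
  exact: wdiff_conj.
have EB : Dm false k (fun w => Hb (T w)) z = \sum_p J k p *: Dm false p Hb (T z).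
  apply/matrixP => i j; rewrite DmE /pd (wirt_dz k (wirt_pull_fun hT Uz (dF i j))) summxE.
  apply: eq_bigr => p _; rewrite [RHS]mxE DmE mulrC //.
have EC : Dm false k (fun w => (Jm T w) ^t*) z = 0.
  apply/matrixP => i j; rewrite DmE [RHS]mxE.
  have -> : (fun w => ((Jm T w) ^t*) i j) = fun w => (Jm T w j i)^*%C.
    by apply/funext => w; rewrite ctrE.
  rewrite (pd_conj false k (dJ j i)) -[pd (~~ false) _ _ _](DmE true k (Jm T) z j i).
  by rewrite (dzbar_Jm oU hT k Uz) mxE conjc0.
have dAB : mdiff (fun w => Jm T w *m Hb (T w)) z.
  move=> i j; have -> : (fun w => (Jm T w *m Hb (T w)) i j) = fun w => \sum_q Jm T w i q * Hb (T w) q j.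
    by apply/funext => w; rewrite mxE.
  by apply: wdiff_sum => q _; exact: wdiffM.
have DE : Dm false k Ha z = Dm false k (fun w => Jm T w *m Hb (T w) *m (Jm T w) ^t*) z.
  apply/matrixP => i j; rewrite !DmE; apply: near_eq_pd; last exact: wclass_wdiff (hHa i j) Uz.
  by apply: (open_near_eq oU Uz) => w Uw; rewrite HT.
rewrite /Gam -[RHS](mulmxK uA); congr (_ *m _).
rewrite DE (DmM false k dAB dC) EC mulmx0 addr0 (DmM false k dJ dB) EB (HT Uz) -/J.
rewrite !mulmxA; congr (_ *m _); rewrite -[RHS]mulmxA -[RHS]mulmxA.
rewrite (mulmxA (invmx J)) mulVmx // mul1mx mulmxDl -mulmxA; congr (_ + _ *m _).
rewrite mulmx_suml; apply: eq_bigr => p _; rewrite -scalemxAl; congr (_ *: _).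
by rewrite mulmxKV.
Qed.

(** The second derivatives of [T] cancel between the two traces because they are symmetric. *)
Lemma transition_eta z : U z -> etaV Ha z = Jm T z *m etaV Hb (T z).
Proof.
move=> Uz; set J := Jm T z; have uJ : J \in unitmx := transition_unit Uz; set Ji := invmx J.
apply/matrixP => k c; rewrite [LHS]mxE [RHS]mxE /eta.
under [RHS]eq_bigr do rewrite [etaV _ _ _ _]mxE /eta mulrBr.
pose D i := Dm false i (Jm T) z; pose S i := \sum_p J i p *: Gam Hb p (T z).
have GE i : Gam Ha i z = D i *m Ji + J *m S i *m Ji by rewrite transition_Gam // mulmxDl.
have E1 : \tr (Gam Ha k z) = \tr (D k *m Ji) + \sum_p J k p * \tr (Gam Hb p (T z)).
  rewrite GE mxtraceD; congr (_ + _); rewrite mxtrace_mulC mulmxA mulVmx // mul1mx raddf_sum.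
  by apply: eq_bigr => p _; rewrite /= mxtraceZ.
have E2 : \sum_i Gam Ha i z k i = \tr (D k *m Ji) + \sum_x J k x * \sum_p Gam Hb p (T z) x p.
  have mD (A B : 'M[C]_n) i j : (A + B) i j = A i j + B i j by rewrite mxE.
  under eq_bigr do rewrite GE mD.
  rewrite big_split /=; congr (_ + _).
    apply: eq_bigr => i _; rewrite !mxE; apply: eq_bigr => q _.
    by rewrite /D (dz_Jm_sym oU hT).
  transitivity (\sum_i \sum_x J k x * (S i *m Ji) x i).
    by apply: eq_bigr => i _; rewrite -mulmxA mxE.
  rewrite exchange_big; apply: eq_bigr => x _; rewrite -mulr_sumr; congr (_ * _).
  transitivity (\sum_i \sum_p \sum_y J i p * Gam Hb p (T z) x y * Ji y i).
    apply: eq_bigr => i _; rewrite mxE exchange_big; apply: eq_bigr => y _.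
    rewrite /S summxE mulr_suml; apply: eq_bigr => p _; congr (_ * _).
    by rewrite mxE.
  rewrite exchange_big; apply: eq_bigr => p _.
  transitivity ((Gam Hb p (T z) *m (Ji *m J)) x p); last by rewrite mulVmx // mulmx1.
  rewrite exchange_big [RHS]mxE; apply: eq_bigr => y _; rewrite [X in _ = _ * X]mxE mulr_sumr.
  apply: eq_bigr => i _; move: (J i p) (Gam Hb p (T z) x y) (Ji y i) => e u v; ring.
rewrite E1 E2 opprD addrACA subrr add0r sumrB; congr (_ - _).
Qed.

Lemma transition_Yv z : U z -> Yv Hb (T z) = (Jm T z) ^t* *m Yv Ha z.
Proof.
move=> Uz; have uJ := transition_unit Uz; have uB := posdef_unit (pb (TU Uz)).
have uA := posdef_unit (pa Uz); set J := Jm T z in uJ *.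
rewrite /Yv transition_eta // -/J !mulmxA; congr (_ *m _).
set P := J ^t* *m invmx (Ha z) *m J.
suff HP : Hb (T z) *m P = 1%:M by rewrite -[P]mul1mx -(mulVmx uB) -mulmxA HP mulmx1.
have : J *m (Hb (T z) *m P) = J.
  by rewrite /P !mulmxA -/J -HT // mulmxV // mul1mx.
by move=> /(congr1 (mulmx (invmx J))); rewrite mulKmx // mulVmx.
Qed.

Definition Yd H (f : V -> C) z : C := \sum_l Yv H z l 0 * dzbar l f z.

(** This makes derivation along the field a global operation. *)
Lemma transition_Yd f z : U z -> wdiff f (T z) -> Yd Ha (fun w => f (T w)) z = Yd Hb f (T z).
Proof.
move=> Uz df; rewrite /Yd.
under eq_bigr do rewrite (wirt_dzbar _ (wirt_pull_fun hT Uz df)) mulr_sumr.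
rewrite exchange_big; apply: eq_bigr => q _; rewrite transition_Yv // mxE mulr_suml.
apply: eq_bigr => l _; rewrite ctrE; move: (_^*%C) (Yv _ _ _ _) (dzbar _ _ _) => x y u; ring.
Qed.

End Transition.

(** * Smooth partitions of unity on a compact complex manifold *)

Section Manifold.
Context {R : realType} {n : nat} {M : complex_manifold R n}.
Local Notation C := (R[i]).
Local Notation V := ('rV[C]_n).
Variable h : hermitian_metric M.
Hypothesis n0 : (0 < n)%N.
Implicit Types (a b c : chart M) (x y : M) (z w : V) (f : M -> C).

Lemma open_image a : open (chart_image a).
Proof. exact: chart_image_open. Qed.

Lemma inv_dom a z : chart_image a z -> chart_dom a (chart_inv a z).
Proof. by move=> [x dx <-]; rewrite chart_mapK. Qed.

Lemma map_inv a z : chart_image a z -> chart_map a (chart_inv a z) = z.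
Proof. by move=> [x dx <-]; rewrite chart_mapK. Qed.

Lemma map_image a x : chart_dom a x -> chart_image a (chart_map a x).
Proof. by move=> dx; exists x. Qed.

Lemma mclass_metric k a : mclass k (chart_image a) (h a).
Proof. by move=> i j; apply: (rdiff_wclass (@open_image a)); exact: hmx_smooth. Qed.

Lemma posdef_metric a z : chart_image a z -> posdef (h a z).
Proof. by move=> az; split; [exact: hmx_hermitian|move=> v; exact: hmx_posdef]. Qed.

Definition overlap a b : set V := [set z | chart_image a z /\ chart_dom b (chart_inv a z)].
Definition transition a b : V -> V := chart_map b \o chart_inv a.

Lemma open_preimage a (N : set M) : open N ->
  open [set z | chart_image a z /\ N (chart_inv a z)].
Proof.
rewrite !openE => oN z [az Nz]; have := @open_image a; rewrite openE => /(_ z az) h1.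
have h2 := chart_inv_continuous az (oN _ Nz).
by apply: filterS (filterI h1 h2) => w [].
Qed.

Lemma open_overlap a b : open (overlap a b).
Proof. exact: open_preimage (chart_dom_open b). Qed.

Lemma transition_image a b z : overlap a b z -> chart_image b (transition a b z).
Proof. by move=> [_ bz]; exact: map_image. Qed.

Lemma inv_transition a b z : overlap a b z -> chart_inv b (transition a b z) = chart_inv a z.
Proof. by move=> [_ bz]; rewrite /transition /= chart_mapK. Qed.

Lemma transition_differentiable a b z : overlap a b z -> differentiable (transition a b) z.
Proof.
move=> [az bz]; have := transition_holomorphic (inv_dom az) bz.
by rewrite map_inv.
Qed.

Lemma metric_jacobian a b z : overlap a b z ->
  h a z = jacobian (transition a b) z *m h b (transition a b z) *m (jacobian (transition a b) z) ^t*.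
Proof.
move=> [az bz]; have := hmx_transition h (inv_dom az) bz.
by rewrite map_inv.
Qed.

Lemma holo_transition a b : holo (overlap a b) (transition a b).
Proof.
apply: (@transition_holo _ _ _ (chart_image b) _ (h a) (h b) n0 (@open_overlap a b) (@open_image b)).
- exact: transition_image.
- exact: transition_differentiable.
- by move=> i j; apply: wclass_sub (mclass_metric 0 a i j) => z [].
- exact: mclass_metric.
- exact: posdef_metric.
- exact: metric_jacobian.
Qed.

Lemma metric_transition a b z : overlap a b z ->
  h a z = Jm (transition a b) z *m h b (transition a b z) *m (Jm (transition a b) z) ^t*.
Proof.
move=> oz; rewrite -(jacobian_Jm (@transition_differentiable a b) oz); exact: metric_jacobian.
Qed.

Definition cclass k f := forall b, wclass k (chart_image b) (fun z => f (chart_inv b z)).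

(** In another chart, [f] is a composite with a transition map where the chart [a] is defined, and
    zero off [K]. The restriction on [k] is the regularity known for transition maps. *)
Lemma cclass_supported k a f (K : set M) (g : V -> C) : closed K -> K `<=` chart_dom a ->
  (forall y, ~ K y -> f y = 0) -> wclass k (chart_image a) g -> (k <= 2)%N ->
  (forall z, chart_image a z -> f (chart_inv a z) = g z) -> cclass k f.
Proof.
move=> cK Ka f0 hg k2 fg b; apply: wclass_local => z bz.
have [dz|ndz] := pselect (chart_dom a (chart_inv b z)).
  exists (overlap b a); first by split.
  have oU := @open_overlap b a.
  have := wclass_comp oU (@transition_image b a) (fun q => wclass_le k2 ((holo_transition b a).1 q)) hg.
  apply: (wclass_eq oU) => w ow; rewrite -fg; first by rewrite inv_transition.
  exact: transition_image.
exists [set w | chart_image b w /\ (~` K) (chart_inv b w)]; first by split=> //= /Ka.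
have oU := @open_preimage b _ (closed_openC cK).
by apply: (wclass_eq oU _ (wclass_cst _ k 0)) => w [_ /= Kw]; rewrite f0.
Qed.

Lemma chart_compact a (K : set V) : K `<=` chart_image a -> compact K ->
  compact (chart_inv a @` K).
Proof.
move=> Ka cK; apply: continuous_compact => //; apply: continuous_in_subspaceT => z /set_mem /Ka az.
exact: chart_inv_continuous.
Qed.

Lemma map_compact a (K : set M) : K `<=` chart_dom a -> compact K -> compact (chart_map a @` K).
Proof.
move=> Ka cK; apply: continuous_compact => //; apply: continuous_in_subspaceT => y /set_mem /Ka ay.
exact: chart_map_continuous.
Qed.

Definition is_bump a x (N : set M) (beta : M -> R) (K : set M) : Prop :=
  [/\ compact K, K `<=` N `&` chart_dom a, forall y, ~ K y -> beta y = 0,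
      forall y, 0 <= beta y & [/\ nbhs x [set y | 0 < beta y] & cclass 2 (fun y => (beta y)%:C%C)]].

Lemma bump_exists a x (N : set M) : chart_dom a x -> nbhs x N ->
  exists beta K, is_bump a x N beta K.
Proof.
move=> dx Nx; set p := chart_map a x; have ip := map_image dx.
have [e e0 he] : exists2 e : R, 0 < e & forall w, nv (w - p) < e -> chart_image a w /\ N (chart_inv a w).
  apply/nbhsVP; have h1 : nbhs p (chart_image a) by apply: open_nbhs_nbhs; split=> //; exact: open_image.
  have h2 : nbhs p (chart_inv a @^-1` N).
    by apply: (chart_inv_continuous ip); rewrite chart_mapK.
  by apply: filterS (filterI h1 h2) => w [].
have nR : 0 < n%:R :> R by rewrite ltr0n.
pose r : R := e / 2 / n%:R; have r0 : 0 < r by rewrite !divr_gt0.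
have rn : n%:R * r = e / 2 by rewrite /r mulrC divfK // lt0r_neq0.
pose g w := bump 3 (r ^+ 2) p w.
pose beta y : R := if `[< chart_dom a y >] then pospow 3 (r ^+ 2 - sqnorm (chart_map a y - p)) else 0.
pose K : set M := chart_inv a @` [set w | nv (w - p) <= e / 2].
have e2 : e / 2 < e by rewrite ltr_pdivrMr // ltr_pMr // ltr1n.
have KV : [set w | nv (w - p) <= e / 2] `<=` chart_image a.
  by move=> w /= hw; apply: (he w _).1; exact: le_lt_trans hw e2.
have cK : compact K by apply: chart_compact => //; exact: compact_ball_nv.
have K0 y : ~ K y -> beta y = 0.
  move=> nK; rewrite /beta; case: asboolP => // dy.
  have hy : n%:R * r <= nv (chart_map a y - p).
    rewrite rn leNgt; apply/negP => hy; apply: nK; exists (chart_map a y); first exact: ltW.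
    exact: chart_mapK.
  have := bump_eq0 (N := 3) isT (ltW r0) (lexx _) hy n0.
  by rewrite bumpE => /(congr1 (@complex.Re R)).
exists beta, K; split.
- exact: cK.
- by move=> _ [w /= hw <-]; split; [exact: (he w (le_lt_trans hw e2)).2|exact: inv_dom (KV _ hw)].
- exact: K0.
- by move=> y; rewrite /beta; case: ifP => // _; exact: pospow_ge0.
split.
  have cp := chart_map_continuous dx.
  have pd : nbhs x (chart_dom a) by apply: open_nbhs_nbhs; split=> //; exact: chart_dom_open.
  have hp : nbhs p [set w | 0 < pospow 3 (r ^+ 2 - sqnorm (w - p))].
    have cg : {for p, continuous g} := wclass_continuous (wclass_bump 2 _ _) I.
    have gp : 0 < pospow 3 (r ^+ 2 - sqnorm (p - p)).
      by rewrite subrr sqnorm0 subr0 pospow_gt0 // exprn_gt0.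
    have /continuousVP/(_ _ gp) [d d0 hd] := cg; apply/nbhsVP; exists d => // w /hd.
    rewrite /g !bumpE -rmorphB nc_real ltr_norml => /andP [h1 _] /=.
    by move: h1; rewrite ltrBrDr addNr.
  apply: filterS (filterI pd (cp _ hp)) => y [dy hy].
  by rewrite /= /beta ifT //; apply/asboolP.
apply: (cclass_supported (compact_closed (@carrier_hausdorff _ _ M) cK) (g := g) (a := a)).
- by move=> _ [w /= hw <-]; exact: inv_dom (KV _ hw).
- by move=> y /K0 ->.
- exact: wclass_sub (@subsetT _ _) (wclass_bump 2 _ _).
- by [].
- move=> z az; rewrite /beta ifT; last by apply/asboolP; exact: inv_dom.
  by rewrite map_inv // /g bumpE.
Qed.

Hypothesis cM : compact [set: M].

(** Compactness is applied with the filter of finite families of points ordered by inclusion. *)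
Lemma finite_subfamily (P : M -> M -> Prop) : (forall x, nbhs x (P x)) ->
  exists s : seq M, forall y, exists2 x, x \in s & P x y.
Proof.
move=> hP; pose F : set_system (seq M) := [set A | exists s0 : seq M, forall s : seq M, {subset s0 <= s} -> A s].
have FF : Filter F.
  split; first by exists [::].
    move=> A B [s1 h1] [s2 h2]; exists (s1 ++ s2) => s hs; split.
      by apply: h1 => x xs; apply: hs; rewrite mem_cat xs.
    by apply: h2 => x xs; apply: hs; rewrite mem_cat xs orbT.
  by move=> A B AB [s0 hs]; exists s0 => s /hs /AB.
have /compact_near_coveringP cov := cM.
have [|s0 hs] := cov _ F (fun (s : seq M) y => exists2 x, x \in s & P x y) FF.
  move=> x _; exists (P x, [set s : seq M | x \in s]).
    split; first exact: hP.
    by exists [:: x] => s; apply; rewrite mem_seq1.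
  by move=> [y s] [/= Py xs]; exists x.
by exists s0 => y; have := hs s0 (fun _ => id) y I.
Qed.

(** Finitely many bumps with positive sum, divided by their sum. The family is subordinate to the
    neighbourhoods [N] as well as to the charts, for localising statements that hold near each
    point. *)
Lemma partition_of_unity (a : M -> chart M) (N : M -> set M) :
  (forall x, chart_dom (a x) x) -> (forall x, nbhs x (N x)) ->
  exists (s : seq M) (phi : M -> M -> R) (K : M -> set M),
    (forall y, \sum_(x <- s) phi x y = 1) /\
    forall x, [/\ compact (K x), K x `<=` N x `&` chart_dom (a x),
      forall y, ~ K x y -> phi x y = 0, forall y, 0 <= phi x y &
      cclass 2 (fun y => (phi x y)%:C%C)].
Proof.
move=> da nN.
have ex x : exists bK : (M -> R) * set M, is_bump (a x) x (N x) bK.1 bK.2.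
  by have [beta [K H]] := bump_exists (da x) (nN x); exists (beta, K).
have [bK hbK] := boolp.choice ex.
have nb x : nbhs x [set y | 0 < (bK x).1 y] by case: (hbK x) => _ _ _ _ [].
have sb x : cclass 2 (fun y => ((bK x).1 y)%:C%C) by case: (hbK x) => _ _ _ _ [].
have [s hs] := finite_subfamily nb.
pose S y := \sum_(x <- s) (bK x).1 y.
have b0 x y : 0 <= (bK x).1 y by case: (hbK x).
have S0 y : 0 < S y.
  have [x xs hx] := hs y; rewrite /S (perm_big _ (perm_to_rem xs)) big_cons.
  by apply: ltr_pwDl hx _; apply: sumr_ge0 => i _.
exists s, (fun x y => (bK x).1 y / S y), (fun x => (bK x).2); split.
  by move=> y; rewrite -mulr_suml mulfV // lt0r_neq0 ?S0.
move=> x; have [cK KN K0 _ _] := hbK x; split.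
- exact: cK.
- exact: KN.
- by move=> y /K0 ->; rewrite mul0r.
- by move=> y; rewrite divr_ge0 // ltW.
move=> b; have oU := @open_image b.
have hS : wclass 2 (chart_image b) (fun z => (S (chart_inv b z))%:C%C).
  have := wclass_sum oU s (P := xpredT) (fun x _ => sb x b).
  by apply: (wclass_eq oU) => z _; rewrite /S rmorph_sum.
have Sn0 z : chart_image b z -> (S (chart_inv b z))%:C%C != 0 :> C.
  by move=> _; rewrite fmorph_eq0 lt0r_neq0 // S0.
apply: (wclass_eq oU _ (wclassM oU (sb x b) (wclassV oU Sn0 hS))) => z _.
by rewrite -fmorphV -rmorphM.
Qed.

End Manifold.

(** * Integration and the divergence theorem on the manifold *)

Section Integration.
Context {R : realType} {n : nat} {M : complex_manifold R n}.
Local Notation C := (R[i]).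
Local Notation V := ('rV[C]_n).
Local Notation dir := ('I_n * bool)%type.
Variable h : hermitian_metric M.
Hypothesis n0 : (0 < n)%N.
Implicit Types (a b c : chart M) (x y : M) (z w : V) (f g : M -> C) (K : set M).

(** Density, against Lebesgue measure in the chart [a], of [f] times the volume form of the metric. *)
Definition density a f : V -> C :=
  ext (chart_image a) (fun z => \det (h a z) * f (chart_inv a z)).

Lemma wclass_density a f K : cclass 1 f -> compact K -> K `<=` chart_dom a ->
  (forall y, ~ K y -> f y = 0) -> wclass 1 setT (density a f).
Proof.
move=> hf cK Ka f0; have oU := @open_image _ _ _ a.
have cKa := compact_closed (@norm_hausdorff _ _) (map_compact Ka cK).
apply: (wclass_ext oU cKa).
- by move=> _ [y Ky <-]; exact: map_image (Ka _ Ky).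
- move=> z az nz; rewrite f0 ?mulr0 // => Kz; apply: nz.
  by exists (chart_inv a z) => //; exact: map_inv.
- exact: (wclassM oU (wclass_det oU (mclass_metric h 1 a)) (hf a)).
Qed.

Lemma continuous_density a f K : cclass 1 f -> compact K -> K `<=` chart_dom a ->
  (forall y, ~ K y -> f y = 0) -> continuous (density a f).
Proof. by move=> hf cK Ka f0 z; exact: wclass_continuous (wclass_density hf cK Ka f0) I. Qed.

Lemma cclassM k f g : cclass k f -> cclass k g -> cclass k (fun y => f y * g y).
Proof. by move=> hf hg b; exact: (wclassM (@open_image _ _ _ b) (hf b) (hg b)). Qed.

Lemma cclass_pred k f : cclass k.+1 f -> cclass k f.
Proof. by move=> hf b; exact: wclass_pred (hf b). Qed.

(** The determinant of the metric transforms by the squared modulus of the Jacobian determinant, so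
    that this is the local change of variables. *)
Lemma chart_independence a b x (B : R) : chart_dom a x -> chart_dom b x ->
  1 + nv (chart_map b x) + (size (index_enum dir)).+1%:R * nv (chart_map b x - chart_map a x) <= B ->
  exists2 N : set M, nbhs x N & forall f K, cclass 1 f -> compact K -> K `<=` N ->
    (forall y, ~ K y -> f y = 0) -> iC B (density a f) = iC B (density b f).
Proof.
move=> ax bx hB; set p := chart_map a x; set q := chart_map b x in hB *.
have op : overlap a b p by split; [exact: map_image|rewrite /p chart_mapK].
have Tp : transition a b p = q by rewrite /transition /= /p chart_mapK.
have oO := @open_overlap _ _ _ a b; have hT := @holo_transition _ _ _ h n0 a b.
have uJ : Jm (transition a b) p \in unitmx.
  apply: (@transition_unit _ _ (overlap a b) (transition a b) (h a) (h b) _ _ p op).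
    by move=> z [az _]; exact: posdef_metric.
  by move=> z oz; exact: metric_transition.
have hB' : 1 + nv (transition a b p) + (size (index_enum dir)).+1%:R * nv (transition a b p - p) <= B.
  by rewrite Tp.
have [t [rho [t0 rho0 tO CoV]]] := local_change_of_variables oO op hT uJ hB'.
rewrite Tp in CoV.
exists [set y | [/\ chart_dom a y, chart_dom b y, nv (chart_map a y - p) < t & nv (chart_map b y - q) < rho]].
  have n1 : nbhs x (chart_dom a) by apply: open_nbhs_nbhs; split=> //; exact: chart_dom_open.
  have n2 : nbhs x (chart_dom b) by apply: open_nbhs_nbhs; split=> //; exact: chart_dom_open.
  have n3 : nbhs x (chart_map a @^-1` [set w | nv (w - p) < t]).
    by apply: (chart_map_continuous ax); apply/nbhsVP; exists t.
  have n4 : nbhs x (chart_map b @^-1` [set w | nv (w - q) < rho]).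
    by apply: (chart_map_continuous bx); apply/nbhsVP; exists rho.
  by apply: filterS (filterI (filterI n1 n2) (filterI n3 n4)) => y [[? ?] [? ?]].
move=> f K hf cK KN f0.
have Kb : K `<=` chart_dom b by move=> y /KN [].
rewrite -(CoV _ (wclass_density hf cK Kb f0)); last first.
  move=> w hw; rewrite /density; have [bw|nbw] := pselect (chart_image b w); last exact: ext_out.
  rewrite ext_in // f0 ?mulr0 // => /KN [_ _ _].
  by rewrite map_inv // ltNge hw.
apply: eq_iC => z; have [tz|ntz] := pselect (nv (z - p) < t).
  have oz := tO z tz; have [az bz] := oz.
  rewrite /density ext_in // ext_in // /pull ext_in; last exact: transition_image.
  rewrite inv_transition // (transition_det (@metric_transition _ _ _ h a b) oz).
  by rewrite mulrAC.
rewrite [RHS]ext_out // /density; have [az|naz] := pselect (chart_image a z); last exact: ext_out.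
rewrite ext_in // f0 ?mulr0 // => /KN [_ _].
by rewrite map_inv.
Qed.

Lemma density_sum a (s : seq M) (F : M -> M -> C) z :
  density a (fun y => \sum_(x <- s) F x y) z = \sum_(x <- s) density a (F x) z.
Proof.
rewrite /density; have [az|naz] := pselect (chart_image a z).
  by rewrite ext_in // mulr_sumr; apply: eq_bigr => x _; rewrite ext_in.
by rewrite ext_out // big1 // => x _; rewrite ext_out.
Qed.

Lemma density_eq0 a f : (forall y, f y = 0) -> density a f =1 fun=> 0.
Proof.
move=> f0 z; rewrite /density; have [az|naz] := pselect (chart_image a z); last exact: ext_out.
by rewrite ext_in // f0 mulr0.
Qed.

Definition chart_at x : chart M := projT1 (cid (chart_cover x)).

Lemma chart_atP x : chart_dom (chart_at x) x.
Proof. by rewrite /chart_at; case: cid. Qed.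

(** The derivative of a function along the vector field, computed at each point in a chart chosen
    there; by [along_YE] the choice does not matter. *)
Definition along_Y f y : C :=
  Yd (h (chart_at y)) (fun z => f (chart_inv (chart_at y) z)) (chart_map (chart_at y) y).

Lemma along_YE a f z : cclass 2 f -> chart_image a z ->
  along_Y f (chart_inv a z) = Yd (h a) (fun w => f (chart_inv a w)) z.
Proof.
move=> hf az; set y := chart_inv a z; set b := chart_at y.
have by_ : chart_dom b y by exact: chart_atP.
have oz : overlap a b z by split.
have bz := transition_image oz.
have hoa : mclass 2 (overlap a b) (h a).
  by move=> i j; apply: wclass_sub (mclass_metric h 2 a i j) => w [].
have TE := @transition_Yd _ _ (overlap a b) (chart_image b) (transition a b) (h a) (h b)
   (@open_overlap _ _ _ a b) (@transition_image _ _ _ a b) (@holo_transition _ _ _ h n0 a b)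
   hoa (mclass_metric h 2 b)
   (fun z (oz : overlap a b z) => posdef_metric h (proj1 oz)) (fun z bz => posdef_metric h bz)
   (@metric_transition _ _ _ h a b) (fun w => f (chart_inv b w)) z oz
   (wclass_wdiff (hf b) bz).
rewrite /along_Y -/b -[chart_map b y]/(transition a b z) -TE /Yd.
apply: eq_bigr => l _; congr (_ * _).
have dl : wdiff (fun w => f (chart_inv a w)) z by exact: wclass_wdiff (hf a) az.
apply/esym; apply: near_eq_dzbar dl; apply: (open_near_eq (@open_overlap _ _ _ a b) oz) => w ow.
by rewrite inv_transition.
Qed.

Lemma cclass_along_Y f : cclass 2 f -> cclass 1 (along_Y f).
Proof.
move=> hf a; have oU := @open_image _ _ _ a.
apply: (wclass_eq oU (fun z az => esym (along_YE hf az))).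
apply: (wclass_sum oU) => l _; apply: (wclassM oU); last exact: wclass_dzbar (hf a).
exact: (wclass_Yv oU (mclass_metric h 2 a) (@posdef_metric _ _ _ h a)).
Qed.

Lemma along_Y_local f K : cclass 2 f -> closed K -> (forall y, ~ K y -> f y = 0) ->
  forall y, ~ K y -> along_Y f y = 0.
Proof.
move=> hf cK f0 y Ky; set b := chart_at y; have dy := chart_atP y.
rewrite /along_Y /Yd big1 // => l _.
have oN := @open_preimage _ _ _ b _ (closed_openC cK).
have Ny : [set z | chart_image b z /\ (~` K) (chart_inv b z)] (chart_map b y).
  by split; [exact: map_image|rewrite /= chart_mapK].
rewrite (_ : dzbar l _ _ = 0) ?mulr0 //.
rewrite -[RHS](dzbar_cst (0 : C) (chart_map b y) l); apply/esym/near_eq_dzbar; last exact: wdiff_cst.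
by apply: (open_near_eq oN Ny) => w [_ /= Kw]; rewrite f0.
Qed.

Lemma along_Y_sum (s : seq M) (F : M -> M -> C) (c : C) y : (forall x, cclass 2 (F x)) ->
  (forall y, \sum_(x <- s) F x y = c) -> \sum_(x <- s) along_Y (F x) y = 0.
Proof.
move=> hF hc; set b := chart_at y; have bz := map_image (chart_atP y).
rewrite /along_Y /Yd -/b exchange_big big1 // => l _; rewrite -mulr_sumr.
have dF x : wdiff (fun z => F x (chart_inv b z)) (chart_map b y) by exact: wclass_wdiff (hF x b) bz.
rewrite -(@dzbar_sum _ _ _ s xpredT (fun x z => F x (chart_inv b z)) _ l (fun x _ => dF x)).
have -> : (fun w => \sum_(x <- s) F x (chart_inv b w)) = fun=> c by apply/funext => w; exact: hc.
by rewrite dzbar_cst mulr0.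
Qed.

Definition divY a z : C := \sum_l dzbar l (fun w => \det (h a w) * Yv (h a) w l 0) z.

(** The function [f * det h * Y_l] is compactly supported in the chart, and the sum over [l] of its
    derivatives is the sum of the two integrands. *)
Lemma chart_stokes a f K (B b0 : R) : cclass 2 f -> compact K -> K `<=` chart_dom a ->
  (forall y, ~ K y -> f y = 0) -> 0 <= b0 -> b0 < B -> (forall y, K y -> nv (chart_map a y) <= b0) ->
  iC B (density a (along_Y f)) = - iC B (ext (chart_image a) (fun z => f (chart_inv a z) * divY a z)) /\
  continuous (ext (chart_image a) (fun z => f (chart_inv a z) * divY a z)).
Proof.
move=> hf cK Ka f0 b00 bB hK; have oU := @open_image _ _ _ a.
have Bp : 0 < B by exact: le_lt_trans b00 bB.
have cKa := compact_closed (@norm_hausdorff _ _) (map_compact Ka cK).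
have KU : chart_map a @` K `<=` chart_image a by move=> _ [y Ky <-]; exact: map_image (Ka _ Ky).
pose Phi z := f (chart_inv a z); pose X l z := \det (h a z) * Yv (h a) z l 0.
have Phi0 z : chart_image a z -> ~ (chart_map a @` K) z -> Phi z = 0.
  move=> az nz; rewrite /Phi f0 // => Kz; apply: nz.
  by exists (chart_inv a z) => //; exact: map_inv.
have hX l : wclass 1 (chart_image a) (X l).
  have h1 := wclass_Yv oU (mclass_metric h 2 a) (@posdef_metric _ _ _ h a) l.
  exact: (wclassM oU (wclass_det oU (mclass_metric h 1 a)) h1).
have hPhi : wclass 1 (chart_image a) Phi by exact: wclass_pred (hf a).
have hE l := wclassM oU hPhi (hX l).
have E0 l z : chart_image a z -> ~ (chart_map a @` K) z -> Phi z * X l z = 0.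
  by move=> az nz; rewrite Phi0 // mul0r.
pose E l := ext (chart_image a) (fun z => Phi z * X l z).
have cE l : wclass 1 setT (E l) := wclass_ext oU cKa KU (E0 l) (hE l).
have cdE l : continuous (dzbar l (E l)).
  by move=> z; exact: wclass_continuous (wclass_dzbar l (cE l)) I.
have K1 : 0 <= (b0 + B) / 2 by rewrite divr_ge0 // addr_ge0 // ltW.
have K2 : (b0 + B) / 2 < B by lra.
have intE l : iC B (dzbar l (E l)) = 0.
  apply: (iC_dz_dzbar l K1 K2 (cE l) _).2 => z i hz.
  apply: (ext_off (K := chart_map a @` K) (E0 l)) => -[y Ky yz].
  have := hK y Ky; have := le_crd i z; rewrite yz; lra.
have [sE csE] := iC_sum (index_enum 'I_n) Bp cdE.
rewrite [RHS]big1 in sE; last by move=> l _; exact: intE.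
have cK' := compact_closed (@carrier_hausdorff _ _ M) cK.
have c1 : continuous (density a (along_Y f)).
  exact: (continuous_density (cclass_along_Y hf) cK Ka (along_Y_local hf cK' f0)).
have hdiv : wclass 0 (chart_image a) (divY a).
  by apply: (wclass_sum oU) => l _; exact: wclass_dzbar (hX l).
have hPd := wclassM oU (wclass_pred hPhi) hdiv.
have PD0 z : chart_image a z -> ~ (chart_map a @` K) z -> Phi z * divY a z = 0.
  by move=> az nz; rewrite Phi0 // mul0r.
have c2 : continuous (ext (chart_image a) (fun z => Phi z * divY a z)).
  by move=> z; exact: wclass_continuous (wclass_ext oU cKa KU PD0 hPd) I.
split; last exact: c2.
apply/eqP; rewrite -addr_eq0 -(iCD Bp c1 c2) -sE; apply/eqP/eq_iC => z.
have pE l : dzbar l (E l) z = ext (chart_image a) (dzbar l (fun z => Phi z * X l z)) z.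
  exact: (pd_ext oU cKa KU true l z (E0 l) (hE l)).
under eq_bigr do rewrite pE.
have [az|naz] := pselect (chart_image a z); last first.
  by rewrite /density !ext_out // addr0 big1 // => l _; rewrite ext_out.
rewrite /density !ext_in // (along_YE hf az) /Yd /divY !mulr_sumr -big_split.
apply: eq_bigr => l _ /=; rewrite ext_in //.
rewrite (dzbarM l (wclass_wdiff hPhi az) (wclass_wdiff (hX l) az)) addrC.
rewrite addrC; congr (_ + _); rewrite /X mulrA mulrC //.
Qed.

End Integration.

Section NoPositiveDivergence.
Context {R : realType} {n : nat} {M : complex_manifold R n}.
Local Notation C := (R[i]).
Local Notation V := ('rV[C]_n).
Local Notation dir := ('I_n * bool)%type.
Variable h : hermitian_metric M.
Hypotheses (n0 : (0 < n)%N) (cM : compact [set: M]).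

Lemma chart_bounded (a : chart M) (K : set M) : compact K -> K `<=` chart_dom a ->
  exists2 b : R, 0 <= b & forall y, K y -> nv (chart_map a y) <= b.
Proof.
move=> cK Ka; have cV := map_compact Ka cK.
have [m m0 hm] : exists2 m : R, 0 <= m & forall (k : 'I_n) z, (chart_map a @` K) z -> nc (z 0 k) <= m.
  apply: (compact_family_bounded cV (f := fun (k : 'I_n) (z : V) => z 0 k)) => k z _.
  exact: continuous_coord.
exists (n%:R * m) => [|y Ky]; first by rewrite mulr_ge0.
apply: le_trans (_ : \sum_(k < n) m <= _); last by rewrite sumr_const card_ord mulr_natl.
by apply: ler_sum => k _; apply: hm; exists y.
Qed.

(** A partition of unity [phi] writes [1] as a sum of functions that live in single charts. The
    derivatives of the [phi x] along the field sum to zero. On the other hand the integral of each of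
    them is, by parts, the opposite of the integral of [phi x] times the divergence, which is
    negative. The second partition [psi] refines the first one finely enough for the integrals,
    computed in different charts, to be added under one integral sign. *)
Lemma no_positive_divergence (y0 : M) :
  ~ forall (a : chart M) z, chart_image a z -> 0 < divY h a z.
Proof.
move=> hdiv; pose a : M -> chart M := @chart_at R n M.
have da x : chart_dom (a x) x by exact: chart_atP.
have [s1 [phi [K1 [sum1 hphi]]]] := partition_of_unity h n0 cM da (fun x : M => @filterT _ (nbhs x) _).
have cK x : compact (K1 x) by case: (hphi x).
have Ka x : K1 x `<=` chart_dom (a x) by case: (hphi x) => _ H _ _ _ y /H [].
have phi0 x y : ~ K1 x y -> phi x y = 0 by case: (hphi x) => _ _ H _ _; exact: H.
have phi_ge0 x y : 0 <= phi x y by case: (hphi x).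
have cphi x : cclass 2 (fun y => (phi x y)%:C%C) by case: (hphi x).
have clK x : closed (K1 x) := compact_closed (@carrier_hausdorff _ _ M) (cK x).
have f0 x y : ~ K1 x y -> (phi x y)%:C%C = 0 :> C by move=> /phi0 ->.
pose g x := along_Y h (fun y => (phi x y)%:C%C).
have cg x : cclass 1 (g x) := cclass_along_Y h n0 (cphi x).
have g0 x y : ~ K1 x y -> g x y = 0 by exact: along_Y_local (cphi x) (clK x) (f0 x) y.
have [bx hbx] : exists bx : M -> R, forall x, 0 <= bx x /\ forall y, K1 x y -> nv (chart_map (a x) y) <= bx x.
  have H x : exists b : R, 0 <= b /\ forall y, K1 x y -> nv (chart_map (a x) y) <= b.
    by have [b b0 hb] := chart_bounded (cK x) (@Ka x); exists b.
  by have [bx H'] := boolp.choice H; exists bx.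
pose b0 : R := \sum_(x <- s1) bx x.
have b00 : 0 <= b0 by apply: sumr_ge0 => x _; exact: (hbx x).1.
have hb0 x y : x \in s1 -> K1 x y -> nv (chart_map (a x) y) <= b0.
  move=> xs /((hbx x).2 y) hy; apply: le_trans hy _.
  rewrite /b0 (perm_big _ (perm_to_rem xs)) big_cons lerDl.
  by apply: sumr_ge0 => z _; exact: (hbx z).1.
(* One box that is large enough for all the changes of charts. *)
pose B : R := 1 + b0 + (size (index_enum dir)).+1%:R * (2 * b0).
have bB : b0 < B.
  have : 0 <= (size (index_enum dir)).+1%:R * (2 * b0) by rewrite !mulr_ge0.
  by move=> t0; rewrite /B addrAC ltrDr ltr_pwDl.
have Bp : 0 < B by exact: le_lt_trans b00 bB.
have exj y : exists x, x \in s1 /\ 0 < phi x y.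
  have [x xs px] : exists2 x, x \in s1 & phi x y != 0.
    apply/hasP; apply: contraT => /hasPn hn; have := sum1 y.
    rewrite big_seq big1 => [/eqP|x xs]; first by rewrite eq_sym oner_eq0.
    by apply/eqP; rewrite -[_ == _]negbK; exact: hn.
  by exists x; split=> //; rewrite lt_neqAle eq_sym px phi_ge0.
have [j hj] := boolp.choice exj.
have Kj y : K1 (j y) y.
  by apply: contrapT => /phi0 h0; have := (hj y).2; rewrite h0 ltxx.
pose c y := a (j y).
(* Near [y] integrals in the chart of any of the finitely many [phi x] can be computed in the
   chart [c y]. *)
have exN (yx : M * M) : exists N : set M, nbhs yx.1 N /\ (yx.2 \in s1 ->
    forall (f : M -> C) K, cclass 1 f -> compact K -> K `<=` N -> (forall y, ~ K y -> f y = 0) ->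
    (forall y, ~ K1 yx.2 y -> f y = 0) ->
    iC B (density h (a yx.2) f) = iC B (density h (c yx.1) f)).
  case: yx => y x /=; have [xs|nxs] := boolP (x \in s1); last first.
    by exists setT; split=> //; exact: filterT.
  have [Kxy|nKxy] := pselect (K1 x y).
    have hB : 1 + nv (chart_map (c y) y) + (size (index_enum dir)).+1%:R *
        nv (chart_map (c y) y - chart_map (a x) y) <= B.
      have h1 := hb0 _ _ (hj y).1 (Kj y); have h2 := hb0 _ _ xs Kxy.
      apply: lerD; first by rewrite lerD2l.
      apply: ler_wpM2l => //; have := nvD (chart_map (c y) y) (- chart_map (a x) y).
      rewrite nvN /c; lra.
    have [N nN hN] := chart_independence h n0 (Ka _ _ Kxy) (Ka _ _ (Kj y)) hB.
    exists N; split; first exact: nN.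
    by move=> _ f K hf cK' KN fK _; exact: (hN f K hf cK' KN fK).
  exists (~` K1 x); split.
    by apply: open_nbhs_nbhs; split=> //; exact: closed_openC.
  move=> _ f K _ _ KN fK fK1.
  have fz y' : f y' = 0.
    by have [Ky'|nKy'] := pselect (K y'); [apply: fK1; exact: KN|exact: fK].
  by rewrite (eq_iC _ (density_eq0 h (a x) fz)) (eq_iC _ (density_eq0 h (c y) fz)).
have [N hN] := boolp.choice exN.
have nN y : nbhs y [set u | forall x, x \in s1 -> N (y, x) u].
  elim: (s1) => [|x s IH]; first by apply: filterS (@filterT _ (nbhs y) _) => u _ x.
  apply: filterS (filterI (hN (y, x)).1 IH) => u [Nu Hu] x'.
  by rewrite inE => /orP [/eqP ->|/Hu].
have dc y : chart_dom (c y) y by exact: Ka (Kj y).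
have [s2 [psi [K2 [sum2 hpsi]]]] := partition_of_unity h n0 cM dc nN.
have cK2 m : compact (K2 m) by case: (hpsi m).
have psi0 m y : ~ K2 m y -> psi m y = 0 by case: (hpsi m) => _ _ H _ _; exact: H.
have Kc m : K2 m `<=` chart_dom (c m) by case: (hpsi m) => _ H _ _ _ y /H [].
have KN2 m x : x \in s1 -> K2 m `<=` N (m, x).
  by case: (hpsi m) => _ H _ _ _ xs y /H [Hy _]; exact: Hy.
have cpsi m : cclass 1 (fun y => (psi m y)%:C%C) by case: (hpsi m) => _ _ _ _ H; exact: cclass_pred.
pose G m x y := (psi m y)%:C%C * g x y.
have cG m x : cclass 1 (G m x) by exact: cclassM (cpsi m) (cg x).
have G01 m x y : ~ K1 x y -> G m x y = 0 by move=> /g0 hg; rewrite /G hg mulr0.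
have G02 m x y : ~ K2 m y -> G m x y = 0 by move=> /psi0 hp; rewrite /G hp mul0r.
(* The pieces [psi m * Y (phi x)] are moved from the chart of [x] to that of [m]. *)
have step x : x \in s1 -> iC B (density h (a x) (g x)) =
    \sum_(m <- s2) iC B (density h (c m) (G m x)).
  move=> xs; have cont m : continuous (density h (a x) (G m x)).
    exact: (continuous_density (cG m x) (cK x) (@Ka x) (G01 m x)).
  have [iE _] := iC_sum s2 Bp cont.
  transitivity (\sum_(m <- s2) iC B (density h (a x) (G m x))).
    rewrite -iE; apply: eq_iC => z; rewrite -density_sum; congr (density h (a x) _ z).
    apply/funext => y; rewrite /G -mulr_suml -[LHS]mul1r; congr (_ * _).
    by rewrite -(rmorph_sum (real_complex R)) /= sum2.
  apply: eq_bigr => m _.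
  exact: ((hN (m, x)).2 xs (G m x) (K2 m) (cG m x) (cK2 m) (KN2 m x xs) (G02 m x) (G01 m x)).
have total : \sum_(x <- s1) iC B (density h (a x) (g x)) = 0.
  rewrite big_seq; under eq_bigr => x xs do rewrite step //.
  rewrite -big_seq exchange_big big1 // => m _.
  have cont x : continuous (density h (c m) (G m x)).
    exact: (continuous_density (cG m x) (cK2 m) (@Kc m) (G02 m x)).
  have [iE _] := iC_sum s1 Bp cont.
  rewrite -iE; transitivity (iC B (fun _ : 'rV[C]_n => 0)); last exact: iC0.
  apply: eq_iC => z; rewrite -density_sum.
  apply: density_eq0 => y; rewrite /G -mulr_sumr.
  rewrite (along_Y_sum h (c := 1) (F := fun x y => (phi x y)%:C%C)) ?mulr0 // => y'.
  by rewrite -(rmorph_sum (real_complex R)) /= sum1.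
pose P x := iC B (ext (chart_image (a x)) (fun z => (phi x (chart_inv (a x) z))%:C%C * divY h (a x) z)).
have stokes x : x \in s1 -> iC B (density h (a x) (g x)) = - P x /\
    continuous (ext (chart_image (a x)) (fun z => (phi x (chart_inv (a x) z))%:C%C * divY h (a x) z)).
  move=> xs; apply: (chart_stokes h n0 (cphi x) (cK x) (@Ka x) (f0 x) b00 bB) => y Ky.
  exact: hb0.
have Pgt x : x \in s1 -> (exists y, 0 < phi x y) -> 0 < P x.
  move=> xs [y hy]; have [_] := stokes x xs; rewrite /P; set e := ext _ _ => ce.
  have e_ge0 z : 0 <= e z.
    rewrite /e; have [az|naz] := pselect (chart_image (a x) z); last by rewrite ext_out.
    by rewrite ext_in // mulr_ge0 ?lecR ?phi_ge0 // ltW // hdiv.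
  have eE : e = fun z => (complex.Re (e z))%:C%C.
    apply/funext => z; have := e_ge0 z; rewrite lecE => /andP [/eqP h0 _].
    by move: h0; case: (e z) => u v /= ->.
  have Ky : K1 x y by apply: contrapT => /phi0 h0; move: hy; rewrite h0 ltxx.
  have dy := Ka x y Ky.
  rewrite eE; apply: (iC_gt0 Bp (z0 := chart_map (a x) y) (continuous_Re ce)).
  - by move=> z; have := e_ge0 z; rewrite lecE => /andP [].
  - have : 0 < e (chart_map (a x) y).
      rewrite /e ext_in; last exact: map_image.
      rewrite chart_mapK // mulr_gt0 ?ltcR //; apply: hdiv; exact: map_image.
    by rewrite ltcE => /andP [].
  - move=> i; apply: le_lt_trans (le_crd _ _) _; apply: le_lt_trans bB; exact: hb0.
have Pge x : x \in s1 -> 0 <= P x.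
  move=> xs; have [ex|nex] := pselect (exists y, 0 < phi x y); first exact/ltW/Pgt.
  rewrite /P (_ : ext _ _ = fun=> 0) ?iC0 //; apply/funext => z.
  have pz y : phi x y = 0.
    by apply/eqP; rewrite eq_le phi_ge0 andbT leNgt; apply/negP => hy; apply: nex; exists y.
  have [az|naz] := pselect (chart_image (a x) z); last by rewrite ext_out.
  by rewrite ext_in // pz mul0r.
have [xs hx] := hj y0.
have : 0 < \sum_(x <- s1) P x.
  rewrite (perm_big _ (perm_to_rem xs)) big_cons; apply: ltr_pwDl; first by apply: Pgt => //; exists y0.
  by rewrite big_seq; apply: sumr_ge0 => x /mem_rem /Pge.
have -> : \sum_(x <- s1) P x = - \sum_(x <- s1) iC B (density h (a x) (g x)).
  rewrite -sumrN big_seq [RHS]big_seq; apply: eq_bigr => x xs'.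
  by rewrite (stokes x xs').1 opprK.
by rewrite total oppr0 ltxx.
Qed.

End NoPositiveDivergence.

(** * The theorem *)

Lemma posdef_diag (R : realType) (n : nat) (H : 'M[R[i]]_n) k : posdef H -> 0 < H k k.
Proof.
move=> [_ /(_ (delta_mx 0 k))]; have d0 : delta_mx 0 k != 0 :> 'rV[R[i]]_n.
  by apply/eqP => /matrixP /(_ 0 k); rewrite !mxE !eqxx => /eqP; rewrite oner_eq0.
move=> /(_ d0); rewrite -rowE mxE (bigD1 k) //= ctrE !mxE !eqxx conjc1 mulr1.
by rewrite big1 ?addr0 // => j jk; rewrite ctrE [delta_mx _ _ _ _]mxE (negPf jk) andbF conjc0 mulr0.
Qed.

(** Projective flatness passes from [h] to the conformal metric, and the local computation applies
    to the latter. *)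
Lemma divY_gt0 (R : realType) (n : nat) (M : complex_manifold R n) (h h' : hermitian_metric M) :
  (2 <= n)%N -> projectively_flat h -> conformal_class h h' -> negative_chern_scalar h' ->
  forall (a : chart M) z, chart_image a z -> 0 < divY h' a z.
Proof.
move=> n2 hflat [u _ hu] hneg a z az.
have oU := @open_image _ _ _ a; pose i0 : 'I_n := Ordinal (ltnW n2).
have hH := mclass_metric h 2 a; have hH' := mclass_metric h' 2 a.
have pH w : chart_image a w -> posdef (h a w) by exact: posdef_metric.
have pH' w : chart_image a w -> posdef (h' a w) by exact: posdef_metric.
(* The conformal factor, written so that its regularity is that of the metrics. *)
pose E w := h' a w i0 i0 / h a w i0 i0.
have H0 w : chart_image a w -> h a w i0 i0 != 0 by move=> /pH /(posdef_diag i0) /lt0r_neq0.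
have E0 w : chart_image a w -> E w != 0.
  by move=> aw; rewrite mulf_neq0 ?invr_eq0 ?H0 //; have /(posdef_diag i0) /lt0r_neq0 := pH' w aw.
have hE w : chart_image a w -> h' a w = E w *: h a w by move=> aw; rewrite /E hu // mxE mulfK // H0.
have cE : wclass 2 (chart_image a) E.
  exact: (wclassM oU (hH' i0 i0) (wclassV oU H0 (hH i0 i0))).
have hr w : chart_image a w -> forall k l,
    Dm true l (Gam (h a) k) w = - (n%:R^-1 * ricci1 (h a) k l w)%:M.
  move=> aw; apply: (flat_connection oU hH pH aw) => i j k l; exact: hflat.
have hr' := conformal_flat oU hH hH' pH cE E0 hE hr.
exact: (div_Y_gt0 oU hH' pH' hr' az n2 (hneg a z az)).
Qed.

Theorem theorem3p1 (R : realType) (n : nat) (hn : (2 <= n)%N)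
    (M : complex_manifold R n) (M_nonempty : [set: M] !=set0)
    (M_compact : compact [set: M]) :
  ~ exists h : hermitian_metric M, negative_projectively_flat h.
Proof.
move=> [h [hflat [h' hconf hneg]]]; have [y0 _] := M_nonempty.
apply: (@no_positive_divergence _ _ _ h' (ltnW hn) M_compact y0).
exact: divY_gt0 hn hflat hconf hneg.
Qed.
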